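(* Let $\mathcal Z_\nu$ be the Zorich map described in the context, built with bi-Lipschitz constant $L$ and scale factor $\lambda$. Suppose $\lambda>L^{5}$ and $\nu>\sqrt{2L/\lambda}$. Then $\mathcal J(\mathcal Z_\nu)=\mathbb R^3$. More strongly, for every nonempty open set $V\subset\mathbb R^3$ one has $\bigcup_{n\ge0}\mathcal Z_\nu^n(V)\supset\mathbb R^3\setminus\{0\}$.
   Context: Zorich maps. Let $Q=\{(x_1,x_2)\in\mathbb R^2:|x_1|\le1,|x_2|\le1\}$. Let $L\ge1$ and let $\mathfrak h=(\mathfrak h_1,\mathfrak h_2,\mathfrak h_3)$ be a sense-preserving $L$-bi-Lipschitz map (i.e. $|a-b|/L\le|\mathfrak h(a)-\mathfrak h(b)|\le L|a-b|$) of $Q$ onto the closed upper unit hemisphere $\{x\in\mathbb R^3:|x|=1,x_3\ge0\}$, with $\partial Q$ mapped onto the equator. Assume $\mathfrak h_1(t,t)=\mathfrak h_2(t,t)$ and $\mathfrak h_1(t,-t)=-\mathfrak h_2(t,-t)$ for $t\in[-1,1]$ (so $\mathfrak h(0,0)=(0,0,1)$). Let $\lambda\ge1$ and $h(x_1,x_2)=\lambda\mathfrak h(x_1/\lambda,x_2/\lambda)$ on $\lambda Q=[-\lambda,\lambda]^2$. For $\nu>0$ set $\mathcal Z_\nu(x_1,x_2,x_3)=\nu e^{x_3}h(x_1,x_2)$ on $\lambda Q\times\mathbb R$ (which is mapped onto $\{x_3\ge0\}$), and extend $\mathcal Z_\nu$ to $\mathbb R^3$ by repeated reflection: in the domain across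 the faces $x_1=(2k+1)\lambda$, $x_2=(2k+1)\lambda$ ($k\in\mathbb Z$) of the beams, and in the range across the plane $x_3=0$. The resulting $\mathcal Z_\nu:\mathbb R^3\to\mathbb R^3$ is quasiregular with an essential singularity at infinity, and $\mathfrak h$, $h$ extend by the same reflections to $L$-Lipschitz maps on $\mathbb R^2$. Julia set. For a quasiregular map $f:\mathbb R^3\to\mathbb R^3$ with essential singularity at infinity, $\mathcal J(f)$ is the set of $x\in\mathbb R^3$ such that $\operatorname{cap}\big(\mathbb R^3\setminus\bigcup_{k\ge1}f^k(U)\big)=0$ for every neighbourhood $U$ of $x$. Here, for an open $A$ and compact $C\subset A$, $\operatorname{cap}(A,C)=\inf_u\int_A|\nabla u|^3\,dm$ over nonnegative $u\in C_0^\infty(A)$ with $u\ge1$ on $C$; a compact $C$ has zero capacity if $\operatorname{cap}(A,C)=0$ for some bounded open $A\supset C$, and an arbitrary set has zero capacity if all its compact subsets do. *)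

(* Defs.v *)
From Stdlib Require Import Reals ZArith List.
From Coquelicot Require Import Coquelicot.
Open Scope R_scope.

Definition R2 := (R * R)%type.
Definition R3 := (R * R * R)%type.
Definition p1 (x : R3) : R := fst (fst x).
Definition p2 (x : R3) : R := snd (fst x).
Definition p3 (x : R3) : R := snd x.

Definition norm2 (a : R2) : R := sqrt (fst a ^ 2 + snd a ^ 2).
Definition dist2 (a b : R2) : R := norm2 (fst a - fst b, snd a - snd b).
Definition norm3 (x : R3) : R := sqrt (p1 x ^ 2 + p2 x ^ 2 + p3 x ^ 2).
Definition dist3 (x y : R3) : R := norm3 (p1 x - p1 y, p2 x - p2 y, p3 x - p3 y).
Definition origin3 : R3 := (0, 0, 0).

Definition open3 (A : R3 -> Prop) : Prop :=
  forall x, A x -> exists r, 0 < r /\ forall y, dist3 x y < r -> A y.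
Definition closed3 (A : R3 -> Prop) : Prop := open3 (fun x => ~ A x).
Definition bounded3 (A : R3 -> Prop) : Prop :=
  exists M, forall x, A x -> norm3 x <= M.
Definition compact3 (K : R3 -> Prop) : Prop := closed3 K /\ bounded3 K.
Definition cont3 (f : R3 -> R) (x : R3) : Prop :=
  forall eps, 0 < eps -> exists d, 0 < d /\
    forall y, dist3 x y < d -> Rabs (f y - f x) < eps.

Inductive coord := C1 | C2 | C3.

Definition pd (i : coord) (u : R3 -> R) (x : R3) : R :=
  match i with
  | C1 => Derive (fun t => u (t, p2 x, p3 x)) (p1 x)
  | C2 => Derive (fun t => u (p1 x, t, p3 x)) (p2 x)
  | C3 => Derive (fun t => u (p1 x, p2 x, t)) (p3 x)
  end.

Definition ex_pd (i : coord) (u : R3 -> R) (x : R3) : Prop :=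
  match i with
  | C1 => ex_derive (fun t => u (t, p2 x, p3 x)) (p1 x)
  | C2 => ex_derive (fun t => u (p1 x, t, p3 x)) (p2 x)
  | C3 => ex_derive (fun t => u (p1 x, p2 x, t)) (p3 x)
  end.

Fixpoint iterpd (l : list coord) (u : R3 -> R) : R3 -> R :=
  match l with
  | nil => u
  | i :: l' => pd i (iterpd l' u)
  end.

Definition smooth3 (u : R3 -> R) : Prop :=
  forall l, (forall x, cont3 (iterpd l u) x) /\
            (forall i x, ex_pd i (iterpd l u) x).

Definition grad_norm (u : R3 -> R) (x : R3) : R :=
  sqrt (pd C1 u x ^ 2 + pd C2 u x ^ 2 + pd C3 u x ^ 2).

Definition admissible (A C : R3 -> Prop) (u : R3 -> R) : Prop :=
  smooth3 u /\ (forall x, 0 <= u x) /\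
  (exists K, compact3 K /\ (forall x, K x -> A x) /\ (forall x, ~ K x -> u x = 0)) /\
  (forall x, C x -> 1 <= u x).

Definition in_cube (M : R) (x : R3) : Prop :=
  Rabs (p1 x) <= M /\ Rabs (p2 x) <= M /\ Rabs (p3 x) <= M.

(* Integral over the cube [-M,M]^3 (iterated Riemann integral); for a
   continuous function vanishing outside the cube this is its Lebesgue integral
   over R^3. *)
Definition cube_integral (M : R) (f : R3 -> R) : R :=
  RInt (fun a => RInt (fun b => RInt (fun c => f (a, b, c)) (- M) M) (- M) M) (- M) M.

Definition cap_zero_in (A C : R3 -> Prop) : Prop :=
  forall eps, 0 < eps -> exists u M,
    admissible A C u /\ (forall x, ~ in_cube M x -> u x = 0) /\
    cube_integral M (fun x => grad_norm u x ^ 3) < eps.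

Definition compact_cap_zero (C : R3 -> Prop) : Prop :=
  exists A, open3 A /\ bounded3 A /\ (forall x, C x -> A x) /\ cap_zero_in A C.

Definition cap_zero (E : R3 -> Prop) : Prop :=
  forall C, compact3 C -> (forall x, C x -> E x) -> compact_cap_zero C.

Definition in_julia (f : R3 -> R3) (x : R3) : Prop :=
  forall U, open3 U -> U x ->
    cap_zero (fun y => ~ exists (k : nat) z, (1 <= k)%nat /\ U z /\ Nat.iter k f z = y).

Definition inQ (a : R2) : Prop := Rabs (fst a) <= 1 /\ Rabs (snd a) <= 1.
Definition onbdQ (a : R2) : Prop := inQ a /\ (Rabs (fst a) = 1 \/ Rabs (snd a) = 1).

Definition sq_path (s : R) : R2 :=
  if Rle_dec s 2 then (1, -1 + s)
  else if Rle_dec s 4 then (3 - s, 1)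
  else if Rle_dec s 6 then (-1, 5 - s)
  else (s - 7, -1).

(* A homeomorphism of Q onto the upper hemisphere (oriented by the outward
   normal, i.e. so that the projection (x1,x2,x3) |-> (x1,x2) onto the closed
   unit disk is orientation preserving) is sense-preserving iff the boundary
   of Q, traversed counterclockwise, is mapped onto the equator with winding
   number +1 (degree +1). *)
Definition sense_preserving (hf : R2 -> R3) : Prop :=
  exists th : R -> R,
    (forall s, 0 <= s <= 8 -> continuity_pt th s) /\
    (forall s, 0 <= s <= 8 ->
        p1 (hf (sq_path s)) = cos (th s) /\ p2 (hf (sq_path s)) = sin (th s)) /\
    th 8 - th 0 = 2 * PI.

(* t lies in [(2k-1) lam, (2k+1) lam] for k = fold_k lam t *)
Definition fold_k (lam t : R) : Z := Int_part ((t + lam) / (2 * lam)).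
Definition sgnZ (k : Z) : R := if Z.even k then 1 else -1.
Definition fold (lam t : R) : R := sgnZ (fold_k lam t) * (t - 2 * IZR (fold_k lam t) * lam).

(* Z_nu(x) = nu e^{x3} h(x1,x2) with h(y) = lam * hf(y/lam) on the beam
   [-lam,lam]^2 x R, extended by reflections in the faces of the beams
   (domain) and in the plane x3 = 0 (range). *)
Definition zorich (hf : R2 -> R3) (lam nu : R) (x : R3) : R3 :=
  let q := (fold lam (p1 x) / lam, fold lam (p2 x) / lam) in
  let s := sgnZ (fold_k lam (p1 x)) * sgnZ (fold_k lam (p2 x)) in
  let y := hf q in
  let r := nu * exp (p3 x) * lam in
  (r * p1 y, r * p2 y, r * (s * p3 y)).

(* Main.v *)
(* Write |x|_h for the horizontal norm.  On a beam the Zorich map Z multiplies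
   volume by at least (nu e^x3)^3 lam / L^2, while |Z x|_h <= nu L e^x3 |x|_h; hence
   Z expands the measure |x|_h^-3 dx by the factor lam / L^5 > 1.  If no iterate
   of an open set V met the planes x1 = +-x2, the iterates of V would stay in
   the diamonds cut out by the preimages of these planes, where Z is injective.
   The parts of such diamonds off the x3-axis and above a fixed height, with
   image in a diamond, have bounded measure, so by Borel-Cantelli some orbit
   leaves them for good; but an orbit off the axis cannot stay close to it, as
   it moves up along the axis and is repelled.  So V meets the planes, and the
   same argument in a plane, where the folding costs a factor 2 and the
   expansion is lam / L^3 > L^2 >= 2, gives a point that reaches the axis.
   Neighbourhoods of the axis grow until they contain a thick cylinder, whose
   second image contains any given point other than 0.  The Julia set
   statement follows because a point has zero 3-capacity.

   The sharp area bound for Lipschitz maps that this needs is obtained without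
   differentiation: in logarithmic polar coordinates the inverse branches of Z
   are Lipschitz maps followed by linear ones, and an l-Lipschitz map of space
   multiplies outer content by at most l^3. *)
Require Import Defs.
From Stdlib Require Import Reals.
From Coquelicot Require Import Coquelicot.
From Stdlib Require Import Lra Lia Psatz ZArith List Classical ClassicalEpsilon.
From Stdlib Require Import FunctionalExtensionality.
Open Scope R_scope.

(** * Euclidean distance and finite sums *)

(** The condition [L ^ 5 < lam] leaves no room for constants: two powers of [L] come from the
    inverse branches and three from the weight, so the change-of-variables estimates must be sharp.
    This rules out covers by cubes, whose Lipschitz images are controlled only through their
    diameters; covers by balls are used, with total content close to that of the box. The exponent
    of the weight is forced: volume grows like the cube of [rad] and the horizontal norm at most
    like [rad], so that a weight of degree -3 (degree -2 in a plane) cancels the unbounded factor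
    [exp x3]. Measure is replaced by finite box covers, with compactness of the starting box in
    place of countable subadditivity. The condition on [nu] enters as [4 / 3 <= nu * lam], which
    makes points near the axis climb by at least 1 per step. At the faces of the beams [fold_k]
    jumps and a point belongs to two beams; there the third coordinate of [hf] vanishes, which
    removes the ambiguity. *)

Lemma p1E a b c : p1 (a, b, c) = a. Proof. reflexivity. Qed.
Lemma p2E a b c : p2 (a, b, c) = b. Proof. reflexivity. Qed.
Lemma p3E a b c : p3 (a, b, c) = c. Proof. reflexivity. Qed.
Ltac proj3 := rewrite ?p1E, ?p2E, ?p3E.
Tactic Notation "proj3" "in" hyp(H) := rewrite ?p1E, ?p2E, ?p3E in H.

Lemma sqrt_le_iff (s r : R) : 0 <= s -> 0 <= r -> (sqrt s <= r <-> s <= r ^ 2).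
Proof.
  intros Hs Hr. split; intros H.
  - rewrite <- (sqrt_sqrt s Hs). pose proof (sqrt_pos s). simpl; nra.
  - rewrite <- (sqrt_pow2 r Hr). now apply sqrt_le_1_alt.
Qed.

Lemma norm3_sq (x : R3) : norm3 x ^ 2 = p1 x ^ 2 + p2 x ^ 2 + p3 x ^ 2.
Proof. unfold norm3. rewrite pow2_sqrt; [reflexivity | nra]. Qed.

Lemma norm3_pos (x : R3) : 0 <= norm3 x.
Proof. apply sqrt_pos. Qed.

Lemma norm3_le (x : R3) (r : R) : 0 <= r ->
  (norm3 x <= r <-> p1 x ^ 2 + p2 x ^ 2 + p3 x ^ 2 <= r ^ 2).
Proof. intros Hr. apply sqrt_le_iff; [nra | exact Hr]. Qed.

Lemma dist3_sq (x y : R3) :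
  dist3 x y ^ 2 = (p1 x - p1 y) ^ 2 + (p2 x - p2 y) ^ 2 + (p3 x - p3 y) ^ 2.
Proof. unfold dist3. now rewrite norm3_sq. Qed.

Lemma dist3_pos (x y : R3) : 0 <= dist3 x y.
Proof. apply norm3_pos. Qed.

Lemma dist3_le (x y : R3) (r : R) : 0 <= r ->
  (dist3 x y <= r <->
   (p1 x - p1 y) ^ 2 + (p2 x - p2 y) ^ 2 + (p3 x - p3 y) ^ 2 <= r ^ 2).
Proof. intros Hr. unfold dist3. rewrite norm3_le; [reflexivity | exact Hr]. Qed.

Lemma dist3_sym (x y : R3) : dist3 x y = dist3 y x.
Proof. unfold dist3, norm3, p1, p2, p3; simpl. f_equal. ring. Qed.

Lemma dist3_refl (x : R3) : dist3 x x = 0.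
Proof.
  pose proof (dist3_pos x x). apply Rle_antisym; [|assumption].
  apply dist3_le; [lra|]. nra.
Qed.

Lemma norm3_dist (x : R3) : norm3 x = dist3 x origin3.
Proof. unfold dist3, norm3, origin3, p1, p2, p3; simpl. f_equal; ring. Qed.

Lemma Rabs_le_of_sq (a r : R) : 0 <= r -> a ^ 2 <= r ^ 2 -> Rabs a <= r.
Proof.
  intros Hr H. rewrite <- (Rabs_pos_eq r Hr). apply Rsqr_le_abs_0.
  unfold Rsqr. lra.
Qed.

Lemma dist3_tri (x y z : R3) : dist3 x z <= dist3 x y + dist3 y z.
Proof.
  pose proof (dist3_pos x y) as A. pose proof (dist3_pos y z) as B.
  apply dist3_le; [lra|].
  pose proof (dist3_sq x y) as SA. pose proof (dist3_sq y z) as SB.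
  set (a := dist3 x y) in *; set (b := dist3 y z) in *.
  set (u1 := p1 x - p1 y) in *; set (u2 := p2 x - p2 y) in *; set (u3 := p3 x - p3 y) in *.
  set (v1 := p1 y - p1 z) in *; set (v2 := p2 y - p2 z) in *; set (v3 := p3 y - p3 z) in *.
  replace (p1 x - p1 z) with (u1 + v1) by (unfold u1, v1; ring).
  replace (p2 x - p2 z) with (u2 + v2) by (unfold u2, v2; ring).
  replace (p3 x - p3 z) with (u3 + v3) by (unfold u3, v3; ring).
  assert (C : Rabs (u1 * v1 + u2 * v2 + u3 * v3) <= a * b).
  { apply Rabs_le_of_sq; [nra|]. replace ((a * b) ^ 2) with (a ^ 2 * b ^ 2) by ring.
    rewrite SA, SB.
    pose proof (pow2_ge_0 (u1 * v2 - u2 * v1)). pose proof (pow2_ge_0 (u1 * v3 - u3 * v1)).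
    pose proof (pow2_ge_0 (u2 * v3 - u3 * v2)). nra. }
  pose proof (Rle_abs (u1 * v1 + u2 * v2 + u3 * v3)).
  replace ((a + b) ^ 2) with (a ^ 2 + b ^ 2 + 2 * (a * b)) by ring. rewrite SA, SB. lra.
Qed.

Lemma dist3_p1 (x y : R3) : Rabs (p1 x - p1 y) <= dist3 x y.
Proof. apply Rabs_le_of_sq; [apply dist3_pos|]. rewrite dist3_sq.
  pose proof (pow2_ge_0 (p1 x - p1 y)); pose proof (pow2_ge_0 (p2 x - p2 y));
  pose proof (pow2_ge_0 (p3 x - p3 y)). lra. Qed.
Lemma dist3_p2 (x y : R3) : Rabs (p2 x - p2 y) <= dist3 x y.
Proof. apply Rabs_le_of_sq; [apply dist3_pos|]. rewrite dist3_sq.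
  pose proof (pow2_ge_0 (p1 x - p1 y)); pose proof (pow2_ge_0 (p2 x - p2 y));
  pose proof (pow2_ge_0 (p3 x - p3 y)). lra. Qed.
Lemma dist3_p3 (x y : R3) : Rabs (p3 x - p3 y) <= dist3 x y.
Proof. apply Rabs_le_of_sq; [apply dist3_pos|]. rewrite dist3_sq.
  pose proof (pow2_ge_0 (p1 x - p1 y)); pose proof (pow2_ge_0 (p2 x - p2 y));
  pose proof (pow2_ge_0 (p3 x - p3 y)). lra. Qed.

Lemma dist3_le_sum (x y : R3) :
  dist3 x y <= Rabs (p1 x - p1 y) + Rabs (p2 x - p2 y) + Rabs (p3 x - p3 y).
Proof.
  pose proof (Rabs_pos (p1 x - p1 y)). pose proof (Rabs_pos (p2 x - p2 y)).
  pose proof (Rabs_pos (p3 x - p3 y)).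
  apply dist3_le; [lra|].
  rewrite <- (pow2_abs (p1 x - p1 y)), <- (pow2_abs (p2 x - p2 y)), <- (pow2_abs (p3 x - p3 y)).
  nra.
Qed.

Lemma R3_eta (x : R3) : x = (p1 x, p2 x, p3 x).
Proof. now destruct x as [[a b] c]. Qed.

Lemma inf_exists (P : R -> Prop) : (exists x, P x) -> (forall x, P x -> 0 <= x) ->
  exists m, 0 <= m /\ (forall x, P x -> m <= x) /\ (forall e, 0 < e -> exists x, P x /\ x < m + e).
Proof.
  intros [x0 H0] Hpos.
  destruct (completeness (fun y => P (- y))) as [s [Hub Hlub]].
  - exists 0. intros y Hy. specialize (Hpos _ Hy). lra.
  - exists (- x0). now rewrite Ropp_involutive.
  - exists (- s). split; [|split].
    + assert (s <= 0); [|lra]. apply Hlub. intros y Hy. specialize (Hpos _ Hy). lra.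
    + intros x Hx. assert (- x <= s); [|lra]. apply Hub. now rewrite Ropp_involutive.
    + intros e He. apply NNPP. intros Hn.
      assert (s <= s - e); [|lra]. apply Hlub. intros y Hy. apply Rnot_lt_le. intros Hlt.
      apply Hn. exists (- y). split; [assumption|lra].
Qed.

Lemma Rle_of_eps (a b : R) : (forall e, 0 < e -> a <= b + e) -> a <= b.
Proof.
  intros H. apply Rnot_lt_le. intros Hlt. specialize (H ((a - b) / 2) ltac:(lra)). lra.
Qed.

Lemma INR_large (r : R) : exists n : nat, (1 <= n)%nat /\ r < INR n.
Proof.
  destruct (INR_unbounded r) as [n Hn]. exists (S n). split; [lia|].
  rewrite S_INR. lra.
Qed.

Definition lsum {T : Type} (f : T -> R) (l : list T) : R :=
  fold_right (fun x s => f x + s) 0 l.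

Lemma lsum_app {T} (f : T -> R) l1 l2 : lsum f (l1 ++ l2) = lsum f l1 + lsum f l2.
Proof. induction l1 as [|x l IH]; simpl; [ring|]. unfold lsum in *. rewrite IH. ring. Qed.

Lemma lsum_le {T} (f g : T -> R) l : (forall x, In x l -> f x <= g x) -> lsum f l <= lsum g l.
Proof.
  induction l as [|x l IH]; simpl; intros H; [lra|].
  apply Rplus_le_compat; [apply H; now left | apply IH; intros; apply H; now right].
Qed.

Lemma lsum_ext {T} (f g : T -> R) l : (forall x, In x l -> f x = g x) -> lsum f l = lsum g l.
Proof. intros H. apply Rle_antisym; apply lsum_le; intros x Hx; rewrite (H x Hx); lra. Qed.

Lemma lsum_scal {T} (f : T -> R) c l : lsum (fun x => c * f x) l = c * lsum f l.
Proof. induction l as [|x l IH]; simpl; [ring|]. unfold lsum in *. rewrite IH. ring. Qed.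

Lemma lsum_plus {T} (f g : T -> R) l : lsum (fun x => f x + g x) l = lsum f l + lsum g l.
Proof. induction l as [|x l IH]; simpl; [ring|]. unfold lsum in *. rewrite IH. ring. Qed.

Lemma lsum_const {T} c (l : list T) : lsum (fun _ => c) l = INR (length l) * c.
Proof.
  induction l as [|x l IH]; [simpl; ring|].
  change (c + lsum (fun _ => c) l = INR (S (length l)) * c). rewrite IH, S_INR. ring.
Qed.

Lemma lsum_nonneg {T} (f : T -> R) l : (forall x, In x l -> 0 <= f x) -> 0 <= lsum f l.
Proof.
  intros H. rewrite <- (Rmult_0_r (INR (length l))), <- lsum_const. now apply lsum_le.
Qed.

Lemma lsum_in {T} (f : T -> R) l x :
  (forall y, In y l -> 0 <= f y) -> In x l -> f x <= lsum f l.
Proof.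
  induction l as [|y l IH]; simpl; intros H [].
  - subst y. assert (0 <= lsum f l); [|unfold lsum in *; lra].
    apply lsum_nonneg. intros; apply H; now right.
  - assert (f x <= lsum f l) by (apply IH; [intros; apply H; now right|assumption]).
    specialize (H y (or_introl eq_refl)). unfold lsum in *; lra.
Qed.

Lemma lsum_map {T U} (g : T -> U) (f : U -> R) l : lsum f (map g l) = lsum (fun x => f (g x)) l.
Proof. induction l as [|x l IH]; simpl; [reflexivity|]. unfold lsum in *. now rewrite IH. Qed.

Lemma lsum_swap {T U} (f : T -> U -> R) l m :
  lsum (fun x => lsum (f x) m) l = lsum (fun y => lsum (fun x => f x y) l) m.
Proof.
  induction l as [|x l IH]; simpl.
  - rewrite lsum_const. ring.
  - change (lsum (f x) m + lsum (fun x => lsum (f x) m) l =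
      lsum (fun y => f x y + lsum (fun x => f x y) l) m).
    rewrite IH, lsum_plus. reflexivity.
Qed.

(** Takes the place of [filter] for predicates that are not decidable; all sums split along with the
    list. *)
Lemma lsum_filter_split {T} (P : T -> Prop) (l : list T) :
  exists l1 l2, (forall x, In x l1 -> In x l /\ P x) /\ (forall x, In x l2 -> In x l /\ ~ P x) /\
    (forall x, In x l -> In x l1 \/ In x l2) /\
    (forall f : T -> R, lsum f l = lsum f l1 + lsum f l2) /\
    (forall x, In x l -> P x -> In x l1).
Proof.
  induction l as [|a l (l1 & l2 & H1 & H2 & H3 & H4 & H5)].
  - exists nil, nil. simpl. repeat split; try tauto. intros; unfold lsum; simpl; ring.
  - destruct (classic (P a)) as [Ha|Ha].
    + exists (a :: l1), l2. simpl. repeat split.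
      * destruct H as [<-|H]; [now left|right; now apply H1].
      * destruct H as [<-|H]; [assumption|now apply H1].
      * right; now apply H2.
      * now apply H2.
      * intros x [<-|H]; [now left; left|]. destruct (H3 x H); tauto.
      * intros f. unfold lsum in *; simpl. rewrite H4. ring.
      * intros x [<-|H] Hp; [now left|right; auto].
    + exists l1, (a :: l2). simpl. repeat split.
      * right; now apply H1.
      * now apply H1.
      * destruct H as [<-|H]; [now left|right; now apply H2].
      * destruct H as [<-|H]; [assumption|now apply H2].
      * intros x [<-|H]; [now right; left|]. destruct (H3 x H); tauto.
      * intros f. unfold lsum in *; simpl. rewrite H4. ring.
      * intros x [<-|H] Hp; [tauto|auto].
Qed.

(** * Outer content of subsets of space *)

Definition box : Type := (R3 * R3)%type.

Definition valid (B : box) : Prop :=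
  p1 (fst B) < p1 (snd B) /\ p2 (fst B) < p2 (snd B) /\ p3 (fst B) < p3 (snd B).

Definition inb (B : box) (x : R3) : Prop :=
  p1 (fst B) <= p1 x <= p1 (snd B) /\ p2 (fst B) <= p2 x <= p2 (snd B) /\
  p3 (fst B) <= p3 x <= p3 (snd B).

Definition vol (B : box) : R :=
  (p1 (snd B) - p1 (fst B)) * (p2 (snd B) - p2 (fst B)) * (p3 (snd B) - p3 (fst B)).

Definition mkbox (c : R3) (h1 h2 h3 : R) : box := (c, (p1 c + h1, p2 c + h2, p3 c + h3)).

(** Outer Jordan content, by finite covers with nondegenerate boxes. Finite covers suffice because
    the one countable union that occurs is made finite by compactness. *)
Definition covb (A : R3 -> Prop) (M : R) : Prop :=
  exists l : list box, (forall B, In B l -> valid B) /\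
    (forall x, A x -> exists B, In B l /\ inb B x) /\ lsum vol l <= M.

Lemma vol_pos B : valid B -> 0 < vol B.
Proof.
  intros (H1 & H2 & H3). unfold vol.
  apply Rmult_lt_0_compat; [apply Rmult_lt_0_compat|]; lra.
Qed.

Lemma mkbox_valid c h1 h2 h3 : 0 < h1 -> 0 < h2 -> 0 < h3 -> valid (mkbox c h1 h2 h3).
Proof. unfold valid, mkbox; cbn [fst snd]; unfold p1, p2, p3; cbn [fst snd]. intros; repeat split; lra. Qed.

Lemma mkbox_vol c h1 h2 h3 : vol (mkbox c h1 h2 h3) = h1 * h2 * h3.
Proof. unfold vol, mkbox; cbn [fst snd]; unfold p1, p2, p3; cbn [fst snd]. ring. Qed.

Lemma mkbox_inb c h1 h2 h3 x : inb (mkbox c h1 h2 h3) x <->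
  p1 c <= p1 x <= p1 c + h1 /\ p2 c <= p2 x <= p2 c + h2 /\ p3 c <= p3 x <= p3 c + h3.
Proof. unfold inb, mkbox; cbn [fst snd]; unfold p1, p2, p3; cbn [fst snd]. tauto. Qed.

Lemma covb_nonneg A M : covb A M -> 0 <= M.
Proof.
  intros (l & Hv & _ & Hs). apply Rle_trans with (2 := Hs).
  apply lsum_nonneg. intros B HB. left. apply vol_pos. auto.
Qed.

Lemma covb_mono (A A' : R3 -> Prop) M M' :
  (forall x, A' x -> A x) -> M <= M' -> covb A M -> covb A' M'.
Proof.
  intros HA HM (l & Hv & Hc & Hs). exists l. repeat split; auto; [apply Hv; auto .. |lra].
Qed.

Lemma covb_empty (A : R3 -> Prop) M : 0 <= M -> (forall x, ~ A x) -> covb A M.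
Proof.
  intros HM HA. exists nil. repeat split; try (intros; contradiction).
  - intros x Hx. destruct (HA x Hx).
  - exact HM.
Qed.

Lemma covb_box B : valid B -> covb (inb B) (vol B).
Proof.
  intros HB. exists (B :: nil). repeat split.
  - destruct H as [<-|[]]; apply HB.
  - destruct H as [<-|[]]; apply HB.
  - destruct H as [<-|[]]; apply HB.
  - intros x Hx. exists B. now split; [left|].
  - unfold lsum; simpl. lra.
Qed.

Lemma covb_union {T} (l : list T) (F : T -> R3 -> Prop) (m : T -> R) (A : R3 -> Prop) M :
  (forall t, In t l -> covb (F t) (m t)) ->
  (forall x, A x -> exists t, In t l /\ F t x) -> lsum m l <= M -> covb A M.
Proof.
  intros HF HA HM.
  assert (G : covb (fun x => exists t, In t l /\ F t x) (lsum m l)).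
  { clear HA HM. induction l as [|t l IH].
    - apply covb_empty; [unfold lsum; simpl; lra|]. intros x (t & [] & _).
    - destruct (HF t (or_introl eq_refl)) as (l1 & V1 & C1 & S1).
      destruct IH as (l2 & V2 & C2 & S2); [intros; apply HF; now right|].
      exists (l1 ++ l2). split; [|split].
      + intros B HB. apply in_app_or in HB. destruct HB; auto.
      + intros x (t' & [<-|Ht] & Hx).
        * destruct (C1 x Hx) as (B & HB & HB'). exists B. split; [apply in_or_app; now left|assumption].
        * destruct (C2 x (ex_intro _ t' (conj Ht Hx))) as (B & HB & HB').
          exists B. split; [apply in_or_app; now right|assumption].
      + rewrite lsum_app. unfold lsum in *; simpl. lra. }
  revert G. apply covb_mono; assumption.
Qed.

Definition aff (s1 s2 s3 : R) (c x : R3) : R3 :=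
  (s1 * p1 x + p1 c, s2 * p2 x + p2 c, s3 * p3 x + p3 c).

Lemma interval_aff (s c a b x : R) : s <> 0 -> a <= x <= b ->
  Rmin (s * a + c) (s * b + c) <= s * x + c <= Rmax (s * a + c) (s * b + c).
Proof.
  intros Hs Hx. unfold Rmin, Rmax. destruct (Rle_dec (s * a + c) (s * b + c)); nra.
Qed.

Lemma interval_aff_len (s c a b : R) : a < b ->
  Rmax (s * a + c) (s * b + c) - Rmin (s * a + c) (s * b + c) = Rabs s * (b - a).
Proof.
  intros H. unfold Rmin, Rmax. destruct (Rle_dec (s * a + c) (s * b + c)).
  - rewrite Rabs_pos_eq by nra. ring.
  - rewrite Rabs_left by nra. ring.
Qed.

(** Negative factors are allowed because the inverse branches contain reflections; the images of the
    endpoints are therefore sorted by [Rmin] and [Rmax]. *)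
Lemma covb_aff s1 s2 s3 c (A A' : R3 -> Prop) M : s1 <> 0 -> s2 <> 0 -> s3 <> 0 ->
  (forall x, A' x -> exists z, A z /\ x = aff s1 s2 s3 c z) ->
  covb A M -> covb A' (Rabs s1 * Rabs s2 * Rabs s3 * M).
Proof.
  intros N1 N2 N3 HA (l & Hv & Hc & Hs).
  set (t := fun B : box =>
    ((Rmin (s1 * p1 (fst B) + p1 c) (s1 * p1 (snd B) + p1 c),
      Rmin (s2 * p2 (fst B) + p2 c) (s2 * p2 (snd B) + p2 c),
      Rmin (s3 * p3 (fst B) + p3 c) (s3 * p3 (snd B) + p3 c)),
     (Rmax (s1 * p1 (fst B) + p1 c) (s1 * p1 (snd B) + p1 c),
      Rmax (s2 * p2 (fst B) + p2 c) (s2 * p2 (snd B) + p2 c),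
      Rmax (s3 * p3 (fst B) + p3 c) (s3 * p3 (snd B) + p3 c))) : box).
  pose proof (Rabs_pos_lt _ N1) as P1. pose proof (Rabs_pos_lt _ N2) as P2.
  pose proof (Rabs_pos_lt _ N3) as P3.
  exists (map t l). split; [|split].
  - intros B HB. apply in_map_iff in HB. destruct HB as (B0 & <- & HB).
    destruct (Hv _ HB) as (V1 & V2 & V3). unfold valid, t, p1, p2, p3 in *; cbn [fst snd] in *.
    repeat split; apply Rminus_gt_0_lt; rewrite interval_aff_len by assumption;
      apply Rmult_lt_0_compat; lra.
  - intros x Hx. destruct (HA x Hx) as (z & Hz & ->). destruct (Hc z Hz) as (B & HB & I1 & I2 & I3).
    exists (t B). split; [now apply in_map|].
    unfold inb, t, aff, p1, p2, p3 in *; cbn [fst snd] in *.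
    split; [|split]; now apply interval_aff.
  - rewrite lsum_map.
    rewrite (lsum_ext _ (fun B => Rabs s1 * Rabs s2 * Rabs s3 * vol B)).
    + rewrite lsum_scal. apply Rmult_le_compat_l; [|assumption].
      apply Rmult_le_pos; [apply Rmult_le_pos|]; lra.
    + intros B HB. destruct (Hv _ HB) as (V1 & V2 & V3). unfold vol, t.
      unfold p1, p2, p3 in *; cbn [fst snd] in *.
      rewrite !interval_aff_len by assumption. ring.
Qed.

Lemma grid1 (a h : R) (N : nat) (x : R) : 0 < h -> (1 <= N)%nat -> a <= x <= a + INR N * h ->
  exists i, (i < N)%nat /\ a + INR i * h <= x <= a + INR i * h + h.
Proof.
  intros Hh HN. induction N as [|N IH]; [lia|]. intros Hx. rewrite S_INR in Hx.
  destruct (Rle_lt_dec (a + INR N * h) x) as [H|H].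
  - exists N. split; [lia|lra].
  - destruct N as [|N]; [simpl in H; lra|].
    destruct IH as (i & Hi & Hx'); [lia|lra|]. exists i. split; [lia|lra].
Qed.

Lemma grid (a : R3) (h1 h2 h3 : R) (N1 N2 N3 : nat) :
  0 < h1 -> 0 < h2 -> 0 < h3 -> (1 <= N1)%nat -> (1 <= N2)%nat -> (1 <= N3)%nat ->
  exists l : list R3, length l = (N1 * N2 * N3)%nat /\
   (forall c, In c l -> p1 a <= p1 c /\ p1 c + h1 <= p1 a + INR N1 * h1 /\
      p2 a <= p2 c /\ p2 c + h2 <= p2 a + INR N2 * h2 /\
      p3 a <= p3 c /\ p3 c + h3 <= p3 a + INR N3 * h3) /\
   (forall x, inb (mkbox a (INR N1 * h1) (INR N2 * h2) (INR N3 * h3)) x ->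
      exists c, In c l /\ inb (mkbox c h1 h2 h3) x).
Proof.
  intros H1 H2 H3 M1 M2 M3.
  set (g := fun t : nat * nat * nat =>
    ((p1 a + INR (fst (fst t)) * h1, p2 a + INR (snd (fst t)) * h2, p3 a + INR (snd t) * h3) : R3)).
  exists (map g (list_prod (list_prod (seq 0 N1) (seq 0 N2)) (seq 0 N3))). split; [|split].
  - now rewrite length_map, !length_prod, !length_seq.
  - intros c Hc. apply in_map_iff in Hc. destruct Hc as ([[i j] k] & <- & Hi).
    apply in_prod_iff in Hi. destruct Hi as [Hi Hk]. apply in_prod_iff in Hi.
    destruct Hi as [Hi Hj]. rewrite !in_seq in *.
    unfold g, p1, p2, p3; cbn [fst snd].
    assert (E : forall n N h, (0 <= n < 0 + N)%nat -> 0 < h ->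
      0 <= INR n * h /\ INR n * h + h <= INR N * h).
    { intros n N h Hn Hh. pose proof (pos_INR n).
      assert (INR (S n) <= INR N) by (apply le_INR; lia). rewrite S_INR in *. nra. }
    destruct (E i N1 h1 Hi H1), (E j N2 h2 Hj H2), (E k N3 h3 Hk H3). lra.
  - intros x Hx. rewrite mkbox_inb in Hx. destruct Hx as (X1 & X2 & X3).
    destruct (grid1 _ _ _ _ H1 M1 X1) as (i & Hi & Ei).
    destruct (grid1 _ _ _ _ H2 M2 X2) as (j & Hj & Ej).
    destruct (grid1 _ _ _ _ H3 M3 X3) as (k & Hk & Ek).
    exists (g (i, j, k)). split.
    + apply in_map. apply in_prod; [apply in_prod|]; apply in_seq; lia.
    + rewrite mkbox_inb. unfold g, p1, p2, p3 in *; cbn [fst snd] in *. lra.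
Qed.

Definition ind (P : Prop) : R := if excluded_middle_informative P then 1 else 0.

(** The bound keeps track of the start [s] of the list, which makes it strong enough for the
    induction. *)
Lemma count_interval (p q : R) (n s : nat) : p <= q ->
  lsum (fun i => ind (p <= INR i <= q)) (seq s n) <= Rmax 0 (q - Rmax p (INR s) + 1).
Proof.
  intros Hpq. revert s. induction n as [|n IH]; intros s.
  - unfold lsum; simpl. apply Rmax_l.
  - change (ind (p <= INR s <= q) + lsum (fun i => ind (p <= INR i <= q)) (seq (S s) n)
      <= Rmax 0 (q - Rmax p (INR s) + 1)).
    specialize (IH (S s)). rewrite S_INR in IH. revert IH.
    generalize (lsum (fun i => ind (p <= INR i <= q)) (seq (S s) n)); intros w.
    unfold ind. destruct (excluded_middle_informative _) as [H|H].
    + rewrite (Rmax_right p (INR s)) by lra. rewrite (Rmax_right p (INR s + 1)) by lra.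
      rewrite (Rmax_right 0 (q - INR s + 1)) by lra.
      unfold Rmax. destruct (Rle_dec _ _); lra.
    + intros Hw. assert (p > INR s \/ INR s > q) by (apply NNPP; intros HH; apply H; lra).
      rewrite Rplus_0_l. apply Rle_trans with (1 := Hw).
      unfold Rmax. repeat destruct (Rle_dec _ _); lra.
Qed.

Lemma count_le (p q : R) (n : nat) : p <= q ->
  lsum (fun i => ind (p <= INR i <= q)) (seq 0 n) <= q - p + 1.
Proof.
  intros H. apply Rle_trans with (1 := count_interval p q n 0 H).
  apply Rmax_lub; [lra|]. pose proof (Rmax_l p (INR 0)). lra.
Qed.

Lemma ind_nonneg P : 0 <= ind P.
Proof. unfold ind. destruct (excluded_middle_informative P); lra. Qed.

Lemma ind_true (P : Prop) : P -> ind P = 1.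
Proof. intros H. unfold ind. now destruct (excluded_middle_informative P). Qed.

(** For [0 <= e <= 1] all powers of [e] are at most [e], so the error is linear. It serves for the
    lattice count, with [e = 1 / N], and for rounding a box to a grid. *)
Lemma prod_perturb (l : list box) (f g h : box -> R) :
  (forall B, In B l -> 0 <= f B /\ 0 <= g B /\ 0 <= h B) ->
  exists K, 0 <= K /\ forall e, 0 <= e <= 1 ->
    lsum (fun B => (f B + e) * (g B + e) * (h B + e)) l <=
    lsum (fun B => f B * g B * h B) l + K * e.
Proof.
  intros Hp. exists (lsum (fun B => (f B + 1) * (g B + 1) * (h B + 1)) l). split.
  - apply lsum_nonneg. intros B HB. destruct (Hp B HB) as (?&?&?).
    apply Rmult_le_pos; [apply Rmult_le_pos|]; lra.
  - intros e He. rewrite Rmult_comm, <- lsum_scal, <- lsum_plus. apply lsum_le.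
    intros B HB. destruct (Hp B HB) as (F&G&H).
    set (a := f B) in *; set (b := g B) in *; set (c := h B) in *.
    assert (0 <= a * b) by nra. assert (0 <= a * c) by nra. assert (0 <= b * c) by nra.
    assert (e * e <= e) by nra. assert (e * e * e <= e) by nra.
    assert (a * (e * e) <= a * e) by (apply Rmult_le_compat_l; lra).
    assert (b * (e * e) <= b * e) by (apply Rmult_le_compat_l; lra).
    assert (c * (e * e) <= c * e) by (apply Rmult_le_compat_l; lra).
    assert (0 <= e * (a * b * c)) by (apply Rmult_le_pos; nra).
    nra.
Qed.

(* Double counting of the lattice points of [B] at mesh [1/N], then [N -> oo]. *)
Lemma vol_le_cover B l : valid B -> (forall C, In C l -> valid C) ->
  (forall x, inb B x -> exists C, In C l /\ inb C x) -> vol B <= lsum vol l.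
Proof.
  intros HB Hv Hc. destruct HB as (V1 & V2 & V3).
  set (d1 := p1 (snd B) - p1 (fst B)). set (d2 := p2 (snd B) - p2 (fst B)).
  set (d3 := p3 (snd B) - p3 (fst B)).
  assert (D1 : 0 < d1) by (unfold d1; lra). assert (D2 : 0 < d2) by (unfold d2; lra).
  assert (D3 : 0 < d3) by (unfold d3; lra).
  set (f := fun C : box => (p1 (snd C) - p1 (fst C)) / d1).
  set (g := fun C : box => (p2 (snd C) - p2 (fst C)) / d2).
  set (h := fun C : box => (p3 (snd C) - p3 (fst C)) / d3).
  assert (Hpos : forall C, In C l -> 0 <= f C /\ 0 <= g C /\ 0 <= h C).
  { intros C HC. destruct (Hv C HC) as (?&?&?). unfold f, g, h.
    repeat split; apply Rle_mult_inv_pos; lra. }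
  destruct (prod_perturb l f g h Hpos) as (K & HK & HKe).
  assert (Hcnt : forall (a d lo hi : R) N, (1 <= N)%nat -> 0 < d -> lo < hi ->
    lsum (fun i => ind (lo <= a + INR i * (d / INR N) <= hi)) (seq 0 N)
      <= INR N * ((hi - lo) / d + / INR N)).
  { intros a d lo hi N HN Hd Hlh.
    assert (0 < INR N) by (apply lt_0_INR; lia).
    assert (HdN : 0 < d / INR N) by (apply Rdiv_lt_0_compat; lra).
    apply Rle_trans with (lsum (fun i => ind ((lo - a) / (d / INR N) <= INR i <= (hi - a) / (d / INR N))) (seq 0 N)).
    - apply lsum_le. intros i _. unfold ind at 1.
      destruct (excluded_middle_informative _) as [[Ha Hb]|]; [|apply ind_nonneg].
      rewrite ind_true; [lra|]. split.
      + apply Rle_div_l; [assumption|lra].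
      + apply Rle_div_r; [assumption|lra].
    - eapply Rle_trans; [apply count_le|].
      + apply Rmult_le_compat_r; [left; now apply Rinv_0_lt_compat|lra].
      + right. field. split; lra. }
  assert (Key : forall N, (1 <= N)%nat ->
    1 <= lsum (fun C => (f C + / INR N) * (g C + / INR N) * (h C + / INR N)) l).
  { intros N HN. assert (PN : 0 < INR N) by (apply lt_0_INR; lia).
    set (x1 := fun i => p1 (fst B) + INR i * (d1 / INR N)).
    set (x2 := fun i => p2 (fst B) + INR i * (d2 / INR N)).
    set (x3 := fun i => p3 (fst B) + INR i * (d3 / INR N)).
    set (I1 := fun C i => ind (p1 (fst C) <= x1 i <= p1 (snd C))).
    set (I2 := fun C i => ind (p2 (fst C) <= x2 i <= p2 (snd C))).
    set (I3 := fun C i => ind (p3 (fst C) <= x3 i <= p3 (snd C))).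
    assert (Hx : forall (a d : R) i, 0 < d -> In i (seq 0 N) ->
       a <= a + INR i * (d / INR N) <= a + d).
    { intros a d i Hd Hi. apply in_seq in Hi. pose proof (pos_INR i).
      assert (INR i <= INR N) by (apply le_INR; lia).
      assert (0 < d / INR N) by (apply Rdiv_lt_0_compat; lra).
      assert (INR N * (d / INR N) = d) by (field; lra). nra. }
    (* Each of the [N ^ 3] lattice points lies in some box of the cover. After the sums are swapped,
       the number of points in one box factors into three interval counts. *)
    assert (S : INR N * INR N * INR N <=
      lsum (fun C => lsum (I1 C) (seq 0 N) * lsum (I2 C) (seq 0 N) * lsum (I3 C) (seq 0 N)) l).
    { replace (INR N * INR N * INR N) with
        (lsum (fun _ => lsum (fun _ => lsum (fun _ => 1) (seq 0 N)) (seq 0 N)) (seq 0 N))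
        by (rewrite !lsum_const, !length_seq; ring).
      apply Rle_trans with (lsum (fun i => lsum (fun j => lsum (fun k =>
        lsum (fun C => I1 C i * I2 C j * I3 C k) l) (seq 0 N)) (seq 0 N)) (seq 0 N)).
      - apply lsum_le; intros i Hi. apply lsum_le; intros j Hj. apply lsum_le; intros k Hk.
        destruct (Hc (x1 i, x2 j, x3 k)) as (C & HC & C1 & C2 & C3).
        { pose proof (Hx (p1 (fst B)) d1 i D1 Hi). pose proof (Hx (p2 (fst B)) d2 j D2 Hj).
          pose proof (Hx (p3 (fst B)) d3 k D3 Hk). unfold d1, d2, d3 in *.
          unfold inb. unfold x1, x2, x3, d1, d2, d3. unfold p1, p2, p3 in *; cbn [fst snd] in *. lra. }
        unfold p1, p2, p3 in C1, C2, C3; cbn in C1, C2, C3.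
        apply Rle_trans with (I1 C i * I2 C j * I3 C k).
        + unfold I1, I2, I3. rewrite !ind_true by assumption. lra.
        + apply (lsum_in (fun C => I1 C i * I2 C j * I3 C k)); [|assumption].
          intros C' _. unfold I1, I2, I3.
          apply Rmult_le_pos; [apply Rmult_le_pos|]; apply ind_nonneg.
      - right.
        rewrite (lsum_ext _ (fun i => lsum (fun C => I1 C i * (lsum (I2 C) (seq 0 N) * lsum (I3 C) (seq 0 N))) l)).
        + rewrite lsum_swap. apply lsum_ext. intros C _.
          rewrite (lsum_ext _ (fun i => (lsum (I2 C) (seq 0 N) * lsum (I3 C) (seq 0 N)) * I1 C i))
            by (intros; ring).
          rewrite lsum_scal. ring.
        + intros i _.
          rewrite (lsum_ext _ (fun j => lsum (fun C => I1 C i * I2 C j * lsum (I3 C) (seq 0 N)) l)).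
          * rewrite lsum_swap. apply lsum_ext. intros C _.
            rewrite (lsum_ext _ (fun j => (I1 C i * lsum (I3 C) (seq 0 N)) * I2 C j)) by (intros; ring).
            rewrite lsum_scal. ring.
          * intros j _. rewrite lsum_swap. apply lsum_ext. intros C _. now rewrite lsum_scal. }
    assert (S2 : INR N * INR N * INR N <= (INR N * INR N * INR N) *
      lsum (fun C => (f C + / INR N) * (g C + / INR N) * (h C + / INR N)) l).
    { apply Rle_trans with (1 := S). rewrite <- lsum_scal. apply lsum_le. intros C HC.
      destruct (Hv C HC) as (W1 & W2 & W3). destruct (Hpos C HC) as (F & G & H).
      pose proof (Hcnt (p1 (fst B)) d1 _ _ N HN D1 W1).
      pose proof (Hcnt (p2 (fst B)) d2 _ _ N HN D2 W2).
      pose proof (Hcnt (p3 (fst B)) d3 _ _ N HN D3 W3).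
      replace (INR N * INR N * INR N * ((f C + / INR N) * (g C + / INR N) * (h C + / INR N)))
        with ((INR N * (f C + / INR N)) * (INR N * (g C + / INR N)) * (INR N * (h C + / INR N))) by ring.
      assert (NN : forall I : nat -> R, (forall i, 0 <= I i) -> 0 <= lsum I (seq 0 N))
        by (intros; apply lsum_nonneg; auto).
      apply Rmult_le_compat; [apply Rmult_le_pos| |apply Rmult_le_compat|];
        try (apply NN; intros; apply ind_nonneg); assumption. }
    apply Rmult_le_reg_l with (INR N * INR N * INR N); [|lra].
    apply Rmult_lt_0_compat; [apply Rmult_lt_0_compat|]; lra. }
  assert (One : 1 <= lsum (fun C => f C * g C * h C) l).
  { apply Rle_of_eps. intros e He. destruct (INR_large (K / e)) as (N & HN & HNe).
    assert (PN : 0 < INR N) by (apply lt_0_INR; lia).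
    apply Rle_trans with (1 := Key N HN).
    assert (0 < / INR N) by now apply Rinv_0_lt_compat.
    apply Rle_trans with (lsum (fun B => f B * g B * h B) l + K * / INR N).
    - apply HKe. split; [lra|]. rewrite <- Rinv_1. apply Rinv_le_contravar; [lra|].
      now apply (le_INR 1).
    - apply Rplus_le_compat_l. 
      assert (K < INR N * e) by (apply (Rlt_div_l K (INR N) e); lra).
      apply Rmult_le_reg_r with (INR N); [lra|]. rewrite Rmult_assoc, Rinv_l by lra. lra. }
  replace (vol B) with (d1 * d2 * d3 * 1) by (unfold vol, d1, d2, d3; ring).
  replace (lsum vol l) with (d1 * d2 * d3 * lsum (fun C => f C * g C * h C) l).
  - apply Rmult_le_compat_l; [|assumption]. apply Rmult_le_pos; [apply Rmult_le_pos|]; lra.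
  - rewrite <- lsum_scal. apply lsum_ext. intros C _. unfold vol, f, g, h. field. lra.
Qed.

(** The lower bound that keeps content from being trivial; it yields the contradiction in
    [eventually_outside]. *)
Lemma covb_vol (A : R3 -> Prop) B M : valid B -> (forall x, inb B x -> A x) -> covb A M -> vol B <= M.
Proof.
  intros HB HA (l & Hv & Hc & Hs). apply Rle_trans with (2 := Hs).
  apply vol_le_cover; auto.
Qed.

(** * Content and Lipschitz maps *)

Definition inball (c : R3) (r : R) (x : R3) : Prop := dist3 x c <= r.

Lemma dist3_homothety (s : R) (c x z : R3) : 0 <= s ->
  dist3 (aff s s s c x) (aff s s s c z) = s * dist3 x z.
Proof.
  intros Hs. pose proof (dist3_pos x z). apply Rle_antisym.
  - apply dist3_le; [nra|]. rewrite Rpow_mult_distr, dist3_sq.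
    unfold aff, p1, p2, p3; cbn [fst snd]. right; ring.
  - apply Rle_trans with (sqrt ((s * dist3 x z) ^ 2)).
    + rewrite sqrt_pow2; [lra|nra].
    + unfold dist3 at 2, norm3. apply sqrt_le_1_alt.
      rewrite Rpow_mult_distr, dist3_sq. unfold aff, p1, p2, p3; cbn [fst snd]. right; ring.
Qed.

Lemma inball_sides (c x : R3) (h1 h2 h3 : R) (z : R3) :
  inb (mkbox c h1 h2 h3) x -> inb (mkbox c h1 h2 h3) z -> dist3 x z <= h1 + h2 + h3.
Proof.
  rewrite !mkbox_inb. intros X Z. eapply Rle_trans; [apply dist3_le_sum|].
  assert (E : forall a b u v w, u <= a <= u + w -> u <= b <= u + w -> v = w -> Rabs (a - b) <= v)
    by (intros; apply Rabs_le; lra).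
  apply Rplus_le_compat; [apply Rplus_le_compat|]; eapply E; solve [apply X | apply Z | reflexivity].
Qed.

Lemma unit_coord (h c x : R) : 0 < h -> c <= x <= c + h -> 0 <= (x - c) / h <= 0 + 1.
Proof.
  intros Hh Hx. split; [apply Rle_mult_inv_pos; lra|].
  apply (proj2 (Rle_div_l (x - c) (0 + 1) h Hh)). lra.
Qed.

Lemma pow2_le_pow2 (a r : R) : - r <= a <= r -> a ^ 2 <= r ^ 2.
Proof. intros H. nra. Qed.

(** [beta] is the content of the unit ball, obtained as an infimum: its scaling behaviour is what
    matters, and its value is never computed. *)
Lemma ball_content : exists beta, 1 <= beta /\
  (forall c r M, 0 < r -> covb (inball c r) M -> beta * r ^ 3 <= M) /\
  (forall c r e, 0 < r -> 0 < e -> covb (inball c r) (beta * r ^ 3 + e)).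
Proof.
  assert (Sc : forall c r c' r' M, 0 < r -> 0 < r' -> covb (inball c r) M ->
     covb (inball c' r') ((r' / r) ^ 3 * M)).
  { intros c r c' r' M Hr Hr' H.
    assert (Hs : 0 < r' / r) by now apply Rdiv_lt_0_compat.
    set (s := r' / r) in *.
    set (t := (p1 c' - s * p1 c, p2 c' - s * p2 c, p3 c' - s * p3 c)).
    replace (s ^ 3 * M) with (Rabs s * Rabs s * Rabs s * M) by (rewrite Rabs_pos_eq by lra; ring).
    apply covb_aff with (c := t) (A := inball c r); try lra; [|assumption].
    intros x Hx.
    exists ((p1 x - p1 t) / s, (p2 x - p2 t) / s, (p3 x - p3 t) / s).
    assert (E : x = aff s s s t ((p1 x - p1 t) / s, (p2 x - p2 t) / s, (p3 x - p3 t) / s)).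
    { rewrite (R3_eta x) at 1. unfold aff. unfold p1, p2, p3; cbn [fst snd].
      f_equal; [f_equal|]; field; lra. }
    split; [|exact E]. unfold inball in *.
    assert (E' : c' = aff s s s t c).
    { rewrite (R3_eta c'). unfold aff, t; unfold p1, p2, p3; cbn [fst snd]. f_equal; [f_equal|]; ring. }
    rewrite E, E', dist3_homothety in Hx by lra.
    apply Rmult_le_reg_l with s; [assumption|]. apply Rle_trans with (1 := Hx).
    unfold s. right; field; lra. }
  destruct (inf_exists (covb (inball origin3 1))) as (beta & _ & Hlb & Happ).
  - exists (vol (mkbox (-1, -1, -1) 2 2 2)).
    apply covb_mono with (inb (mkbox (-1, -1, -1) 2 2 2)) (vol (mkbox (-1, -1, -1) 2 2 2)).
    + intros x Hx. unfold inball in Hx. rewrite mkbox_inb.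
      pose proof (dist3_p1 x origin3) as A. pose proof (dist3_p2 x origin3) as B.
      pose proof (dist3_p3 x origin3) as C.
      unfold origin3, p1, p2, p3 in *; cbn [fst snd] in *.
      pose proof (proj1 (Rabs_le_between _ _) (Rle_trans _ _ _ A Hx)) as A'.
      pose proof (proj1 (Rabs_le_between _ _) (Rle_trans _ _ _ B Hx)) as B'.
      pose proof (proj1 (Rabs_le_between _ _) (Rle_trans _ _ _ C Hx)) as C'. lra.
    + lra.
    + apply covb_box. apply mkbox_valid; lra.
  - apply covb_nonneg.
  - exists beta. split; [|split].
    + apply Rle_of_eps. intros e He. destruct (Happ e He) as (M & HM & HMe).
      apply Rle_trans with M; [|lra].
      (* The centred unit cube lies in the unit ball, since [3 * (1 / 2) ^ 2 <= 1]. *)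
      replace 1 with (vol (mkbox (-1/2, -1/2, -1/2) 1 1 1)) by (rewrite mkbox_vol; lra).
      apply covb_vol with (3 := HM); [apply mkbox_valid; lra|].
      intros x Hx. rewrite mkbox_inb in Hx. apply dist3_le; [lra|].
      unfold origin3, p1, p2, p3 in *; cbn [fst snd] in *.
      destruct Hx as (X1 & X2 & X3).
      pose proof (pow2_le_pow2 (fst (fst x) - 0) (1/2) ltac:(lra)).
      pose proof (pow2_le_pow2 (snd (fst x) - 0) (1/2) ltac:(lra)).
      pose proof (pow2_le_pow2 (snd x - 0) (1/2) ltac:(lra)). lra.
    + intros c r M Hr H. apply (Sc c r origin3 1) in H; [|lra|lra].
      apply Hlb in H.
      apply Rle_trans with (1 := Rmult_le_compat_r (r ^ 3) _ _ (pow_le r 3 (Rlt_le _ _ Hr)) H). right. field. lra.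
    + intros c r e Hr He. assert (R3p : 0 < r ^ 3) by now apply pow_lt.
      destruct (Happ (e / r ^ 3)) as (M & HM & HMe); [now apply Rdiv_lt_0_compat|].
      apply (Sc origin3 1 c r) in HM; [|lra|lra].
      revert HM. apply covb_mono; [tauto|].
      apply Rle_trans with (r ^ 3 * (beta + e / r ^ 3)).
      * replace (r / 1) with r by field. apply Rmult_le_compat_l; lra.
      * right. field. lra.
Qed.

(* Self-similar Vitali argument.  Let [q] be the optimal value of [sum beta r^3]
   over ball covers of the cube.  Using the inscribed ball once and rescaled
   near-optimal covers on the grid cubes outside it gives
   [q <= beta/8 + (1 - beta/8) q]. *)
Lemma cube_ball_cover beta : 1 <= beta ->
  (forall c r M, 0 < r -> covb (inball c r) M -> beta * r ^ 3 <= M) ->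
  forall e, 0 < e -> exists l : list (R3 * R),
    (forall b, In b l -> 0 < snd b) /\
    (forall x, inb (mkbox origin3 1 1 1) x -> exists b, In b l /\ inball (fst b) (snd b) x) /\
    lsum (fun b => beta * snd b ^ 3) l <= 1 + e.
Proof.
  intros Hb1 Hbeta.
  set (P := fun v => exists l : list (R3 * R),
    (forall b, In b l -> 0 < snd b) /\
    (forall x, inb (mkbox origin3 1 1 1) x -> exists b, In b l /\ inball (fst b) (snd b) x) /\
    lsum (fun b => beta * snd b ^ 3) l = v).
  set (ctr := (1/2, 1/2, 1/2) : R3).
  destruct (inf_exists P) as (q & Hq0 & Hlb & Happ).
  - eexists. exists ((ctr, 1) :: nil). split; [|split; [|reflexivity]].
    + intros b [<-|[]]. simpl. lra.
    + intros x Hx. exists (ctr, 1). split; [now left|]. rewrite mkbox_inb in Hx.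
      apply dist3_le; [simpl; lra|]. unfold origin3, ctr, p1, p2, p3 in *; cbn [fst snd] in *.
      destruct Hx as (X1 & X2 & X3).
      pose proof (pow2_le_pow2 (fst (fst x) - 1/2) (1/2) ltac:(lra)).
      pose proof (pow2_le_pow2 (snd (fst x) - 1/2) (1/2) ltac:(lra)).
      pose proof (pow2_le_pow2 (snd x - 1/2) (1/2) ltac:(lra)). lra.
  - intros v (l & Hl & _ & <-). apply lsum_nonneg. intros b Hb.
    pose proof (pow_lt _ 3 (Hl b Hb)). nra.
  (* Here [n] is the total volume of the grid cubes contained in the inscribed ball. They cover the
     concentric ball of radius [(1 - eps) / 2], hence the lower bound for [n]. *)
  - assert (Step : forall eps eta, 0 < eps < 1 -> 0 < eta -> exists n, 
        beta * ((1 - eps) / 2) ^ 3 <= n <= 1 /\ q <= beta / 8 + (1 - n) * (q + eta)).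
    { intros eps eta Heps Heta.
      destruct (Happ eta Heta) as (v & (L & HL & HLc & HLs) & Hv).
      destruct (INR_large (6 / eps)) as (N & HN & HNe).
      assert (PN : 0 < INR N) by (apply lt_0_INR; lia).
      set (h := / INR N). assert (Hh : 0 < h) by now apply Rinv_0_lt_compat.
      assert (NH : INR N * h = 1) by (unfold h; field; lra).
      (* A grid cube has diameter at most [3 * h], so a cube that meets the smaller ball stays
         inside the ball of radius [1 / 2]. *)
      assert (Hhe : 3 * h <= eps / 2).
      { assert (6 < INR N * eps) by (apply (Rlt_div_l 6 (INR N) eps); lra).
        apply Rmult_le_reg_l with (INR N); [lra|]. nra. }
      destruct (grid origin3 h h h N N N Hh Hh Hh HN HN HN) as (g & Hlen & Hins & Hcov).
      rewrite NH in Hins, Hcov.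
      destruct (lsum_filter_split (fun c => forall x, inb (mkbox c h h h) x -> inball ctr (1/2) x) g)
        as (g1 & g2 & G1 & G2 & G3 & G4 & G5).
      assert (Hcount : INR (length g1) * h ^ 3 + INR (length g2) * h ^ 3 = 1).
      { pose proof (G4 (fun _ => h ^ 3)) as E. rewrite !lsum_const in E. rewrite <- E, Hlen.
        rewrite !mult_INR. replace 1 with ((INR N * h) ^ 3) by (rewrite NH; ring). ring. }
      exists (INR (length g1) * h ^ 3).
      assert (H3 : 0 < h ^ 3) by now apply pow_lt.
      split; [split|].
      - apply (Hbeta ctr); [lra|].
        exists (map (fun c => mkbox c h h h) g1). split; [|split].
        + intros B HB. apply in_map_iff in HB. destruct HB as (c & <- & _). now apply mkbox_valid.
        + intros x Hx.
          destruct (Hcov x) as (c & Hc & Hcx).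
          { unfold inball in Hx. rewrite mkbox_inb.
            pose proof (dist3_p1 x ctr) as A. pose proof (dist3_p2 x ctr) as B.
            pose proof (dist3_p3 x ctr) as C.
            pose proof (proj1 (Rabs_le_between _ _) (Rle_trans _ _ _ A Hx)) as A'.
            pose proof (proj1 (Rabs_le_between _ _) (Rle_trans _ _ _ B Hx)) as B'.
            pose proof (proj1 (Rabs_le_between _ _) (Rle_trans _ _ _ C Hx)) as C'.
            unfold ctr, origin3, p1, p2, p3 in *; cbn [fst snd] in *. lra. }
          exists (mkbox c h h h). split; [|assumption]. apply in_map_iff. exists c. split; [reflexivity|].
          apply G5; [assumption|]. intros x' Hx'.
          pose proof (inball_sides _ _ _ _ _ _ Hx' Hcx). unfold inball in *.
          pose proof (dist3_tri x' x ctr). lra.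
        + rewrite lsum_map. rewrite (lsum_ext _ (fun _ => h ^ 3)) by (intros; rewrite mkbox_vol; ring).
          rewrite lsum_const. lra.
      - pose proof (pos_INR (length g2)). nra.
      - assert (Pq : P (beta * (1/2) ^ 3 + INR (length g2) * (h ^ 3 * v))).
        { exists ((ctr, 1/2) :: flat_map (fun c => map (fun b => (aff h h h c (fst b), h * snd b)) L) g2).
          split; [|split].
          - intros b [<-|Hb]; [simpl; lra|]. apply in_flat_map in Hb. destruct Hb as (c & _ & Hb).
            apply in_map_iff in Hb. destruct Hb as (b0 & <- & Hb0). simpl.
            apply Rmult_lt_0_compat; auto.
          - intros x Hx. destruct (Hcov x) as (c & Hc & Hcx); [assumption|].
            destruct (G3 c Hc) as [Hg|Hg].
            + exists (ctr, 1/2). split; [now left|]. now apply (G1 c Hg).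
            + assert (exists z, inb (mkbox origin3 1 1 1) z /\ x = aff h h h c z) as (z & Hz & ->).
              { exists ((p1 x - p1 c) / h, (p2 x - p2 c) / h, (p3 x - p3 c) / h).
                rewrite mkbox_inb in Hcx. split.
                - rewrite mkbox_inb. unfold origin3, p1, p2, p3 in *; cbn [fst snd] in *.
                  repeat split; apply unit_coord; lra.
                - rewrite (R3_eta x) at 1. unfold aff. unfold p1, p2, p3; cbn [fst snd].
                  f_equal; [f_equal|]; field; lra. }
              destruct (HLc z Hz) as (b & Hb & Hbz).
              exists (aff h h h c (fst b), h * snd b). split.
              * right. apply in_flat_map. exists c. split; [assumption|].
                apply in_map_iff. now exists b.
              * unfold inball in *. simpl. rewrite dist3_homothety by lra.
                apply Rmult_le_compat_l; lra.
          - unfold lsum at 1. simpl fold_right. f_equal.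
            match goal with |- ?a = _ => change a with (lsum (fun b : R3 * R => beta * snd b ^ 3)
              (flat_map (fun c => map (fun b => (aff h h h c (fst b), h * snd b)) L) g2)) end.
            clear - HLs. induction g2 as [|c g2 IH].
            + simpl. unfold lsum; simpl. ring.
            + cbn [flat_map]. rewrite lsum_app, IH, lsum_map.
              rewrite (lsum_ext _ (fun b => h ^ 3 * (beta * snd b ^ 3))) by (intros; simpl; ring).
              rewrite lsum_scal, HLs. change (length (c :: g2)) with (S (length g2)).
              rewrite S_INR. ring. }
        apply Hlb in Pq. apply Rle_trans with (1 := Pq).
        replace (1 - INR (length g1) * h ^ 3) with (INR (length g2) * h ^ 3) by lra.
        pose proof (pos_INR (length g2)).
        assert (INR (length g2) * h ^ 3 * v <= INR (length g2) * h ^ 3 * (q + eta))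
          by (apply Rmult_le_compat_l; nra).
        lra. }
    assert (Hq1 : q <= 1).
    { apply Rnot_lt_le. intros Hlt.
      (* As [eta] tends to 0, [Step] gives [q * n <= beta / 8], hence [q * (1 - eps) ^ 3 <= 1]; this
         [eps] is chosen to violate that. *)
      assert (exists eps, 0 < eps < 1 /\ 1 < q * (1 - eps) ^ 3) as (eps & Heps & Hqe).
      { set (k := Rmin ((q - 1) / (4 * q)) (1/2)). exists k.
        assert (0 < (q - 1) / (4 * q)) by (apply Rdiv_lt_0_compat; lra).
        assert (K1 : k <= (q - 1) / (4 * q)) by apply Rmin_l.
        assert (K2 : k <= 1/2) by apply Rmin_r.
        assert (K3 : 0 < k) by (unfold k; apply Rmin_glb_lt; lra).
        split; [lra|].
        assert (1 - 3 * k <= (1 - k) ^ 3) by nra.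
        assert (q * k <= (q - 1) / 4).
        { apply Rle_trans with (q * ((q - 1) / (4 * q))); [nra|]. right. field. lra. }
        nra. }
      assert (q * (beta * ((1 - eps) / 2) ^ 3) <= beta / 8).
      { apply Rle_of_eps. intros eta Heta. destruct (Step eps eta Heps Heta) as (n & Hn & Hqn).
        assert (0 < beta * ((1 - eps) / 2) ^ 3).
        { apply Rmult_lt_0_compat; [lra|]. apply pow_lt. lra. }
        nra. }
      replace (((1 - eps) / 2) ^ 3) with ((1 - eps) ^ 3 / 8) in H by field.
      nra. }
    intros e He. destruct (Happ e He) as (v & (L & HL & HLc & HLs) & Hv).
    exists L. repeat split; auto. lra.
Qed.

Lemma side_count (D s : R) : 0 < D -> 0 < s ->
  exists N, (1 <= N)%nat /\ D <= INR N * s <= D + s.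
Proof.
  intros HD Hs. destruct (archimed (D / s)) as [A1 A2].
  assert (Ds : 0 < D / s) by now apply Rdiv_lt_0_compat.
  assert (U : (0 < up (D / s))%Z) by (apply lt_IZR; lra).
  exists (Z.to_nat (up (D / s))). split; [lia|].
  rewrite INR_IZR_INZ, Z2Nat.id by lia.
  assert (E : D / s * s = D) by (field; lra). nra.
Qed.

(** The image of a ball of radius [r] lies in a ball of radius [l * r], so a ball cover of nearly
    the volume of [B] gives the sharp factor [l ^ 3]. The Lipschitz condition involves points [c]
    near [B] as well, because the centres of the balls may lie outside it. *)
Lemma lipschitz_box (B : box) (Psi : R3 -> R3) (l d : R) : valid B -> 0 < l -> 0 < d ->
  (forall x c, inb B x -> dist3 x c <= d -> dist3 (Psi x) (Psi c) <= l * dist3 x c) ->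
  forall e, 0 < e -> covb (fun y => exists x, inb B x /\ y = Psi x) (l ^ 3 * vol B + e).
Proof.
  intros HB Hl Hd HL e He.
  destruct ball_content as (beta & Hb1 & Hblow & Hbup).
  set (v := vol B). assert (Hv : 0 < v) by now apply vol_pos.
  assert (L3 : 0 < l ^ 3) by now apply pow_lt.
  (* Three losses have to fit into [e]: rounding the box to a grid costs [v + t] instead of [v], the
     ball cover of a cube a factor [1 + t], and the box cover of each image ball another [1 + t]. *)
  set (t := Rmin 1 (e / (l ^ 3 * (4 + 3 * v)))).
  assert (Q : 0 < e / (l ^ 3 * (4 + 3 * v))) by (apply Rdiv_lt_0_compat; [lra|nra]).
  assert (T1 : t <= 1) by apply Rmin_l.
  assert (T0 : 0 < t) by (unfold t; apply Rmin_glb_lt; lra).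
  assert (T2 : l ^ 3 * ((v + t) * (1 + t) ^ 2) <= l ^ 3 * v + e).
  { assert (T3 : t <= e / (l ^ 3 * (4 + 3 * v))) by apply Rmin_r.
    assert (T4 : t * (4 + 3 * v) <= e / l ^ 3).
    { apply Rle_trans with (e / (l ^ 3 * (4 + 3 * v)) * (4 + 3 * v)).
      - apply Rmult_le_compat_r; lra.
      - right. field. split; lra. }
    assert (T5 : (v + t) * (1 + t) ^ 2 <= v + t * (4 + 3 * v)).
    { apply Rle_trans with ((v + t) * (1 + 3 * t)); [|nra].
      apply Rmult_le_compat_l; [lra|nra]. }
    replace (l ^ 3 * v + e) with (l ^ 3 * (v + e / l ^ 3)) by (field; lra).
    apply Rmult_le_compat_l; lra. }
  destruct (cube_ball_cover beta Hb1 Hblow t T0) as (L & HLp & HLc & HLs).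
  destruct HB as (V1 & V2 & V3).
  set (D1 := p1 (snd B) - p1 (fst B)) in *. set (D2 := p2 (snd B) - p2 (fst B)) in *.
  set (D3 := p3 (snd B) - p3 (fst B)) in *.
  assert (P1 : 0 < D1) by (unfold D1; lra). assert (P2 : 0 < D2) by (unfold D2; lra).
  assert (P3 : 0 < D3) by (unfold D3; lra).
  destruct (prod_perturb (B :: nil) (fun _ => D1) (fun _ => D2) (fun _ => D3)) as (K & HK & HKe).
  { intros; lra. }
  (* The mesh is at most 1 for [prod_perturb], at most [d / 2] so that balls of radius at most
     [2 * s] stay within the range of the Lipschitz condition, and small enough that the rounding
     error is at most [t]. *)
  set (s := Rmin (Rmin 1 (d / 2)) (t / (K + 1))).
  assert (St : 0 < t / (K + 1)) by (apply Rdiv_lt_0_compat; lra).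
  assert (S0 : 0 < s) by (unfold s; repeat apply Rmin_glb_lt; lra).
  assert (S1 : s <= 1) by (unfold s; eapply Rle_trans; [apply Rmin_l|apply Rmin_l]).
  assert (S2 : 2 * s <= d).
  { assert (s <= d / 2) by (unfold s; eapply Rle_trans; [apply Rmin_l|apply Rmin_r]). lra. }
  assert (S3 : K * s <= t).
  { assert (s <= t / (K + 1)) by apply Rmin_r.
    apply Rle_trans with ((K + 1) * (t / (K + 1))); [nra|right; field; lra]. }
  destruct (side_count D1 s P1 S0) as (N1 & M1 & E1).
  destruct (side_count D2 s P2 S0) as (N2 & M2 & E2).
  destruct (side_count D3 s P3 S0) as (N3 & M3 & E3).
  destruct (grid (fst B) s s s N1 N2 N3 S0 S0 S0 M1 M2 M3) as (g & Hlen & _ & Hcov).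
  assert (Hvol : INR (length g) * s ^ 3 <= v + t).
  { rewrite Hlen, !mult_INR.
    replace (INR N1 * INR N2 * INR N3 * s ^ 3) with ((INR N1 * s) * (INR N2 * s) * (INR N3 * s)) by ring.
    specialize (HKe s ltac:(lra)). unfold lsum in HKe; simpl in HKe.
    apply Rle_trans with ((D1 + s) * (D2 + s) * (D3 + s)).
    - apply Rmult_le_compat; [nra|nra| |lra]. apply Rmult_le_compat; nra.
    - unfold v, vol. fold D1 D2 D3. lra. }
  (* A single ball cannot exceed the total [1 + t <= 2], and [beta >= 1]. *)
  assert (Rsmall : forall b, In b L -> snd b <= 2).
  { intros b Hb. apply Rnot_lt_le. intros Hlt.
    assert (beta * snd b ^ 3 <= 1 + t).
    { apply Rle_trans with (2 := HLs). apply (lsum_in (fun b => beta * snd b ^ 3)); [|assumption].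
      intros b' Hb'. pose proof (pow_lt _ 3 (HLp b' Hb')). nra. }
    assert (2 ^ 3 <= snd b ^ 3) by (apply pow_incr; lra). nra. }
  apply covb_union with (l := list_prod g L)
    (F := fun cb y => exists x, inb B x /\ inb (mkbox (fst cb) s s s) x /\
      inball (aff s s s (fst cb) (fst (snd cb))) (s * snd (snd cb)) x /\ y = Psi x)
    (m := fun cb => (l * s) ^ 3 * ((1 + t) * (beta * snd (snd cb) ^ 3))).
  - intros [c [b r]] Hcb. apply in_prod_iff in Hcb. destruct Hcb as [Hc Hb]. cbn [fst snd].
    pose proof (HLp _ Hb) as Hr. pose proof (Rsmall _ Hb) as Hr2. cbn [fst snd] in Hr, Hr2.
    assert (Hls : 0 < l * s * r) by (repeat apply Rmult_lt_0_compat; lra).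
    assert (L3' : 0 < (l * s * r) ^ 3) by now apply pow_lt.
    apply covb_mono with (3 := Hbup (Psi (aff s s s c b)) (l * s * r) (t * (l * s * r) ^ 3) Hls
       ltac:(now apply Rmult_lt_0_compat)).
    + intros y (x & HxB & Hxc & Hxb & ->). unfold inball in *.
      assert (s * r <= d) by nra.
      eapply Rle_trans; [apply HL; [assumption|lra]|].
      replace (l * s * r) with (l * (s * r)) by ring. apply Rmult_le_compat_l; lra.
    + replace ((l * s) ^ 3 * ((1 + t) * (beta * r ^ 3)))
        with (beta * (l * s * r) ^ 3 + t * beta * (l * s * r) ^ 3) by ring.
      apply Rplus_le_compat_l. apply Rmult_le_compat_r; [lra|nra].
  - intros y (x & Hx & ->). destruct (Hcov x) as (c & Hc & Hcx).
    { rewrite mkbox_inb. unfold inb in Hx. unfold D1, D2, D3 in *. lra. }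
    assert (exists z, inb (mkbox origin3 1 1 1) z /\ x = aff s s s c z) as (z & Hz & E).
    { exists ((p1 x - p1 c) / s, (p2 x - p2 c) / s, (p3 x - p3 c) / s).
      rewrite mkbox_inb in Hcx. split.
      - rewrite mkbox_inb. unfold origin3, p1, p2, p3 in *; cbn [fst snd] in *.
        repeat split; apply unit_coord; lra.
      - rewrite (R3_eta x) at 1. unfold aff. unfold p1, p2, p3; cbn [fst snd].
        f_equal; [f_equal|]; field; lra. }
    destruct (HLc z Hz) as (b & Hb & Hbz).
    exists (c, b). split; [now apply in_prod|]. exists x. simpl.
    repeat split; try assumption; try apply Hx; try apply Hcx.
    unfold inball in *. rewrite E, dist3_homothety by lra. apply Rmult_le_compat_l; lra.
  - apply Rle_trans with (INR (length g) * ((l * s) ^ 3 * ((1 + t) * (1 + t)))).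
    + apply Rle_trans with (INR (length g) * lsum (fun b => (l * s) ^ 3 * ((1 + t) * (beta * snd b ^ 3))) L).
      * right. clear. induction g as [|c g IH]; [unfold lsum; simpl; ring|].
        cbn [list_prod]. rewrite lsum_app, lsum_map, IH. simpl fst. simpl snd.
        change (length (c :: g)) with (S (length g)). rewrite S_INR. ring.
      * apply Rmult_le_compat_l; [apply pos_INR|].
        rewrite lsum_scal. apply Rmult_le_compat_l; [apply pow_le; nra|].
        rewrite lsum_scal. apply Rmult_le_compat_l; lra.
    + apply Rle_trans with (2 := T2).
      replace (INR (length g) * ((l * s) ^ 3 * ((1 + t) * (1 + t))))
        with (l ^ 3 * ((INR (length g) * s ^ 3) * (1 + t) ^ 2)) by ring.
      apply Rmult_le_compat_l; [lra|]. apply Rmult_le_compat_r; [nra|assumption].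
Qed.

(** * Weighted covers and the Borel--Cantelli argument *)

(* Covers by weighted boxes: [wcov phi A M] bounds by [M] the outer measure of
   [A] with density [1 / phi]; the condition [1 <= w * phi x] avoids the junk
   value of [1 / 0]. *)
Definition wcov (phi : R3 -> R) (A : R3 -> Prop) (M : R) : Prop :=
  exists l : list (box * R), (forall i, In i l -> valid (fst i) /\ 0 <= snd i) /\
    (forall x, A x -> exists i, In i l /\ inb (fst i) x /\ 1 <= snd i * phi x) /\
    lsum (fun i => snd i * vol (fst i)) l <= M.

Lemma wcov_mono phi (A A' : R3 -> Prop) M M' :
  (forall x, A' x -> A x) -> M <= M' -> wcov phi A M -> wcov phi A' M'.
Proof.
  intros HA HM (l & Hv & Hc & Hs). exists l. repeat split; auto; [apply Hv; auto .. |lra].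
Qed.

Lemma wcov_union phi {T} (l : list T) (F : T -> R3 -> Prop) (m : T -> R) (A : R3 -> Prop) M :
  (forall t, In t l -> wcov phi (F t) (m t)) ->
  (forall x, A x -> exists t, In t l /\ F t x) -> lsum m l <= M -> wcov phi A M.
Proof.
  intros HF HA HM.
  assert (G : wcov phi (fun x => exists t, In t l /\ F t x) (lsum m l)).
  { clear HA HM. induction l as [|t l IH].
    - exists nil. split; [|split].
      + intros i [].
      + intros x (t & [] & _).
      + unfold lsum; simpl; lra.
    - destruct (HF t (or_introl eq_refl)) as (l1 & V1 & C1 & S1).
      destruct IH as (l2 & V2 & C2 & S2); [intros; apply HF; now right|].
      exists (l1 ++ l2). split; [|split].
      + intros B HB. apply in_app_or in HB. destruct HB; auto.
      + intros x (t' & [<-|Ht] & Hx).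
        * destruct (C1 x Hx) as (B & HB & HB'). exists B. split; [apply in_or_app; now left|assumption].
        * destruct (C2 x (ex_intro _ t' (conj Ht Hx))) as (B & HB & HB').
          exists B. split; [apply in_or_app; now right|assumption].
      + rewrite lsum_app. unfold lsum in *; simpl. lra. }
  revert G. apply wcov_mono; assumption.
Qed.

Lemma covb_wcov phi (A : R3 -> Prop) M w :
  0 <= w -> (forall x, A x -> 1 <= w * phi x) -> covb A M -> wcov phi A (w * M).
Proof.
  intros Hw HA (l & Hv & Hc & Hs). exists (map (fun B => (B, w)) l). split; [|split].
  - intros i Hi. apply in_map_iff in Hi. destruct Hi as (B & <- & HB). simpl. auto.
  - intros x Hx. destruct (Hc x Hx) as (B & HB & HBx). exists (B, w).
    split; [apply in_map_iff; now exists B|]. simpl. auto.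
  - rewrite lsum_map. simpl. rewrite lsum_scal. now apply Rmult_le_compat_l.
Qed.

(** A box of weight [w] with [w * b < 1] covers no point of [A], because [phi <= b] there; such
    boxes are discarded, and the others have volume at most [b] times their weighted volume. *)
Lemma wcov_covb phi (A : R3 -> Prop) M b :
  0 < b -> (forall x, A x -> phi x <= b) -> wcov phi A M -> covb A (b * M).
Proof.
  intros Hb HA (l & Hv & Hc & Hs).
  destruct (lsum_filter_split (fun i : box * R => 1 <= snd i * b) l)
    as (l1 & l2 & L1 & L2 & _ & L4 & L5).
  exists (map fst l1). split; [|split].
  - intros B HB. apply in_map_iff in HB. destruct HB as (i & <- & Hi).
    apply Hv. now apply L1.
  - intros x Hx. destruct (Hc x Hx) as (i & Hi & Hix & Hiw). exists (fst i). split; [|assumption].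
    apply in_map. apply L5; [assumption|]. destruct (Hv i Hi) as [_ Hw].
    specialize (HA x Hx). nra.
  - rewrite lsum_map. apply Rle_trans with (b * lsum (fun i => snd i * vol (fst i)) l).
    + rewrite L4, Rmult_plus_distr_l, <- !lsum_scal.
      rewrite <- (Rplus_0_r (lsum (fun x => vol (fst x)) l1)). apply Rplus_le_compat.
      * apply lsum_le. intros i Hi. destruct (L1 i Hi) as [Hi' Hi1].
        pose proof (vol_pos _ (proj1 (Hv i Hi'))).
        replace (b * (snd i * vol (fst i))) with (snd i * b * vol (fst i)) by ring. nra.
      * apply lsum_nonneg. intros i Hi. destruct (L2 i Hi) as [Hi' _].
        destruct (Hv i Hi') as [V1 V2]. pose proof (vol_pos _ V1).
        apply Rmult_le_pos; [lra|]. nra.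
    + apply Rmult_le_compat_l; lra.
Qed.

Definition small (d : R) (B : box) : Prop :=
  p1 (snd B) - p1 (fst B) <= d /\ p2 (snd B) - p2 (fst B) <= d /\ p3 (snd B) - p3 (fst B) <= d.

(** Boxes in the range must not cross the plane of reflection, since the two sides of it have their
    preimages in different beams. *)
Definition onesided (B : box) : Prop := 0 <= p3 (fst B) \/ p3 (snd B) <= 0.

Lemma subdivide_onesided B d : valid B -> onesided B -> 0 < d ->
  exists l, (forall C, In C l -> valid C /\ small d C /\ onesided C) /\
    (forall x, inb B x -> exists C, In C l /\ inb C x) /\ lsum vol l <= vol B.
Proof.
  intros (V1 & V2 & V3) Ho Hd.
  set (D1 := p1 (snd B) - p1 (fst B)). set (D2 := p2 (snd B) - p2 (fst B)).
  set (D3 := p3 (snd B) - p3 (fst B)).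
  assert (P1 : 0 < D1) by (unfold D1; lra). assert (P2 : 0 < D2) by (unfold D2; lra).
  assert (P3 : 0 < D3) by (unfold D3; lra).
  destruct (INR_large ((D1 + D2 + D3) / d)) as (N & HN & HNd).
  assert (PN : 0 < INR N) by (apply lt_0_INR; lia).
  assert (HNd' : D1 + D2 + D3 < INR N * d) by (apply (Rlt_div_l (D1 + D2 + D3) (INR N) d); lra).
  assert (Q : forall D, 0 < D -> 0 < D / INR N /\ INR N * (D / INR N) = D).
  { intros D HD. split; [now apply Rdiv_lt_0_compat|field; lra]. }
  destruct (Q D1 P1) as [H1 E1]. destruct (Q D2 P2) as [H2 E2]. destruct (Q D3 P3) as [H3 E3].
  destruct (grid (fst B) _ _ _ N N N H1 H2 H3 HN HN HN) as (g & Hlen & Hin & Hcov).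
  rewrite E1, E2, E3 in Hin, Hcov.
  exists (map (fun c => mkbox c (D1 / INR N) (D2 / INR N) (D3 / INR N)) g). split; [|split].
  - intros C HC. apply in_map_iff in HC. destruct HC as (c & <- & Hc).
    split; [now apply mkbox_valid|]. specialize (Hin c Hc). split.
    + unfold small, mkbox. unfold p1, p2, p3; cbn [fst snd].
      assert (Hq : forall D, 0 < D -> D < INR N * d -> D / INR N <= d).
      { intros D HD HD'. apply (proj2 (Rle_div_l D d (INR N) PN)). lra. }
      pose proof (Hq D1 P1 ltac:(lra)). pose proof (Hq D2 P2 ltac:(lra)).
      pose proof (Hq D3 P3 ltac:(lra)). lra.
    + unfold onesided, mkbox. unfold D3 in Hin. destruct Ho as [Ho|Ho]; [left|right];
      unfold p1, p2, p3 in *; cbn [fst snd] in *; unfold D3, p3; lra.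
  - intros x Hx. destruct (Hcov x) as (c & Hc & Hcx).
    { rewrite mkbox_inb. unfold inb, D1, D2, D3 in *. lra. }
    exists (mkbox c (D1 / INR N) (D2 / INR N) (D3 / INR N)). split; [|assumption].
    apply in_map_iff. now exists c.
  - rewrite lsum_map.
    rewrite (lsum_ext _ (fun _ => D1 / INR N * (D2 / INR N) * (D3 / INR N)))
      by (intros; apply mkbox_vol).
    rewrite lsum_const, Hlen, !mult_INR. unfold vol. fold D1 D2 D3. right. field. lra.
Qed.

Lemma subdivide B d : valid B -> 0 < d ->
  exists l, (forall C, In C l -> valid C /\ small d C /\ onesided C) /\
    (forall x, inb B x -> exists C, In C l /\ inb C x) /\ lsum vol l <= vol B.
Proof.
  intros HB Hd. destruct (classic (onesided B)) as [Ho|Ho]; [now apply subdivide_onesided|].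
  unfold onesided in Ho. apply not_or_and in Ho. destruct Ho as [O1 O2].
  destruct HB as (V1 & V2 & V3). destruct B as [[[a1 a2] a3] [[b1 b2] b3]].
  unfold p1, p2, p3 in *; cbn [fst snd] in *.
  destruct (subdivide_onesided ((a1, a2, a3), (b1, b2, 0)) d) as (l1 & L1 & C1 & S1).
  { unfold valid, p1, p2, p3; cbn [fst snd]. lra. }
  { right. unfold p3; cbn [fst snd]. lra. }
  { assumption. }
  destruct (subdivide_onesided ((a1, a2, 0), (b1, b2, b3)) d) as (l2 & L2 & C2 & S2).
  { unfold valid, p1, p2, p3; cbn [fst snd]. lra. }
  { left. unfold p3; cbn [fst snd]. lra. }
  { assumption. }
  exists (l1 ++ l2). split; [|split].
  - intros C HC. apply in_app_or in HC. destruct HC; auto.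
  - intros x Hx. unfold inb, p1, p2, p3 in Hx; cbn [fst snd] in Hx.
    destruct (Rle_lt_dec (p3 x) 0) as [H|H].
    + destruct (C1 x) as (C & HC & HCx); [unfold inb, p1, p2, p3 in *; cbn [fst snd] in *; lra|].
      exists C. split; [apply in_or_app; now left|assumption].
    + destruct (C2 x) as (C & HC & HCx); [unfold inb, p1, p2, p3 in *; cbn [fst snd] in *; lra|].
      exists C. split; [apply in_or_app; now right|assumption].
  - rewrite lsum_app. unfold vol in *; unfold p1, p2, p3 in *; cbn [fst snd] in *. lra.
Qed.

(* Pulling a small box back by [f] into [W] multiplies its content by at most
   [K / g]. *)
Definition pullback (f : R3 -> R3) (W : R3 -> Prop) (g : R3 -> R) (K : R) : Prop :=
  exists d, 0 < d /\ forall B, valid B -> small d B -> onesided B ->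
    exists c, 0 < c /\ covb (fun x => W x /\ inb B (f x)) (c * vol B) /\
      forall x, W x -> inb B (f x) -> c * g x <= K.

Lemma pullback_mono f (W W' : R3 -> Prop) g K :
  (forall x, W' x -> W x) -> pullback f W g K -> pullback f W' g K.
Proof.
  intros H (d & Hd & HB). exists d. split; [assumption|]. intros B V S O.
  destruct (HB B V S O) as (c & Hc & Hcov & Hcg). exists c. split; [assumption|]. split.
  - revert Hcov. apply covb_mono; [|lra]. intros x []; auto.
  - auto.
Qed.

(** The change-of-variables inequality. The pulled back piece of a small box [C] has content at most
    [c * vol C]; giving it the weight [w * kappa / c] cancels the unknown factor [c], and the
    hypothesis on [phi] says precisely that this weight is large enough. *)
Lemma pullback_wcov f (W : R3 -> Prop) g K phi kappa M : pullback f W g K -> 0 <= kappa ->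
  (forall x, W x -> 0 < g x /\ K * phi (f x) <= kappa * phi x * g x) ->
  wcov phi (fun y => exists x, W x /\ y = f x) M -> wcov phi W (kappa * M).
Proof.
  intros (d & Hd & HB) Hk HW (l & Hv & Hc & Hs).
  apply wcov_union with (l := l)
    (F := fun i x => W x /\ inb (fst i) (f x) /\ 1 <= snd i * phi (f x))
    (m := fun i => kappa * (snd i * vol (fst i))).
  - intros [B w] Hi. destruct (Hv _ Hi) as [V Hw]. cbn [fst snd] in *.
    destruct (subdivide B d V Hd) as (s & Sv & Sc & Ss).
    apply wcov_union with (l := s)
      (F := fun C x => W x /\ inb C (f x) /\ 1 <= w * phi (f x))
      (m := fun C => kappa * (w * vol C)).
    + intros C HC. destruct (Sv C HC) as (VC & SmC & OC).
      destruct (HB C VC SmC OC) as (c & Hc0 & Hcov & Hcg).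
      replace (kappa * (w * vol C)) with ((w * kappa / c) * (c * vol C)) by (field; lra).
      apply covb_wcov.
      * apply Rle_mult_inv_pos; [now apply Rmult_le_pos|assumption].
      * intros x (Wx & Ix & Hx). destruct (HW x Wx) as [Hg HK]. specialize (Hcg x Wx Ix).
        (* Positivity comes from the covering condition [1 <= w * phi (f x)] with [w >= 0]. *)
        assert (Hp : 0 < phi (f x)).
        { apply Rnot_le_lt. intros Hle. assert (0 <= w * - phi (f x)) by (apply Rmult_le_pos; lra). lra. }
        assert (H1 : c * phi (f x) <= kappa * phi x).
        { apply Rmult_le_reg_r with (g x); [assumption|].
          pose proof (Rmult_le_compat_r (phi (f x)) _ _ (Rlt_le _ _ Hp) Hcg). lra. }
        apply Rle_trans with (w * phi (f x)); [assumption|].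
        replace (w * kappa / c * phi x) with (w * (kappa * phi x / c)) by (field; lra).
        apply Rmult_le_compat_l; [assumption|].
        apply (proj1 (Rle_div_r (phi (f x)) (kappa * phi x) c Hc0)). lra.
      * revert Hcov. apply covb_mono; [|lra]. tauto.
    + intros x (Wx & Ix & Hx). destruct (Sc _ Ix) as (C & HC & HCx). now exists C.
    + rewrite lsum_scal, lsum_scal. apply Rmult_le_compat_l; [assumption|].
      now apply Rmult_le_compat_l.
  - intros x Wx. destruct (Hc (f x)) as (i & Hi & Hix); [now exists x|]. exists i. tauto.
  - rewrite lsum_scal. now apply Rmult_le_compat_l.
Qed.

Lemma box_compact (B : box) (P : nat -> R3 -> Prop) : valid B ->
  (forall x, inb B x -> exists n d, 0 < d /\ forall y, dist3 x y < d -> P n y) ->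
  exists N, forall x, inb B x -> exists n, (n <= N)%nat /\ P n x.
Proof.
  intros HB HP.
  set (emb := fun t : Compactness.Tn 3 R => ((fst t, fst (snd t)), fst (snd (snd t))) : R3).
  set (inv := fun x : R3 => (p1 x, (p2 x, (p3 x, tt))) : Compactness.Tn 3 R).
  assert (HQ : forall x, exists q : nat * posreal, inb B x -> forall y, dist3 x y < snd q -> P (fst q) y).
  { intros x. destruct (classic (inb B x)) as [Hx|Hx].
    - destruct (HP x Hx) as (n & d & Hd & H). exists (n, mkposreal d Hd). auto.
    - exists (O, mkposreal 1 Rlt_0_1). tauto. }
  set (q := fun x => proj1_sig (constructive_indefinite_description _ (HQ x))).
  assert (Hq : forall x, inb B x -> forall y, dist3 x y < snd (q x) -> P (fst (q x)) y).
  { intros x. unfold q. now destruct (constructive_indefinite_description _ (HQ x)). }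
  (* The gauge is a third of the radius because a distance is bounded by the sum of three coordinate
     differences. The compactness result is doubly negated, hence the proof by contradiction. *)
  assert (Hthird : forall p : posreal, 0 < p / 3) by (intros p; pose proof (cond_pos p); lra).
  apply NNPP. intros Hno.
  apply (compactness_list 3 (inv (fst B)) (inv (snd B))
    (fun t => mkposreal _ (Hthird (snd (q (emb t)))))).
  intros (l & Hl). apply Hno.
  exists (fold_right Nat.max 0%nat (map (fun t => fst (q (emb t))) l)).
  intros x Hx. destruct (Hl (inv x)) as (t & Ht & Hbt & Hct).
  { unfold inv; simpl. unfold inb in Hx. tauto. }
  exists (fst (q (emb t))). split.
  - clear - Ht. revert Ht.  induction l as [|a l IH]; intros Ht; [contradiction|].
    cbn [map fold_right]. destruct Ht as [<-|Ht]; [apply Nat.le_max_l|].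
    apply Nat.le_trans with (1 := IH Ht). apply Nat.le_max_r.
  - destruct t as (t1 & t2 & t3 & []). simpl in Hbt, Hct. apply Hq.
    + unfold emb, inb; unfold p1, p2, p3 in *; cbn [fst snd] in *. tauto.
    + unfold emb in *. cbn [fst snd] in *.
      eapply Rle_lt_trans; [apply dist3_le_sum|].
      rewrite (Rabs_minus_sym _ (p1 x)), (Rabs_minus_sym _ (p2 x)), (Rabs_minus_sym _ (p3 x)).
      unfold p1, p2, p3 in *; cbn [fst snd] in *. lra.
Qed.

(* Borel-Cantelli: the sets [{x in V | G (f^n x)}] have outer measure at most
   [kappa^n M], so finitely many of them do not cover [V]. *)
Lemma eventually_outside (f : R3 -> R3) (phi : R3 -> R) (G : R3 -> Prop) (B : box) (kappa b M : R) :
  valid B -> 0 <= kappa < 1 -> 0 < b -> (forall x, inb B x -> phi x <= b) ->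
  (forall n x, inb B x -> G (Nat.iter n f x) ->
     exists d, 0 < d /\ forall y, dist3 x y < d -> G (Nat.iter n f y)) ->
  (forall k (A : R3 -> Prop) M', (forall x, A x -> exists v, inb B v /\ x = Nat.iter k f v) ->
     wcov phi (fun y => exists x, A x /\ y = f x) M' -> wcov phi A (kappa * M')) ->
  (forall n, wcov phi (fun y => G y /\ exists v, inb B v /\ y = Nat.iter n f v) M) ->
  exists x N, inb B x /\ forall n, (N <= n)%nat -> ~ G (Nat.iter n f x).
Proof.
  intros HB Hk Hb Hphi Hopen Hcontr Hfin. apply NNPP. intros Hno.
  assert (M0 : 0 <= M).
  { destruct (Hfin 0%nat) as (l & Hv & _ & Hs). apply Rle_trans with (2 := Hs).
    apply lsum_nonneg. intros i Hi. destruct (Hv i Hi) as [V W].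
    apply Rmult_le_pos; [assumption|]. left. now apply vol_pos. }
  assert (Hn : forall n, wcov phi (fun x => inb B x /\ G (Nat.iter n f x)) (kappa ^ n * M)).
  { intros n.
    (* The bound [M] at time [n] is pulled back one step at a time; after [j] steps it concerns the
       points at time [n - j]. *)
    assert (Hj : forall j, (j <= n)%nat -> wcov phi (fun y => exists x, (inb B x /\ G (Nat.iter n f x)) /\
       y = Nat.iter (n - j) f x) (kappa ^ j * M)).
    { induction j as [|j IH]; intros Hj.
      - apply wcov_mono with (3 := Hfin n); [|simpl; lra].
        intros y (x & [Hx HG] & ->). rewrite Nat.sub_0_r in *. split; [assumption|]. now exists x.
      - replace (kappa ^ S j * M) with (kappa * (kappa ^ j * M)) by (simpl; ring).
        apply (Hcontr (n - S j)%nat).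
        + intros y (x & [Hx HG] & ->). now exists x.
        + apply wcov_mono with (3 := IH ltac:(lia)); [|lra].
          intros z (y & (x & Hx & ->) & ->). exists x. split; [assumption|].
          replace (n - j)%nat with (S (n - S j)) by lia. reflexivity. }
    apply wcov_mono with (3 := Hj n ltac:(lia)); [|lra].
    intros x Hx. exists x. split; [assumption|]. now rewrite Nat.sub_diag. }
  (* If every orbit returned to [G] after time [N], finitely many of the open conditions would cover
     [B], and the volume of [B] would be bounded by the tail of a geometric series. *)
  assert (Hsum : forall N, vol B <= b * (kappa ^ N * M / (1 - kappa))).
  { intros N.
    destruct (box_compact B (fun n y => (N <= n)%nat /\ G (Nat.iter n f y)) HB) as (N' & HN').
    { intros x Hx. apply NNPP. intros Hn'. apply Hno. exists x, N. split; [assumption|].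
      intros n Hle HG. apply Hn'. destruct (Hopen n x Hx HG) as (d & Hd & H).
      exists n, d. auto. }
    apply covb_vol with (A := inb B); [assumption|auto|].
    apply wcov_covb with phi; [assumption|assumption|].
    apply wcov_union with (l := seq N (S N')) (F := fun n x => inb B x /\ G (Nat.iter n f x))
      (m := fun n => kappa ^ n * M).
    - intros; apply Hn.
    - intros x Hx. destruct (HN' x Hx) as (n & Hle & Hle' & HG). exists n.
      split; [apply in_seq; lia|auto].
    - assert (Geo : forall s k, lsum (fun n => kappa ^ n * M) (seq k s) <= kappa ^ k * M / (1 - kappa)).
      { induction s as [|s IHs]; intros k.
        - unfold lsum; simpl. apply Rle_mult_inv_pos; [|lra].
          apply Rmult_le_pos; [apply pow_le; lra|assumption].
        - change (kappa ^ k * M + lsum (fun n => kappa ^ n * M) (seq (S k) s) <= kappa ^ k * M / (1 - kappa)).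
          apply Rle_trans with (kappa ^ k * M + kappa ^ S k * M / (1 - kappa)).
          + apply Rplus_le_compat_l. apply IHs.
          + right. simpl. field. lra. }
      apply Geo. }
  pose proof (vol_pos B HB) as Hvol.
  (* The denominator is [b * M + 1] because [M] may vanish. *)
  assert (Hq : 0 < vol B / (b * M + 1) * (1 - kappa)).
  { apply Rmult_lt_0_compat; [|lra]. apply Rdiv_lt_0_compat; [assumption|]. nra. }
  destruct (pow_lt_1_zero kappa) with (2 := Hq) as (N & HN).
  { rewrite Rabs_pos_eq; lra. }
  specialize (HN N ltac:(lia)). rewrite Rabs_pos_eq in HN by (apply pow_le; lra).
  specialize (Hsum N).
  assert (Hbm : 0 <= b * M) by nra.
  assert (E : kappa ^ N / (1 - kappa) < vol B / (b * M + 1)).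
  { apply (proj2 (Rlt_div_l (kappa ^ N) (vol B / (b * M + 1)) (1 - kappa) ltac:(lra))). exact HN. }
  assert (E2 : b * (kappa ^ N * M / (1 - kappa)) = b * M * (kappa ^ N / (1 - kappa))) by (field; lra).
  rewrite E2 in Hsum.
  assert (E3 : vol B / (b * M + 1) * (b * M + 1) = vol B) by (field; lra).
  assert (0 <= kappa ^ N / (1 - kappa)) by (apply Rle_mult_inv_pos; [apply pow_le|]; lra).
  set (z := kappa ^ N / (1 - kappa)) in *. set (y := vol B / (b * M + 1)) in *. nra.
Qed.

(** * The Zorich map *)

Lemma sgnZ_cases k : sgnZ k = 1 \/ sgnZ k = -1.
Proof. unfold sgnZ. destruct (Z.even k); auto. Qed.

Lemma sgnZ_sq k : sgnZ k * sgnZ k = 1.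
Proof. destruct (sgnZ_cases k) as [-> | ->]; ring. Qed.

Lemma sgnZ_add a b : sgnZ (a + b) = sgnZ a * sgnZ b.
Proof.
  unfold sgnZ. rewrite Z.even_add. destruct (Z.even a), (Z.even b); simpl; ring.
Qed.

Lemma sgnZ_opp k : sgnZ (- k) = sgnZ k.
Proof. unfold sgnZ. now rewrite Z.even_opp. Qed.

Lemma sgnZ_succ k : sgnZ (k + 1) = - sgnZ k.
Proof. rewrite sgnZ_add. unfold sgnZ at 2. simpl. ring. Qed.

Lemma sgnZ_double k : sgnZ (2 * k) = 1.
Proof. unfold sgnZ. now rewrite Z.even_mul. Qed.

Lemma Rabs_sgnZ k a : Rabs (sgnZ k * a) = Rabs a.
Proof.
  rewrite Rabs_mult. destruct (sgnZ_cases k) as [-> | ->].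
  - rewrite Rabs_R1. ring.
  - replace (-1) with (- (1)) by ring. rewrite Rabs_Ropp, Rabs_R1. ring.
Qed.

(** The chart of the [k]-th interval over [[-1, 1]], inverse to the normalised fold. Unlike [fold_k]
    it does not single out one of the two intervals at a common endpoint. *)
Definition unf (lam : R) (k : Z) (a : R) : R := 2 * IZR k * lam + sgnZ k * (lam * a).

Lemma fold_k_bounds lam t : 0 < lam ->
  (2 * IZR (fold_k lam t) - 1) * lam <= t < (2 * IZR (fold_k lam t) + 1) * lam.
Proof.
  intros Hl. unfold fold_k.
  destruct (base_Int_part ((t + lam) / (2 * lam))) as [H1 H2].
  set (k := IZR (Int_part ((t + lam) / (2 * lam)))) in *.
  assert (E : (t + lam) / (2 * lam) * (2 * lam) = t + lam) by (field; lra).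
  set (q := (t + lam) / (2 * lam)) in *. nra.
Qed.

(** At the right endpoint of an interval [fold_k] already returns the next index, but both folds
    have the same value there; the case [Rabs a = 1] records this. *)
Lemma fold_unf lam k a : 0 < lam -> Rabs a <= 1 ->
  fold lam (unf lam k a) = lam * a /\ (fold_k lam (unf lam k a) = k \/ Rabs a = 1).
Proof.
  intros Hl Ha. apply Rabs_le_between in Ha. set (t := unf lam k a).
  pose proof (fold_k_bounds lam t Hl) as Hm. set (m := fold_k lam t) in *.
  assert (Ht : (2 * IZR k - 1) * lam <= t <= (2 * IZR k + 1) * lam).
  { unfold t, unf. destruct (sgnZ_cases k) as [-> | ->]; nra. }
  destruct (Req_dec t ((2 * IZR k + 1) * lam)) as [He|Hne].
  - assert (Hmk : m = (k + 1)%Z).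
    { assert (IZR m < IZR k + 2) by nra. assert (IZR k < IZR m) by nra.
      rewrite <- plus_IZR in H. apply lt_IZR in H, H0. lia. }
    assert (Hsa : sgnZ k * a = 1).
    { unfold t, unf in He. apply Rmult_eq_reg_l with lam; lra. }
    assert (Has : a = sgnZ k).
    { rewrite <- (Rmult_1_l a), <- (sgnZ_sq k), Rmult_assoc, Hsa. ring. }
    split.
    + unfold fold. fold m. rewrite Hmk, sgnZ_succ, He, plus_IZR, Has. ring.
    + right. rewrite Has. destruct (sgnZ_cases k) as [-> | ->]; unfold Rabs; destruct Rcase_abs; lra.
  - assert (Hmk : m = k).
    { assert (IZR m < IZR k + 1) by nra. assert (IZR k < IZR m + 1) by nra.
      rewrite <- plus_IZR in H, H0. apply lt_IZR in H, H0. lia. }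
    split; [|now left]. unfold fold. fold m. rewrite Hmk. unfold t, unf.
    replace (sgnZ k * (2 * IZR k * lam + sgnZ k * (lam * a) - 2 * IZR k * lam))
      with (sgnZ k * sgnZ k * (lam * a)) by ring.
    rewrite sgnZ_sq. ring.
Qed.

Lemma unf_fold lam t : 0 < lam ->
  t = unf lam (fold_k lam t) (fold lam t / lam) /\ Rabs (fold lam t / lam) <= 1.
Proof.
  intros Hl. pose proof (fold_k_bounds lam t Hl) as H. unfold unf, fold.
  set (m := fold_k lam t) in *. split.
  - replace (sgnZ m * (lam * (sgnZ m * (t - 2 * IZR m * lam) / lam)))
      with ((sgnZ m * sgnZ m) * (t - 2 * IZR m * lam)) by (field; lra).
    rewrite sgnZ_sq. ring.
  - replace (sgnZ m * (t - 2 * IZR m * lam) / lam) with (sgnZ m * ((t - 2 * IZR m * lam) / lam)) by (field; lra).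
    rewrite Rabs_sgnZ. apply Rabs_le. split.
    + apply (proj1 (Rle_div_r (- (1)) (t - 2 * IZR m * lam) lam Hl)). lra.
    + apply (proj2 (Rle_div_l (t - 2 * IZR m * lam) 1 lam Hl)). lra.
Qed.

Lemma fold_bound lam t : 0 < lam -> Rabs (fold lam t) <= lam.
Proof.
  intros Hl. destruct (unf_fold lam t Hl) as [_ H].
  replace (fold lam t) with (lam * (fold lam t / lam)) by (field; lra).
  rewrite Rabs_mult, (Rabs_pos_eq lam) by lra. nra.
Qed.

Lemma fold_small lam t : 0 < lam -> Rabs t <= lam -> fold lam t = t.
Proof.
  intros Hl Ht.
  destruct (fold_unf lam 0 (t / lam) Hl) as [H _].
  - unfold Rdiv. rewrite Rabs_mult, (Rabs_pos_eq (/ lam)) by (left; now apply Rinv_0_lt_compat).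
    apply (proj2 (Rle_div_l (Rabs t) 1 lam Hl)). lra.
  - replace (unf lam 0 (t / lam)) with t in H.
    + rewrite H. field. lra.
    + unfold unf, sgnZ; simpl. field. lra.
Qed.

Lemma fold_shift lam j t : 0 < lam -> fold lam (t + 2 * IZR j * lam) = sgnZ j * fold lam t.
Proof.
  intros Hl. destruct (unf_fold lam t Hl) as [E H].
  set (k := fold_k lam t) in *. set (a := fold lam t / lam) in *.
  assert (Ea : fold lam t = lam * a) by (unfold a; field; lra).
  destruct (fold_unf lam (k + j) (sgnZ j * a) Hl) as [F _]; [now rewrite Rabs_sgnZ|].
  rewrite Ea. replace (t + 2 * IZR j * lam) with (unf lam (k + j) (sgnZ j * a)).
  - rewrite F. ring.
  - rewrite E at 1. unfold unf. rewrite sgnZ_add, plus_IZR.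
    replace (sgnZ k * sgnZ j * (lam * (sgnZ j * a))) with (sgnZ k * (lam * a) * (sgnZ j * sgnZ j)) by ring.
    rewrite sgnZ_sq. ring.
Qed.

Lemma fold_opp lam t : 0 < lam -> fold lam (- t) = - fold lam t.
Proof.
  intros Hl. destruct (unf_fold lam t Hl) as [E H].
  set (k := fold_k lam t) in *. set (a := fold lam t / lam) in *.
  assert (Ea : fold lam t = lam * a) by (unfold a; field; lra).
  destruct (fold_unf lam (- k) (- a) Hl) as [F _]; [now rewrite Rabs_Ropp|].
  rewrite Ea. replace (- t) with (unf lam (- k) (- a)).
  - rewrite F. ring.
  - rewrite E. unfold unf. rewrite sgnZ_opp, opp_IZR. ring.
Qed.

Lemma fold_lipschitz_le lam a b : 0 < lam -> a <= b -> Rabs (fold lam a - fold lam b) <= b - a.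
Proof.
  intros Hl Hab.
  pose proof (fold_k_bounds lam a Hl) as Ha. pose proof (fold_k_bounds lam b Hl) as Hb.
  pose proof (fold_bound lam a Hl) as Fa. pose proof (fold_bound lam b Hl) as Fb.
  unfold fold in *. set (k := fold_k lam a) in *. set (m := fold_k lam b) in *.
  assert (Hkm : (k <= m)%Z).
  { assert (IZR k < IZR m + 1) by nra. rewrite <- plus_IZR in H. apply lt_IZR in H. lia. }
  destruct (Z.eq_dec k m) as [->|Hne].
  - replace (sgnZ m * (a - 2 * IZR m * lam) - sgnZ m * (b - 2 * IZR m * lam)) with (sgnZ m * (a - b)) by ring.
    rewrite Rabs_sgnZ, Rabs_left1; lra.
  - destruct (Z.eq_dec m (k + 1)) as [->|Hne'].
    + rewrite sgnZ_succ, plus_IZR in *.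
      replace (sgnZ k * (a - 2 * IZR k * lam) - - sgnZ k * (b - 2 * (IZR k + 1) * lam))
        with (sgnZ k * ((a - (2 * IZR k + 1) * lam) + (b - (2 * IZR k + 1) * lam))) by ring.
      rewrite Rabs_sgnZ. apply Rabs_le. lra.
    + assert (Hk2 : IZR k + 2 <= IZR m) by (rewrite <- plus_IZR; apply IZR_le; lia).
      assert (2 * lam <= b - a) by nra.
      apply Rabs_le_between in Fa, Fb. apply Rabs_le. lra.
Qed.

Lemma fold_lipschitz lam a b : 0 < lam -> Rabs (fold lam a - fold lam b) <= Rabs (a - b).
Proof.
  intros Hl. destruct (Rle_lt_dec a b) as [H|H].
  - rewrite (Rabs_left1 (a - b)) by lra. pose proof (fold_lipschitz_le lam a b Hl H). lra.
  - rewrite Rabs_minus_sym, (Rabs_pos_eq (a - b)) by lra.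
    apply fold_lipschitz_le; lra.
Qed.

Lemma fold_abs_le lam t : 0 < lam -> Rabs (fold lam t) <= Rabs t.
Proof.
  intros Hl. pose proof (fold_lipschitz lam t 0 Hl) as H.
  rewrite (fold_small lam 0 Hl) in H by (rewrite Rabs_R0; lra).
  now rewrite !Rminus_0_r in H.
Qed.

Definition hnorm (x : R3) : R := sqrt (p1 x ^ 2 + p2 x ^ 2).

Lemma hnorm_sq x : hnorm x ^ 2 = p1 x ^ 2 + p2 x ^ 2.
Proof. unfold hnorm. rewrite pow2_sqrt; [reflexivity | nra]. Qed.

Lemma hnorm_pos x : 0 <= hnorm x.
Proof. apply sqrt_pos. Qed.

Lemma norm2_sq a : norm2 a ^ 2 = fst a ^ 2 + snd a ^ 2.
Proof. unfold norm2. rewrite pow2_sqrt; [reflexivity | nra]. Qed.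

Lemma dist2_sq a b : dist2 a b ^ 2 = (fst a - fst b) ^ 2 + (snd a - snd b) ^ 2.
Proof. unfold dist2. now rewrite norm2_sq. Qed.

Lemma dist2_pos a b : 0 <= dist2 a b.
Proof. apply sqrt_pos. Qed.

Lemma dist2_0 a b : dist2 a b <= 0 -> a = b.
Proof.
  intros H. pose proof (dist2_pos a b). pose proof (dist2_sq a b) as E.
  replace (dist2 a b) with 0 in E by lra. destruct a as [a1 a2], b as [b1 b2]; cbn [fst snd] in *.
  pose proof (pow2_ge_0 (a1 - b1)). pose proof (pow2_ge_0 (a2 - b2)).
  f_equal; apply Rminus_diag_uniq, Rsqr_0_uniq; unfold Rsqr; lra.
Qed.

Lemma pow2_le_inv (a b : R) : 0 <= b -> a ^ 2 <= b ^ 2 -> a <= b.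
Proof. intros Hb H. apply Rnot_lt_le. intros Hlt. nra. Qed.

Lemma norm3_tri (x y : R3) : norm3 x <= norm3 y + dist3 x y.
Proof. rewrite !norm3_dist. pose proof (dist3_tri x y origin3). lra. Qed.

Lemma small_dist d B x y : small d B -> inb B x -> inb B y -> dist3 x y <= 3 * d.
Proof.
  intros (S1 & S2 & S3) (X1 & X2 & X3) (Y1 & Y2 & Y3).
  eapply Rle_trans; [apply dist3_le_sum|].
  assert (Rabs (p1 x - p1 y) <= d) by (apply Rabs_le; lra).
  assert (Rabs (p2 x - p2 y) <= d) by (apply Rabs_le; lra).
  assert (Rabs (p3 x - p3 y) <= d) by (apply Rabs_le; lra). lra.
Qed.

(** The exponents are those of the pull-back estimates. In space the norms vary by factors [1 + t]
    and [1 - t], each to the third power, and the cover costs one more [1 + t]; in the plane the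
    powers are one lower. The [t] below solves [1 + 15 * t = theta * (1 - 3 * t)]. *)
Lemma slack_exists theta : 1 < theta ->
  exists t, 0 < t < 1 /\ (1 + t) ^ 4 <= theta * (1 - t) ^ 3 /\ (1 + t) ^ 3 <= theta * (1 - t) ^ 2.
Proof.
  intros Ht. set (t := (theta - 1) / (15 + 3 * theta)). exists t.
  assert (T0 : 0 < t) by (apply Rdiv_lt_0_compat; lra).
  assert (E : t * (15 + 3 * theta) = theta - 1) by (unfold t; field; lra).
  assert (T1 : t < 1/3) by nra.
  assert (A4 : (1 + t) ^ 4 <= 1 + 15 * t).
  { assert (t * t <= t) by nra. assert (t ^ 3 <= t) by (simpl; nra). assert (t ^ 4 <= t) by (simpl; nra).
    replace ((1 + t) ^ 4) with (1 + 4 * t + 6 * (t * t) + 4 * t ^ 3 + t ^ 4) by ring. lra. }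
  assert (B3 : 1 - 3 * t <= (1 - t) ^ 3).
  { replace ((1 - t) ^ 3) with (1 - 3 * t + t * t * (3 - t)) by ring. nra. }
  assert (M : theta * (1 - 3 * t) <= theta * (1 - t) ^ 3) by (apply Rmult_le_compat_l; lra).
  split; [lra|]. split; [lra|].
  assert ((1 + t) ^ 3 <= (1 + t) ^ 4) by (apply Rle_pow; [lra|lia]).
  assert ((1 - t) ^ 3 <= (1 - t) ^ 2).
  { replace ((1 - t) ^ 3) with ((1 - t) ^ 2 * (1 - t)) by ring.
    pose proof (pow2_ge_0 (1 - t)). nra. }
  assert (theta * (1 - t) ^ 3 <= theta * (1 - t) ^ 2) by (apply Rmult_le_compat_l; lra). lra.
Qed.

Definition contmap (f : R3 -> R3) : Prop :=
  forall x e, 0 < e -> exists d, 0 < d /\ forall y, dist3 x y < d -> dist3 (f x) (f y) < e.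

Lemma contmap_iter f n : contmap f -> contmap (Nat.iter n f).
Proof.
  intros Hf. induction n as [|n IH]; intros x e He.
  - exists e. auto.
  - destruct (Hf (Nat.iter n f x) e He) as (d & Hd & H). destruct (IH x d Hd) as (d' & Hd' & H').
    exists d'. split; [assumption|]. intros y Hy. apply H. now apply H'.
Qed.

(** The segment from [a] to [b] contains an endpoint of the interval of [a]. This controls the jump
    of the sign across a face. *)
Lemma fold_k_differ lam a b : 0 < lam -> fold_k lam a <> fold_k lam b ->
  lam - Rabs (fold lam a) <= Rabs (a - b).
Proof.
  intros Hl Hne. pose proof (fold_k_bounds lam a Hl) as Ha. pose proof (fold_k_bounds lam b Hl) as Hb.
  unfold fold. rewrite Rabs_sgnZ. set (k := fold_k lam a) in *. set (m := fold_k lam b) in *.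
  destruct (Z_lt_le_dec k m) as [H|H].
  - assert (IZR k + 1 <= IZR m) by (rewrite <- plus_IZR; apply IZR_le; lia).
    assert ((2 * IZR k + 1) * lam <= b) by nra.
    rewrite (Rabs_left1 (a - b)) by lra. pose proof (Rle_abs (a - 2 * IZR k * lam)). lra.
  - assert (IZR m + 1 <= IZR k) by (rewrite <- plus_IZR; apply IZR_le; lia).
    assert (b <= (2 * IZR k - 1) * lam) by nra.
    rewrite (Rabs_pos_eq (a - b)) by lra. pose proof (Rle_abs (- (a - 2 * IZR k * lam))).
    rewrite Rabs_Ropp in *. lra.
Qed.

(** An endpoint also belongs to the neighbouring interval, whose index has the opposite parity; both
    signs of the image are thus available on a face. *)
Lemma unf_alternative lam k a : Rabs a = 1 -> exists k', unf lam k' a = unf lam k a /\ sgnZ k' = - sgnZ k.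
Proof.
  intros Ha. assert (H : sgnZ k * a = 1 \/ sgnZ k * a = -1).
  { rewrite <- (Rabs_sgnZ k) in Ha. unfold Rabs in Ha. destruct (Rcase_abs _) in Ha; lra. }
  destruct H as [H|H].
  - exists (k + 1)%Z. unfold unf. rewrite sgnZ_succ, plus_IZR. split; [|reflexivity].
    replace (- sgnZ k * (lam * a)) with (- lam * (sgnZ k * a)) by ring.
    replace (sgnZ k * (lam * a)) with (lam * (sgnZ k * a)) by ring. rewrite H. ring.
  - exists (k + -1)%Z. unfold unf. rewrite sgnZ_add, plus_IZR.
    replace (sgnZ (-1)) with (-1) by (unfold sgnZ; simpl; lra). split; [|ring].
    replace (sgnZ k * -1 * (lam * a)) with (- lam * (sgnZ k * a)) by ring.
    replace (sgnZ k * (lam * a)) with (lam * (sgnZ k * a)) by ring. rewrite H. ring.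
Qed.

(** Boxes are convex, so the intermediate value theorem along segments keeps [g] between two
    consecutive lattice values. *)
Lemma box_avoids_lattice (B : box) (g : R3 -> R) (c : R) : valid B -> 0 < c ->
  (forall x e, 0 < e -> exists d, 0 < d /\ forall y, dist3 x y < d -> Rabs (g x - g y) < e) ->
  (forall x k, inb B x -> g x <> IZR k * c) ->
  exists k, forall x, inb B x -> IZR k * c < g x < IZR (k + 1) * c.
Proof.
  intros (V1 & V2 & V3) Hc Hg Hno.
  set (x0 := fst B). assert (I0 : inb B x0) by (unfold inb, x0; lra).
  destruct (base_Int_part (g x0 / c)) as [K1 K2]. set (k := Int_part (g x0 / c)) in *.
  assert (E0 : g x0 / c * c = g x0) by (field; lra).
  assert (G0 : IZR k * c < g x0 < IZR (k + 1) * c).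
  { rewrite plus_IZR. pose proof (Hno x0 k I0). set (q := g x0 / c) in *. split; [|nra].
    assert (IZR k * c <= g x0) by nra. lra. }
  exists k. intros x Ix.
  set (gam := fun t : R => (p1 x0 + t * (p1 x - p1 x0), p2 x0 + t * (p2 x - p2 x0), p3 x0 + t * (p3 x - p3 x0)) : R3).
  assert (Cg : continuity (fun t => g (gam t))).
  { intros t e He. destruct (Hg (gam t) e He) as (d & Hd & H).
    set (S := Rabs (p1 x - p1 x0) + Rabs (p2 x - p2 x0) + Rabs (p3 x - p3 x0)).
    assert (S0 : 0 <= S) by (unfold S; repeat apply Rplus_le_le_0_compat; apply Rabs_pos).
    exists (d / (S + 1)). split; [apply Rdiv_lt_0_compat; lra|].
    intros s [_ Hs]. simpl in *. unfold Rdist in *. rewrite Rabs_minus_sym. apply H.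
    eapply Rle_lt_trans; [apply dist3_le_sum|]. unfold gam. proj3.
    replace (p1 x0 + t * (p1 x - p1 x0) - (p1 x0 + s * (p1 x - p1 x0))) with ((t - s) * (p1 x - p1 x0)) by ring.
    replace (p2 x0 + t * (p2 x - p2 x0) - (p2 x0 + s * (p2 x - p2 x0))) with ((t - s) * (p2 x - p2 x0)) by ring.
    replace (p3 x0 + t * (p3 x - p3 x0) - (p3 x0 + s * (p3 x - p3 x0))) with ((t - s) * (p3 x - p3 x0)) by ring.
    rewrite !Rabs_mult, <- !Rmult_plus_distr_l. fold S. rewrite Rabs_minus_sym in Hs.
    apply Rle_lt_trans with (Rabs (t - s) * (S + 1)).
    - apply Rmult_le_compat_l; [apply Rabs_pos|lra].
    - replace d with (d / (S + 1) * (S + 1)) by (field; lra). apply Rmult_lt_compat_r; lra. }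
  assert (Ig : forall t, 0 <= t <= 1 -> inb B (gam t)).
  { intros t Ht. unfold inb, gam in *. proj3. nra. }
  assert (E1 : gam 1 = x).
  { rewrite (R3_eta x). unfold gam. f_equal; [f_equal|]; ring. }
  assert (E2 : gam 0 = x0).
  { rewrite (R3_eta x0). unfold gam. f_equal; [f_equal|]; ring. }
  assert (No : forall j, ~ (Rmin (g x0) (g x) <= IZR j * c <= Rmax (g x0) (g x))).
  { intros j Hj. destruct (IVT_gen (fun t => g (gam t)) 0 1 (IZR j * c) Cg) as (t & Ht & Et).
    - now rewrite E1, E2.
    - rewrite Rmin_left, Rmax_right in Ht by lra. apply (Hno (gam t) j); auto. }
  split; apply Rnot_le_lt; intros Hle.
  - apply (No k). unfold Rmin, Rmax. destruct (Rle_dec _ _); lra.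
  - apply (No (k + 1)%Z). unfold Rmin, Rmax. destruct (Rle_dec _ _); lra.
Qed.

Lemma unf_exists lam i t : 0 < lam ->
  exists b, t = unf lam i b /\ lam * Rabs b = Rabs (t - 2 * IZR i * lam).
Proof.
  intros Hl. exists (sgnZ i * ((t - 2 * IZR i * lam) / lam)). split.
  - unfold unf. replace (sgnZ i * (lam * (sgnZ i * ((t - 2 * IZR i * lam) / lam))))
      with (sgnZ i * sgnZ i * (t - 2 * IZR i * lam)) by (field; lra). rewrite sgnZ_sq. ring.
  - rewrite Rabs_sgnZ. rewrite <- (Rabs_pos_eq lam) at 1 by lra. rewrite <- Rabs_mult. f_equal. field. lra.
Qed.

(** The wall is the common endpoint of the intervals [j] and [j + 1]. The first case includes the
    wall itself, and its last clause then supplies the representation from the other side. *)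
Lemma interval_rep lam t j : 0 < lam -> Rabs (t - (2 * IZR j + 1) * lam) < lam ->
  (exists b, Rabs b <= 1 /\ t = unf lam j b /\
     (Rabs b = 1 -> exists b', Rabs b' <= 1 /\ t = unf lam (j + 1) b')) \/
  (exists b, Rabs b < 1 /\ t = unf lam (j + 1) b).
Proof.
  intros Hl Ht. apply Rabs_lt_between in Ht.
  destruct (unf_exists lam j t Hl) as (b & E & A). destruct (unf_exists lam (j + 1) t Hl) as (b' & E' & A'). rewrite plus_IZR in A'.
  destruct (Rle_lt_dec t ((2 * IZR j + 1) * lam)) as [H|H].
  - left. rewrite (Rabs_pos_eq (t - _)) in A by lra. exists b. split; [nra|]. split; [assumption|].
    intros Hb. exists b'. split; [|assumption]. rewrite Hb in A. rewrite (Rabs_left (t - _)) in A' by lra. nra.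
  - right. exists b'. split; [|assumption]. rewrite (Rabs_left (t - _)) in A' by lra. nra.
Qed.

Lemma ln_le_sub1 x : 0 < x -> ln x <= x - 1.
Proof.
  intros Hx. pose proof (exp_ineq1_le (ln x)) as H. rewrite exp_ln in H by assumption. lra.
Qed.

Lemma norm3_le_sum x : norm3 x <= Rabs (p1 x) + Rabs (p2 x) + Rabs (p3 x).
Proof.
  rewrite norm3_dist. eapply Rle_trans; [apply dist3_le_sum|]. unfold origin3. proj3.
  rewrite !Rminus_0_r. lra.
Qed.

Lemma norm3_p1 x : Rabs (p1 x) <= norm3 x.
Proof.
  rewrite norm3_dist. pose proof (dist3_p1 x origin3) as H. unfold origin3 in H at 1. proj3 in H.
  now rewrite Rminus_0_r in H.
Qed.

Lemma norm3_p3 x : Rabs (p3 x) <= norm3 x.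
Proof.
  rewrite norm3_dist. pose proof (dist3_p3 x origin3) as H. unfold origin3 in H at 1. proj3 in H.
  now rewrite Rminus_0_r in H.
Qed.

Lemma norm3_hnorm x : norm3 x <= hnorm x + Rabs (p3 x).
Proof.
  pose proof (hnorm_pos x). pose proof (Rabs_pos (p3 x)).
  apply norm3_le; [lra|]. pose proof (hnorm_sq x). pose proof (pow2_abs (p3 x)). nra.
Qed.

Lemma hnorm_le_sum x : hnorm x <= Rabs (p1 x) + Rabs (p2 x).
Proof.
  pose proof (Rabs_pos (p1 x)). pose proof (Rabs_pos (p2 x)).
  apply pow2_le_inv; [lra|]. rewrite hnorm_sq, <- (pow2_abs (p1 x)), <- (pow2_abs (p2 x)). nra.
Qed.

Lemma norm3_origin x : x <> origin3 -> 0 < norm3 x.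
Proof.
  intros Hx. destruct (norm3_pos x) as [H|H]; [assumption|exfalso]. apply Hx.
  pose proof (norm3_sq x) as E. rewrite <- H in E.
  pose proof (pow2_ge_0 (p1 x)). pose proof (pow2_ge_0 (p2 x)). pose proof (pow2_ge_0 (p3 x)).
  rewrite (R3_eta x). unfold origin3. f_equal; [f_equal|]; apply Rsqr_0_uniq; unfold Rsqr; simpl in *; lra.
Qed.

Lemma unf_bound lam k t : 0 < lam -> Rabs t <= 1 -> Rabs (unf lam k t - 2 * IZR k * lam) <= lam.
Proof.
  intros Hl Ht. unfold unf.
  replace (2 * IZR k * lam + sgnZ k * (lam * t) - 2 * IZR k * lam) with (sgnZ k * (lam * t)) by ring.
  rewrite Rabs_sgnZ, Rabs_mult, (Rabs_pos_eq lam) by lra. nra.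
Qed.

Lemma sign_index z : exists e, (e = 0 \/ e = 1)%Z /\ sgnZ e * Rabs z = z.
Proof.
  destruct (Rle_lt_dec 0 z).
  - exists 0%Z. split; [auto|]. rewrite Rabs_pos_eq by assumption. unfold sgnZ; simpl. lra.
  - exists 1%Z. split; [auto|]. rewrite Rabs_left by assumption. unfold sgnZ; simpl. lra.
Qed.

Lemma inverse_exists (hf : R2 -> R3) :
  (forall y, norm3 y = 1 /\ 0 <= p3 y -> exists a, inQ a /\ hf a = y) ->
  exists Phi : R3 -> R2, forall y, norm3 y = 1 -> 0 <= p3 y -> inQ (Phi y) /\ hf (Phi y) = y.
Proof.
  intros Honto.
  assert (H : forall y, exists a, norm3 y = 1 -> 0 <= p3 y -> inQ a /\ hf a = y).
  { intros y. destruct (classic (norm3 y = 1 /\ 0 <= p3 y)) as [Hy|Hy].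
    - destruct (Honto y Hy) as (a & Ha). now exists a.
    - exists (0, 0). tauto. }
  exists (fun y => proj1_sig (constructive_indefinite_description _ (H y))).
  intros y. now destruct (constructive_indefinite_description _ (H y)).
Qed.

(** * The map in beam coordinates and its behaviour near the axis *)

Section Zorich.
Variables (L lam nu : R) (hf : R2 -> R3).
Hypothesis HL : 1 <= L.
Hypothesis Hbilip : forall a b, inQ a -> inQ b ->
  dist2 a b / L <= dist3 (hf a) (hf b) /\ dist3 (hf a) (hf b) <= L * dist2 a b.
Hypothesis Honto : forall y, (norm3 y = 1 /\ 0 <= p3 y) <-> exists a, inQ a /\ hf a = y.
Hypothesis Hbd : forall y, (norm3 y = 1 /\ p3 y = 0) <-> exists a, onbdQ a /\ hf a = y.
Hypothesis Hdiag : forall t, -1 <= t <= 1 ->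
  p1 (hf (t, t)) = p2 (hf (t, t)) /\ p1 (hf (t, - t)) = - p2 (hf (t, - t)).
Hypothesis Hlam1 : 1 <= lam.
Hypothesis Hnu0 : 0 < nu.
Hypothesis Hnulam : 4 / 3 <= nu * lam.
Hypothesis Hlam : L ^ 5 < lam.
Variable Phi : R3 -> R2.
Hypothesis HPhi : forall y, norm3 y = 1 -> 0 <= p3 y -> inQ (Phi y) /\ hf (Phi y) = y.

Let zor : R3 -> R3 := zorich hf lam nu.

(** The radius of the sphere containing the image of the horizontal plane through [x]. *)
Definition rad (x : R3) : R := nu * exp (p3 x) * lam.

Lemma rad_pos x : 0 < rad x.
Proof. unfold rad. pose proof (exp_pos (p3 x)). apply Rmult_lt_0_compat; [|lra]. nra. Qed.

Lemma hf_sphere a : inQ a -> p1 (hf a) ^ 2 + p2 (hf a) ^ 2 + p3 (hf a) ^ 2 = 1 /\ 0 <= p3 (hf a).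
Proof.
  intros Ha. destruct (proj2 (Honto (hf a)) (ex_intro _ a (conj Ha eq_refl))) as [H1 H2].
  rewrite <- norm3_sq, H1. split; [ring|assumption].
Qed.

Lemma hf_inj a b : inQ a -> inQ b -> hf a = hf b -> a = b.
Proof.
  intros Ha Hb E. destruct (Hbilip a b Ha Hb) as [H _]. rewrite E, dist3_refl in H.
  apply dist2_0. apply Rmult_le_reg_r with (/ L); [apply Rinv_0_lt_compat; lra|]. lra.
Qed.

Lemma hf_bd a : inQ a -> (p3 (hf a) = 0 <-> onbdQ a).
Proof.
  intros Ha. split; intros H.
  - destruct (proj2 (Honto (hf a)) (ex_intro _ a (conj Ha eq_refl))) as [H1 _].
    destruct (proj1 (Hbd (hf a)) (conj H1 H)) as (b & Hb & E).
    rewrite <- (hf_inj b a); [assumption|apply Hb|assumption|assumption].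
  - apply (proj2 (Hbd (hf a))). now exists a.
Qed.

Lemma inQ_0 : inQ (0, 0).
Proof. unfold inQ; cbn [fst snd]. rewrite Rabs_R0. lra. Qed.

Lemma hf_0 : hf (0, 0) = (0, 0, 1).
Proof.
  destruct (Hdiag 0 ltac:(lra)) as [D1 D2]. rewrite Ropp_0 in D2.
  destruct (hf_sphere _ inQ_0) as [S1 S2].
  rewrite (R3_eta (hf (0, 0))).
  assert (E2 : p2 (hf (0, 0)) = 0) by lra. assert (E1 : p1 (hf (0, 0)) = 0) by lra.
  rewrite E1, E2 in *. f_equal. nra.
Qed.

(** Valid in every chart that contains the point, also on the faces: where [fold_k] disagrees with
    the chart, [(a, b)] is on the boundary of the square and the third coordinate of [hf], the one
    that carries the sign, is 0. *)
Lemma zorich_unf k1 k2 a b z : inQ (a, b) ->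
  zor (unf lam k1 a, unf lam k2 b, z) =
  (nu * exp z * lam * p1 (hf (a, b)), nu * exp z * lam * p2 (hf (a, b)),
   nu * exp z * lam * (sgnZ k1 * sgnZ k2 * p3 (hf (a, b)))).
Proof.
  intros Hab. assert (Hl : 0 < lam) by lra. destruct Hab as [Ha Hb]; cbn [fst snd] in *.
  destruct (fold_unf lam k1 a Hl Ha) as [E1 K1]. destruct (fold_unf lam k2 b Hl Hb) as [E2 K2].
  unfold zor, zorich. proj3.
  rewrite E1, E2. replace (lam * a / lam) with a by (field; lra).
  replace (lam * b / lam) with b by (field; lra).
  f_equal. f_equal. destruct K1 as [K1|K1]; [destruct K2 as [K2|K2]|].
  - unfold p1, p2; cbn [fst snd]. now rewrite K1, K2.
  - assert (H0 : p3 (hf (a, b)) = 0).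
    { apply hf_bd; [now split|]. split; [now split|]. now right. }
    rewrite H0. ring.
  - assert (H0 : p3 (hf (a, b)) = 0).
    { apply hf_bd; [now split|]. split; [now split|]. now left. }
    rewrite H0. ring.
Qed.

Lemma coordinates x : exists k1 k2 a b, inQ (a, b) /\
  p1 x = unf lam k1 a /\ p2 x = unf lam k2 b /\ x = (unf lam k1 a, unf lam k2 b, p3 x) /\
  fold lam (p1 x) = lam * a /\ fold lam (p2 x) = lam * b.
Proof.
  assert (Hl : 0 < lam) by lra.
  destruct (unf_fold lam (p1 x) Hl) as [E1 H1]. destruct (unf_fold lam (p2 x) Hl) as [E2 H2].
  exists (fold_k lam (p1 x)), (fold_k lam (p2 x)), (fold lam (p1 x) / lam), (fold lam (p2 x) / lam).
  repeat split; try assumption.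
  - rewrite <- E1, <- E2. apply R3_eta.
  - field; lra.
  - field; lra.
Qed.

Lemma zorich_norm x : norm3 (zor x) = rad x.
Proof.
  destruct (coordinates x) as (k1 & k2 & a & b & Hab & _ & _ & -> & _).
  rewrite zorich_unf by assumption. destruct (hf_sphere _ Hab) as [S1 S2].
  unfold rad. proj3.
  pose proof (rad_pos (0, 0, p3 x)) as Rp. unfold rad in Rp. proj3 in Rp.
  set (r := nu * exp (p3 x) * lam) in *.
  unfold norm3. proj3.
  transitivity (sqrt (r ^ 2)); [f_equal|apply sqrt_pow2; lra].
  replace ((r * p1 (hf (a, b))) ^ 2 + (r * p2 (hf (a, b))) ^ 2 + (r * (sgnZ k1 * sgnZ k2 * p3 (hf (a, b)))) ^ 2)
    with (r ^ 2 * (p1 (hf (a, b)) ^ 2 + p2 (hf (a, b)) ^ 2 + (sgnZ k1 * sgnZ k1) * (sgnZ k2 * sgnZ k2) * p3 (hf (a, b)) ^ 2)) by ring.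
  rewrite !sgnZ_sq, !Rmult_1_l, S1. ring.
Qed.

Lemma zorich_p3_le x : Rabs (p3 (zor x)) <= rad x.
Proof.
  rewrite <- zorich_norm. pose proof (dist3_p3 (zor x) origin3) as H.
  rewrite <- norm3_dist in H. unfold origin3 in H. proj3 in H.
  now rewrite Rminus_0_r in H.
Qed.

Lemma hf_horizontal a b : inQ (a, b) ->
  p1 (hf (a, b)) ^ 2 + p2 (hf (a, b)) ^ 2 <= L ^ 2 * (a ^ 2 + b ^ 2).
Proof.
  intros Hab. destruct (Hbilip (a, b) (0, 0) Hab inQ_0) as [_ H].
  assert (H2 : dist3 (hf (a, b)) (hf (0, 0)) ^ 2 <= (L * dist2 (a, b) (0, 0)) ^ 2).
  { apply pow_incr. split; [apply dist3_pos|assumption]. }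
  rewrite Rpow_mult_distr, dist3_sq, dist2_sq, hf_0 in H2.
  proj3 in H2. cbn [fst snd] in H2.
  rewrite !Rminus_0_r in H2. pose proof (pow2_ge_0 (p3 (hf (a, b)) - 1)). lra.
Qed.

(** On the sphere the squared distance to the pole is [2 - 2 * w], where [w] is the height, and
    [w >= 0] gives [1 - w <= (1 - w) * (1 + w)], the squared horizontal norm. *)
Lemma hf_horizontal_low a b : inQ (a, b) ->
  a ^ 2 + b ^ 2 <= 2 * L ^ 2 * (p1 (hf (a, b)) ^ 2 + p2 (hf (a, b)) ^ 2) /\
  1 - L ^ 2 * (a ^ 2 + b ^ 2) / 2 <= p3 (hf (a, b)).
Proof.
  intros Hab. destruct (Hbilip (a, b) (0, 0) Hab inQ_0) as [H1 H2].
  pose proof (dist2_pos (a, b) (0, 0)) as P.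
  assert (H1' : dist2 (a, b) (0, 0) ^ 2 <= (L * dist3 (hf (a, b)) (hf (0, 0))) ^ 2).
  { apply pow_incr. split; [assumption|]. rewrite Rmult_comm.
    apply (proj1 (Rle_div_l _ _ L ltac:(lra)) H1). }
  assert (H2' : dist3 (hf (a, b)) (hf (0, 0)) ^ 2 <= (L * dist2 (a, b) (0, 0)) ^ 2).
  { apply pow_incr. split; [apply dist3_pos|assumption]. }
  rewrite Rpow_mult_distr, dist3_sq, dist2_sq, hf_0 in H1', H2'.
  proj3 in H1'. proj3 in H2'. cbn [fst snd] in H1', H2'.
  rewrite !Rminus_0_r in H1', H2'.
  destruct (hf_sphere _ Hab) as [S1 S2].
  set (u := p1 (hf (a, b))) in *. set (v := p2 (hf (a, b))) in *. set (w := p3 (hf (a, b))) in *.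
  assert (E : u ^ 2 + v ^ 2 + (w - 1) ^ 2 = 2 - 2 * w) by nra.
  rewrite E in H1', H2'. split; [|lra].
  assert (w <= 1) by nra.
  assert (E2 : u ^ 2 + v ^ 2 = (1 - w) * (1 + w)) by (replace (u ^ 2 + v ^ 2) with (1 - w ^ 2) by lra; ring).
  rewrite E2. apply Rle_trans with (1 := H1').
  replace (L ^ 2 * (2 - 2 * w)) with (2 * L ^ 2 * ((1 - w) * 1)) by ring.
  apply Rmult_le_compat_l; [nra|]. apply Rmult_le_compat_l; lra.
Qed.

Lemma fold_sq_le x : fold lam (p1 x) ^ 2 + fold lam (p2 x) ^ 2 <= hnorm x ^ 2.
Proof.
  rewrite hnorm_sq. assert (Hl : 0 < lam) by lra.
  pose proof (fold_abs_le lam (p1 x) Hl) as A. pose proof (fold_abs_le lam (p2 x) Hl) as B.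
  rewrite <- (pow2_abs (p1 x)), <- (pow2_abs (p2 x)), <- (pow2_abs (fold lam (p1 x))), <- (pow2_abs (fold lam (p2 x))).
  apply Rplus_le_compat; apply pow_incr; split; try apply Rabs_pos; assumption.
Qed.

Lemma zorich_hnorm_le x : lam * hnorm (zor x) <= L * rad x * hnorm x.
Proof.
  pose proof (rad_pos x) as Rp. pose proof (hnorm_pos x). pose proof (hnorm_pos (zor x)).
  apply pow2_le_inv; [apply Rmult_le_pos; [apply Rmult_le_pos|]; lra|].
  rewrite !Rpow_mult_distr. pose proof (fold_sq_le x) as Hf.
  assert (E : hnorm (zor x) ^ 2 * lam ^ 2 <= rad x ^ 2 * (L ^ 2 * (fold lam (p1 x) ^ 2 + fold lam (p2 x) ^ 2))).
  { rewrite hnorm_sq.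
    destruct (coordinates x) as (k1 & k2 & a & b & Hab & _ & _ & Ex & -> & ->).
    rewrite Ex at 1 2. rewrite zorich_unf by assumption. proj3.
    pose proof (hf_horizontal a b Hab) as Hh. unfold rad in *.
    set (r := nu * exp (p3 x) * lam) in *.
    replace (((r * p1 (hf (a, b))) ^ 2 + (r * p2 (hf (a, b))) ^ 2) * lam ^ 2)
      with (r ^ 2 * lam ^ 2 * (p1 (hf (a, b)) ^ 2 + p2 (hf (a, b)) ^ 2)) by ring.
    replace (r ^ 2 * (L ^ 2 * ((lam * a) ^ 2 + (lam * b) ^ 2)))
      with (r ^ 2 * lam ^ 2 * (L ^ 2 * (a ^ 2 + b ^ 2))) by ring.
    apply Rmult_le_compat_l; [|assumption]. apply Rmult_le_pos; apply pow2_ge_0. }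
  rewrite Rmult_comm. apply Rle_trans with (1 := E).
  replace (L ^ 2 * rad x ^ 2 * hnorm x ^ 2) with (rad x ^ 2 * (L ^ 2 * hnorm x ^ 2)) by ring.
  apply Rmult_le_compat_l; [apply pow2_ge_0|]. apply Rmult_le_compat_l; [apply pow2_ge_0|assumption].
Qed.

(** Within distance [lam / (2 * L)] of the axis the point is in the central beam and its direction
    has height at least [1 - 1 / 8], hence [3 / 4]. The first part is the repulsion from the axis,
    by a factor of at least [rad x / (2 * L * lam)]. *)
Lemma zorich_near_axis x : hnorm x <= lam / (2 * L) ->
  rad x * hnorm x <= 2 * L * lam * hnorm (zor x) /\ 3 / 4 * rad x <= p3 (zor x).
Proof.
  intros Hx. assert (Hl : 0 < lam) by lra. pose proof (rad_pos x) as Rp.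
  pose proof (hnorm_pos x) as Px. pose proof (hnorm_pos (zor x)).
  assert (Hd : 2 * L * hnorm x <= lam).
  { apply Rle_trans with (2 * L * (lam / (2 * L))); [apply Rmult_le_compat_l; lra|right; field; lra]. }
  assert (Hdl : hnorm x < lam) by nra.
  assert (Habs : forall c, c ^ 2 <= hnorm x ^ 2 -> Rabs c < lam).
  { intros c Hc. apply Rle_lt_trans with (2 := Hdl). now apply Rabs_le_of_sq. }
  pose proof (hnorm_sq x) as Hsq.
  assert (A1 : Rabs (p1 x) < lam) by (apply Habs; nra).
  assert (A2 : Rabs (p2 x) < lam) by (apply Habs; nra).
  assert (Q : forall c, Rabs c < lam -> Rabs (c / lam) < 1).
  { intros c Hc. unfold Rdiv. rewrite Rabs_mult, (Rabs_pos_eq (/ lam)) by (left; now apply Rinv_0_lt_compat).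
    apply (proj2 (Rlt_div_l (Rabs c) 1 lam Hl)). lra. }
  assert (Hab : inQ (p1 x / lam, p2 x / lam)) by (split; cbn [fst snd]; left; auto).
  assert (Ex : x = (unf lam 0 (p1 x / lam), unf lam 0 (p2 x / lam), p3 x)).
  { rewrite (R3_eta x) at 1. unfold unf, sgnZ; simpl. f_equal. f_equal; field; lra. }
  destruct (hf_horizontal_low _ _ Hab) as [H1 H2].
  set (a := p1 x / lam) in *. set (b := p2 x / lam) in *.
  assert (Eab : a ^ 2 + b ^ 2 = hnorm x ^ 2 / lam ^ 2) by (rewrite Hsq; unfold a, b; field; lra).
  assert (EZ : zor x = (rad x * p1 (hf (a, b)), rad x * p2 (hf (a, b)), rad x * p3 (hf (a, b)))).
  { rewrite Ex at 1. rewrite zorich_unf by assumption. unfold rad, sgnZ; simpl. repeat f_equal; ring. }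
  split.
  - apply pow2_le_inv; [repeat apply Rmult_le_pos; lra|].
    rewrite Rpow_mult_distr, (Rpow_mult_distr (2 * L * lam)), (hnorm_sq (zor x)), EZ.
    proj3.
    replace (hnorm x ^ 2) with (lam ^ 2 * (a ^ 2 + b ^ 2)) by (rewrite Eab; field; lra).
    set (S := p1 (hf (a, b)) ^ 2 + p2 (hf (a, b)) ^ 2) in *.
    replace ((rad x * p1 (hf (a, b))) ^ 2 + (rad x * p2 (hf (a, b))) ^ 2) with (rad x ^ 2 * S) by (unfold S; ring).
    assert (0 <= S) by (unfold S; nra).
    apply Rle_trans with (rad x ^ 2 * (lam ^ 2 * (2 * L ^ 2 * S))).
    + apply Rmult_le_compat_l; [apply pow2_ge_0|]. apply Rmult_le_compat_l; [apply pow2_ge_0|assumption].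
    + assert (0 <= rad x ^ 2 * (lam ^ 2 * (L ^ 2 * S))).
      { repeat (apply Rmult_le_pos; [apply pow2_ge_0|]). assumption. }
      replace ((2 * L * lam) ^ 2 * (rad x ^ 2 * S)) with (4 * (rad x ^ 2 * (lam ^ 2 * (L ^ 2 * S)))) by ring.
      lra.
  - rewrite EZ. proj3. rewrite Rmult_comm.
    apply Rmult_le_compat_l; [lra|]. apply Rle_trans with (2 := H2).
    rewrite Eab. assert (E4 : (2 * L * hnorm x) ^ 2 <= lam ^ 2) by (apply pow_incr; split; [|assumption]; nra).
    assert (L ^ 2 * (hnorm x ^ 2 / lam ^ 2) <= 1 / 4); [|lra].
    replace (L ^ 2 * (hnorm x ^ 2 / lam ^ 2)) with ((L ^ 2 * hnorm x ^ 2) / lam ^ 2) by (field; lra).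
    apply (proj2 (Rle_div_l (L ^ 2 * hnorm x ^ 2) (1 / 4) (lam ^ 2) (pow_lt lam 2 Hl))).
    replace ((2 * L * hnorm x) ^ 2) with (4 * (L ^ 2 * hnorm x ^ 2)) in E4 by ring. lra.
Qed.

(** * Logarithmic polar coordinates and the inverse branches *)

Definition dirup (y : R3) : R3 := (p1 y / norm3 y, p2 y / norm3 y, Rabs (p3 y) / norm3 y).

Lemma dirup_sphere y : 0 < norm3 y -> norm3 (dirup y) = 1 /\ 0 <= p3 (dirup y).
Proof.
  intros Hy. split.
  - unfold norm3 at 1. rewrite <- sqrt_1. f_equal. unfold dirup. proj3.
    unfold Rdiv. rewrite !Rpow_mult_distr, pow2_abs, <- !Rmult_plus_distr_r, <- norm3_sq. field. lra.
  - unfold dirup. proj3. apply Rle_mult_inv_pos; [apply Rabs_pos|assumption].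
Qed.

(** For plain directions this is an identity, the law of cosines. Reflecting both directions into
    the upper half-space can only bring them closer, since [p3 y * p3 y' <= Rabs (p3 y) * Rabs (p3
    y')]. *)
Lemma dirup_dist y y' : 0 < norm3 y -> 0 < norm3 y' ->
  (norm3 y - norm3 y') ^ 2 + norm3 y * norm3 y' * dist3 (dirup y) (dirup y') ^ 2 <= dist3 y y' ^ 2.
Proof.
  intros Hy Hy'. rewrite !dist3_sq. unfold dirup.
  pose proof (norm3_sq y) as E. pose proof (norm3_sq y') as E'.
  set (r := norm3 y) in *. set (r' := norm3 y') in *.
  proj3.
  pose proof (pow2_abs (p3 y)) as Ea. pose proof (pow2_abs (p3 y')) as Ea'.
  assert (Hm : p3 y * p3 y' <= Rabs (p3 y) * Rabs (p3 y')) by (rewrite <- Rabs_mult; apply Rle_abs).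
  set (c := Rabs (p3 y)) in *. set (c' := Rabs (p3 y')) in *.
  assert (EE : r * r' * ((p1 y / r - p1 y' / r') ^ 2 + (p2 y / r - p2 y' / r') ^ 2 + (c / r - c' / r') ^ 2)
    = (p1 y ^ 2 + p2 y ^ 2 + c ^ 2) * (r' / r) + (p1 y' ^ 2 + p2 y' ^ 2 + c' ^ 2) * (r / r')
      - 2 * (p1 y * p1 y' + p2 y * p2 y' + c * c')) by (field; lra).
  rewrite EE, Ea, Ea', <- E, <- E'.
  replace (r ^ 2 * (r' / r)) with (r * r') by (field; lra).
  replace (r' ^ 2 * (r / r')) with (r * r') by (field; lra).
  nra.
Qed.


(** The normalised horizontal position, in the square, of all preimages of [y]. *)
Definition theta (y : R3) : R2 := Phi (dirup y).

Lemma theta_spec y : 0 < norm3 y -> inQ (theta y) /\ hf (theta y) = dirup y.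
Proof. intros Hy. destruct (dirup_sphere y Hy). now apply HPhi. Qed.

Lemma theta_dist y y' : 0 < norm3 y -> 0 < norm3 y' ->
  dist2 (theta y) (theta y') <= L * dist3 (dirup y) (dirup y').
Proof.
  intros Hy Hy'. destruct (theta_spec y Hy) as [Q1 E1]. destruct (theta_spec y' Hy') as [Q2 E2].
  destruct (Hbilip _ _ Q1 Q2) as [H _]. rewrite E1, E2 in H.
  rewrite Rmult_comm. apply (proj1 (Rle_div_l _ _ L ltac:(lra)) H).
Qed.

Lemma dirup_zorich k1 k2 a b z : inQ (a, b) ->
  dirup (zor (unf lam k1 a, unf lam k2 b, z)) = hf (a, b).
Proof.
  intros Hab. unfold dirup. rewrite zorich_norm, zorich_unf by assumption.
  pose proof (rad_pos (unf lam k1 a, unf lam k2 b, z)) as Rp.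
  unfold rad in *. proj3 in Rp. proj3.
  proj3. 
  destruct (hf_sphere _ Hab) as [_ S2].
  set (r := nu * exp z * lam) in *.
  rewrite Rabs_mult, (Rabs_pos_eq r), Rmult_assoc, !Rabs_sgnZ, (Rabs_pos_eq (p3 _)) by lra.
  rewrite (R3_eta (hf (a, b))) at 4. f_equal; [f_equal|]; field; lra.
Qed.

Lemma theta_zorich k1 k2 a b z : inQ (a, b) -> theta (zor (unf lam k1 a, unf lam k2 b, z)) = (a, b).
Proof.
  intros Hab. pose proof (rad_pos (unf lam k1 a, unf lam k2 b, z)) as Rp. rewrite <- zorich_norm in Rp.
  destruct (theta_spec _ Rp) as [Q E]. rewrite dirup_zorich in E by assumption.
  now apply hf_inj.
Qed.

(** The inverse branch into the beam [(k1, k2)]; it exists when the parity of the beam agrees with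
    the sign of [p3 y]. *)
Lemma zorich_preimage y k1 k2 : 0 < norm3 y -> sgnZ k1 * sgnZ k2 * Rabs (p3 y) = p3 y ->
  zor (unf lam k1 (fst (theta y)), unf lam k2 (snd (theta y)), ln (norm3 y / (nu * lam))) = y.
Proof.
  intros Hy Hs. destruct (theta_spec y Hy) as [Q E].
  rewrite zorich_unf by now rewrite <- surjective_pairing.
  rewrite <- surjective_pairing, E, exp_ln by (apply Rdiv_lt_0_compat; nra).
  unfold dirup. proj3.
  rewrite (R3_eta y) at 10. f_equal; [f_equal|]; try (field; lra).
  replace (nu * (norm3 y / (nu * lam)) * lam * (sgnZ k1 * sgnZ k2 * (Rabs (p3 y) / norm3 y)))
    with (sgnZ k1 * sgnZ k2 * Rabs (p3 y)) by (field; lra). exact Hs.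
Qed.

Lemma ln_dist r a b : 0 < r -> r <= a -> r <= b -> (ln a - ln b) ^ 2 <= ((a - b) / r) ^ 2.
Proof.
  intros Hr Ha Hb.
  assert (W : forall u v, r <= u -> u <= v -> 0 <= ln v - ln u <= (v - u) / r).
  { intros u v Hu Huv. split.
    - destruct Huv as [Huv| ->]; [|lra]. assert (ln u < ln v) by (apply ln_increasing; lra). lra.
    - rewrite <- ln_div by lra. apply Rle_trans with (v / u - 1).
      + pose proof (exp_ineq1_le (ln (v / u))) as H. rewrite exp_ln in H by (apply Rdiv_lt_0_compat; lra). lra.
      + replace (v / u - 1) with ((v - u) / u) by (field; lra).
        apply Rmult_le_compat_l; [lra|]. apply Rinv_le_contravar; lra. }
  destruct (Rle_lt_dec a b) as [H|H].
  - destruct (W a b Ha H). replace ((ln a - ln b) ^ 2) with ((ln b - ln a) ^ 2) by ring.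
    replace (((a - b) / r) ^ 2) with (((b - a) / r) ^ 2) by (field; lra). now apply pow_incr.
  - destruct (W b a Hb ltac:(lra)). now apply pow_incr.
Qed.

(** Division by [L] makes the angular part 1-Lipschitz in the direction, and outside the ball of
    radius [r] both direction and logarithm fit under the same constant [1 / r]. Bounding the sum of
    squares, and not each coordinate, is what keeps the volume estimate sharp. *)
Lemma log_polar_lipschitz r y y' : 0 < r -> r <= norm3 y -> r <= norm3 y' ->
  (fst (theta y) / L - fst (theta y') / L) ^ 2 + (snd (theta y) / L - snd (theta y') / L) ^ 2 +
  (ln (norm3 y) - ln (norm3 y')) ^ 2 <= (dist3 y y' / r) ^ 2.
Proof.
  intros Hr Hy Hy'. pose proof (ln_dist r _ _ Hr Hy Hy') as Hln.
  pose proof (theta_dist y y' ltac:(lra) ltac:(lra)) as Ht.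
  assert (Ht2 : dist2 (theta y) (theta y') ^ 2 <= (L * dist3 (dirup y) (dirup y')) ^ 2)
    by (apply pow_incr; split; [apply dist2_pos|assumption]).
  rewrite Rpow_mult_distr, dist2_sq in Ht2.
  pose proof (dirup_dist y y' ltac:(lra) ltac:(lra)) as Hd.
  set (D := dist3 (dirup y) (dirup y') ^ 2) in *. assert (0 <= D) by apply pow2_ge_0.
  assert (HD : (fst (theta y) / L - fst (theta y') / L) ^ 2 + (snd (theta y) / L - snd (theta y') / L) ^ 2 <= D).
  { replace ((fst (theta y) / L - fst (theta y') / L) ^ 2 + (snd (theta y) / L - snd (theta y') / L) ^ 2)
      with (((fst (theta y) - fst (theta y')) ^ 2 + (snd (theta y) - snd (theta y')) ^ 2) / L ^ 2) by (field; lra).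
    apply (proj2 (Rle_div_l _ D (L ^ 2) (pow_lt L 2 ltac:(lra)))). lra. }
  assert (HD2 : r ^ 2 * D <= norm3 y * norm3 y' * D) by (apply Rmult_le_compat_r; nra).
  apply Rle_trans with (D + ((norm3 y - norm3 y') / r) ^ 2); [lra|].
  replace (D + ((norm3 y - norm3 y') / r) ^ 2) with ((r ^ 2 * D + (norm3 y - norm3 y') ^ 2) / r ^ 2) by (field; lra).
  replace ((dist3 y y' / r) ^ 2) with (dist3 y y' ^ 2 / r ^ 2) by (field; lra).
  apply Rmult_le_compat_r; [|lra]. left. apply Rinv_0_lt_compat. now apply pow_lt.
Qed.


(** The constant [4 / 3] is the inverse of the [3 / 4] in [zorich_near_axis]: near the axis one step
    raises the height from [p3 x] to at least [p3 x + 1]. *)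
Lemma rad_ge x : 4 / 3 * (1 + p3 x) <= rad x.
Proof.
  unfold rad. pose proof (exp_ineq1_le (p3 x)). pose proof (exp_pos (p3 x)).
  replace (nu * exp (p3 x) * lam) with (nu * lam * exp (p3 x)) by ring.
  apply Rle_trans with (4 / 3 * exp (p3 x)); [lra|]. apply Rmult_le_compat_r; lra.
Qed.

(** An orbit that violates this is eventually near the axis, because points below [- T] are mapped
    close to 0. Near the axis it climbs without bound, so the repulsion factor finally exceeds 2 and
    the horizontal norm, which is never 0, doubles until it passes the threshold. *)
Lemma leaves_axis : exists T, 0 < T /\ forall x, (forall n, 0 < hnorm (Nat.iter n zor x)) ->
  forall N, exists n, (N <= n)%nat /\ lam / (2 * L) < hnorm (Nat.iter n zor x) /\ - T < p3 (Nat.iter n zor x).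
Proof.
  assert (Hl : 0 < lam) by lra.
  set (d := lam / (2 * L)).
  assert (Hd : 0 < d) by (apply Rdiv_lt_0_compat; lra).
  set (T := Rmax (d + 1) (- ln (d / (nu * lam)))).
  assert (T1 : d + 1 <= T) by apply Rmax_l.
  assert (Hrad : forall x, p3 x <= - T -> rad x <= d).
  { intros x Hx. unfold rad. replace (nu * exp (p3 x) * lam) with (nu * lam * exp (p3 x)) by ring.
    apply Rle_trans with (nu * lam * exp (ln (d / (nu * lam)))).
    - apply Rmult_le_compat_l; [lra|].
      assert (H : p3 x <= ln (d / (nu * lam))).
      { assert (- ln (d / (nu * lam)) <= T) by apply Rmax_r. lra. }
      destruct H as [H| ->]; [left; now apply exp_increasing|lra].
    - rewrite exp_ln by (apply Rdiv_lt_0_compat; lra). right. field. lra. }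
  assert (Hhr : forall x, hnorm (zor x) <= rad x).
  { intros x. rewrite <- zorich_norm. apply pow2_le_inv; [apply norm3_pos|].
    rewrite hnorm_sq, norm3_sq. nra. }
  exists T. split; [lra|]. intros x Hx N. apply NNPP. intros Hno.
  assert (Hst : forall n, (N <= n)%nat -> hnorm (Nat.iter n zor x) <= d \/ p3 (Nat.iter n zor x) <= - T).
  { intros n Hn. destruct (Rle_lt_dec (hnorm (Nat.iter n zor x)) d) as [H|H]; [now left|].
    right. apply Rnot_lt_le. intros H'. apply Hno. now exists n. }
  assert (Hnear : forall n, (N <= n)%nat -> hnorm (Nat.iter n zor x) <= d ->
     hnorm (Nat.iter (S n) zor x) <= d /\ p3 (Nat.iter n zor x) + 1 <= p3 (Nat.iter (S n) zor x) /\
     0 <= p3 (Nat.iter (S n) zor x)).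
  { intros n Hn H. destruct (zorich_near_axis _ H) as [_ H3].
    pose proof (rad_ge (Nat.iter n zor x)). pose proof (rad_pos (Nat.iter n zor x)).
    change (Nat.iter (S n) zor x) with (zor (Nat.iter n zor x)).
    split; [|lra]. destruct (Hst (S n) ltac:(lia)) as [H'|H']; [assumption|].
    change (Nat.iter (S n) zor x) with (zor (Nat.iter n zor x)) in H'. lra. }
  assert (Hstart : exists n, (N <= n)%nat /\ hnorm (Nat.iter n zor x) <= d).
  { destruct (Hst N ltac:(lia)) as [H|H]; [now exists N|].
    exists (S N). split; [lia|]. apply Rle_trans with (1 := Hhr _). now apply Hrad. }
  destruct Hstart as (m & Hm & Hm').
  assert (Hall : forall j, hnorm (Nat.iter (j + S m) zor x) <= d /\ INR j <= p3 (Nat.iter (j + S m) zor x)).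
  { induction j as [|j IH].
    - destruct (Hnear m Hm Hm') as (H1 & H2 & H3). simpl. now split.
    - destruct (Hnear (j + S m)%nat ltac:(lia) (proj1 IH)) as (H1 & H2 & H3).
      rewrite S_INR. change (S j + S m)%nat with (S (j + S m)). split; [assumption|lra]. }
  (* At height at least [j] one has [rad >= j], so the repulsion factor is at least
     [j / (2 * L * lam)]; written as twice a quotient that exceeds 1 for large [j]. *)
  assert (Hgrow : forall j, 2 * hnorm (Nat.iter (j + S m) zor x) * (INR j / (4 * L * lam)) <= hnorm (Nat.iter (S (j + S m)) zor x)).
  { intros j. destruct (Hall j) as [H1 H2].
    destruct (zorich_near_axis _ H1) as [H3 _]. pose proof (rad_ge (Nat.iter (j + S m) zor x)) as H4.
    change (Nat.iter (S (j + S m)) zor x) with (zor (Nat.iter (j + S m) zor x)).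
    set (y := Nat.iter (j + S m) zor x) in *. pose proof (hnorm_pos y). pose proof (pos_INR j).
    apply Rmult_le_reg_l with (2 * L * lam); [nra|].
    apply Rle_trans with (INR j * hnorm y).
    - right. field. lra.
    - apply Rle_trans with (2 := H3). apply Rmult_le_compat_r; lra. }
  destruct (INR_large (4 * L * lam)) as (J & HJ & HJ').
  assert (Hpow : forall j, 2 ^ j * hnorm (Nat.iter (J + S m) zor x) <= hnorm (Nat.iter ((j + J) + S m) zor x)).
  { induction j as [|j IH]; [simpl; lra|].
    change (2 ^ S j) with (2 * 2 ^ j). change ((S j + J) + S m)%nat with (S ((j + J) + S m)).
    apply Rle_trans with (2 := Hgrow (j + J)%nat).
    set (w := hnorm (Nat.iter ((j + J) + S m) zor x)) in *.
    assert (0 <= w) by apply hnorm_pos.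
    assert (1 <= INR (j + J) / (4 * L * lam)).
    { apply (proj1 (Rle_div_r 1 (INR (j + J)) (4 * L * lam) ltac:(nra))).
      rewrite plus_INR. pose proof (pos_INR j). lra. }
    nra. }
  pose proof (Hx (J + S m)%nat) as H0. set (w := hnorm (Nat.iter (J + S m) zor x)) in *.
  destruct (Pow_x_infinity 2 ltac:(rewrite Rabs_pos_eq; lra) (d / w + 1)) as (j & Hj).
  specialize (Hj j ltac:(lia)). rewrite Rabs_pos_eq in Hj by (apply pow_le; lra).
  pose proof (Hpow j) as H1. destruct (Hall (j + J)%nat) as [H2 _].
  assert (d / w * w = d) by (field; lra). nra.
Qed.

(** * Pull-back of content under the Zorich map *)

Definition inbeam (k1 k2 : Z) (x : R3) : Prop :=
  exists a b, inQ (a, b) /\ p1 x = unf lam k1 a /\ p2 x = unf lam k2 b.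

Lemma rad_low b x : - b <= p3 x -> nu * exp (- b) * lam <= rad x.
Proof.
  intros H. unfold rad. apply Rmult_le_compat_r; [lra|]. apply Rmult_le_compat_l; [lra|].
  destruct H as [H|<-]; [left; now apply exp_increasing|lra].
Qed.

Lemma ln_rad x : p3 x = ln (norm3 (zor x)) - ln (nu * lam).
Proof.
  rewrite zorich_norm by assumption. unfold rad.
  replace (nu * exp (p3 x) * lam) with (nu * lam * exp (p3 x)) by ring.
  rewrite ln_mult, ln_exp by (try apply exp_pos; nra). ring.
Qed.

(* In the coordinates [(theta / L, ln |.|)] the inverse of the Zorich map is
   [1/r]-Lipschitz, and those coordinates are turned into the original ones by
   a linear map of determinant [(L lam)^2]. *)
Lemma pullback_zorich (W : R3 -> Prop) (b t0 : R) : 1 < t0 -> (forall x, W x -> - b <= p3 x) ->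
  (exists k1 k2, forall x, W x -> 0 <= p3 (zor x) -> inbeam k1 k2 x) ->
  (exists k1 k2, forall x, W x -> p3 (zor x) <= 0 -> inbeam k1 k2 x) ->
  pullback zor W (fun x => rad x ^ 3) (t0 * (L * lam) ^ 2).
Proof.
  intros Ht0 Hb Hup Hdn. destruct (slack_exists t0 Ht0) as (t & Ht & Hs & _).
  set (rho := nu * exp (- b) * lam).
  assert (Hrho : 0 < rho).
  { unfold rho. pose proof (exp_pos (- b)). apply Rmult_lt_0_compat; [|lra]. nra. }
  assert (HLl : 1 <= L * lam) by nra.
  (* Points of [B] are within [3 * d] of each other and ball centres within [d] of [B]; since
     [4 * d <= t * n0], all the norms differ from [n0] by at most the fraction [t]. *)
  set (d := t * rho / 4). assert (Hd : 0 < d) by (unfold d; nra).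
  exists d. split; [assumption|]. intros B VB SB OB.
  assert (Hk : exists k1 k2, forall x, W x -> inb B (zor x) -> inbeam k1 k2 x).
  (* A box on one side of the plane of reflection sees one beam, that is, a single inverse
     branch. *)
  { destruct OB as [O|O].
    - destruct Hup as (k1 & k2 & H). exists k1, k2. intros x Wx (_ & _ & I). apply H; [assumption|lra].
    - destruct Hdn as (k1 & k2 & H). exists k1, k2. intros x Wx (_ & _ & I). apply H; [assumption|lra]. }
  destruct Hk as (k1 & k2 & Hk). pose proof (vol_pos B VB) as Hvol.
  destruct (classic (exists x0, W x0 /\ inb B (zor x0))) as [(x0 & W0 & I0)|Hno].
  2:{ exists 1. split; [lra|]. split.
      - apply covb_empty; [lra|]. intros x Hx. apply Hno. now exists x.
      - intros x Wx Ix. exfalso. apply Hno. now exists x. }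
  set (n0 := norm3 (zor x0)).
  assert (Hn0 : rho <= n0).
  { unfold n0, zor. rewrite zorich_norm by assumption. apply rad_low. auto. }
  assert (Hd4 : 4 * d <= t * n0) by (unfold d; nra).
  set (r := (1 - t) * n0). assert (Hr : 0 < r) by (unfold r; nra).
  assert (Hl : 0 < / r) by now apply Rinv_0_lt_compat.
  assert (HB3 : forall y, inb B y -> n0 - 3 * d <= norm3 y <= n0 + 3 * d).
  { intros y Hy. pose proof (small_dist d B y _ SB Hy I0) as D.
    pose proof (norm3_tri y (zor x0)). pose proof (norm3_tri (zor x0) y).
    rewrite (dist3_sym (zor x0) y) in *. unfold n0. lra. }
  set (Psi := fun y => (fst (theta y) / L, snd (theta y) / L, ln (norm3 y)) : R3).
  assert (Hlip : covb (fun y => exists x, inb B x /\ y = Psi x) ((/ r) ^ 3 * vol B + t * ((/ r) ^ 3 * vol B))).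
  { apply lipschitz_box with (d := d); try assumption.
    - intros y c Hy Hc. destruct (HB3 y Hy) as [Hy1 Hy2].
      pose proof (norm3_tri y c) as Htri.
      apply dist3_le; [apply Rmult_le_pos; [lra|apply dist3_pos]|].
      unfold Psi. proj3. replace (/ r * dist3 y c) with (dist3 y c / r) by (unfold Rdiv; ring).
      eapply log_polar_lipschitz; try eassumption; unfold r; lra.
    - apply Rmult_lt_0_compat; [lra|]. apply Rmult_lt_0_compat; [now apply pow_lt|assumption]. }
  exists ((L * lam) ^ 2 * ((1 + t) * (/ r) ^ 3)).
  assert (Hr3 : 0 < (/ r) ^ 3) by now apply pow_lt.
  assert (HLl2 : 0 < (L * lam) ^ 2) by (apply pow_lt; lra).
  split; [|split].
  - apply Rmult_lt_0_compat; [assumption|]. apply Rmult_lt_0_compat; lra.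
  (* The chart in reverse: [L] undoes the division, [lam] rescales the square to the beam, and the
     sign is that of the reflection. *)
  - set (s1 := sgnZ k1 * (L * lam)). set (s2 := sgnZ k2 * (L * lam)).
    assert (A1 : Rabs s1 = L * lam) by (unfold s1; rewrite Rabs_sgnZ, Rabs_pos_eq; lra).
    assert (A2 : Rabs s2 = L * lam) by (unfold s2; rewrite Rabs_sgnZ, Rabs_pos_eq; lra).
    replace ((L * lam) ^ 2 * ((1 + t) * (/ r) ^ 3) * vol B)
      with (Rabs s1 * Rabs s2 * Rabs 1 * ((/ r) ^ 3 * vol B + t * ((/ r) ^ 3 * vol B)))
      by (rewrite A1, A2, Rabs_R1; ring).
    assert (N : forall s, Rabs s = L * lam -> s <> 0) by (intros s E ->; rewrite Rabs_R0 in E; lra).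
    apply covb_aff with (c := (2 * IZR k1 * lam, 2 * IZR k2 * lam, - ln (nu * lam)))
      (A := fun y => exists x, inb B x /\ y = Psi x);
      [now apply N|now apply N|lra| |exact Hlip].
    intros x [Wx Ix]. exists (Psi (zor x)). split; [now exists (zor x)|].
    destruct (Hk x Wx Ix) as (a & c & Hac & E1 & E2).
    assert (Ex : x = (unf lam k1 a, unf lam k2 c, p3 x)) by (rewrite <- E1, <- E2; apply R3_eta).
    assert (Et : theta (zor x) = (a, c)).
    { rewrite Ex. eapply theta_zorich; eassumption. }
    unfold aff, Psi. proj3. rewrite Et. cbn [fst snd].
    replace (1 * ln (norm3 (zor x)) + - ln (nu * lam)) with (p3 x) by (rewrite (ln_rad x); ring).
    rewrite Ex at 1. unfold unf, s1, s2. f_equal. f_equal; field; lra.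
  - intros x Wx Ix. destruct (HB3 _ Ix) as [_ H].
    rewrite zorich_norm in H by assumption. fold rad in H.
    assert (Hx3 : rad x ^ 3 <= ((1 + t) * n0) ^ 3).
    { apply pow_incr. split; [left; now apply rad_pos|lra]. }
    replace ((L * lam) ^ 2 * ((1 + t) * (/ r) ^ 3) * rad x ^ 3)
      with ((L * lam) ^ 2 * ((1 + t) * ((/ r) ^ 3 * rad x ^ 3))) by ring.
    rewrite (Rmult_comm t0). apply Rmult_le_compat_l; [lra|].
    assert (H1 : (/ r) ^ 3 * rad x ^ 3 <= (1 + t) ^ 3 / (1 - t) ^ 3).
    { apply Rle_trans with ((/ r) ^ 3 * ((1 + t) * n0) ^ 3); [apply Rmult_le_compat_l; lra|].
      right. unfold r. field. lra. }
    apply Rle_trans with ((1 + t) * ((1 + t) ^ 3 / (1 - t) ^ 3)); [apply Rmult_le_compat_l; lra|].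
    replace ((1 + t) * ((1 + t) ^ 3 / (1 - t) ^ 3)) with ((1 + t) ^ 4 / (1 - t) ^ 3)
      by (field; lra).
    apply (proj2 (Rle_div_l _ t0 ((1 - t) ^ 3) (pow_lt (1 - t) 3 ltac:(lra)))). lra.
Qed.

(* The plane [x2 = eps * x1] with arclength coordinate [u]; the middle
   coordinate is a dummy that turns area in the plane into volume. *)
Definition emb (eps : R) (x : R3) : R3 := (p1 x / sqrt 2, eps * (p1 x / sqrt 2), p3 x).

Definition planar (eps : R) (x : R3) : R3 :=
  (sqrt 2 * p1 (zor (emb eps x)), p2 x, p3 (zor (emb eps x))).

Lemma sqrt2_pos : 0 < sqrt 2.
Proof. apply sqrt_lt_R0; lra. Qed.

Lemma sqrt2_sq : sqrt 2 * sqrt 2 = 2.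
Proof. apply sqrt_sqrt; lra. Qed.

Lemma div_sqrt2_sq a : (a / sqrt 2) ^ 2 = a ^ 2 / 2.
Proof.
  pose proof sqrt2_pos. replace (a ^ 2 / 2) with (a ^ 2 / (sqrt 2 * sqrt 2)) by now rewrite sqrt2_sq.
  field. lra.
Qed.

Lemma hf_diag eps a : eps = 1 \/ eps = -1 -> -1 <= a <= 1 -> p2 (hf (a, eps * a)) = eps * p1 (hf (a, eps * a)).
Proof.
  intros [-> | ->] Ha; destruct (Hdiag a Ha) as [D1 D2].
  - rewrite !Rmult_1_l. now symmetry.
  - replace (-1 * a) with (- a) by ring. rewrite D2. ring.
Qed.

Lemma emb_coordinates eps x : eps = 1 \/ eps = -1 -> exists k k' a, inQ (a, eps * a) /\
  p1 x / sqrt 2 = unf lam k a /\ eps * (p1 x / sqrt 2) = unf lam k' (eps * a) /\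
  fold_k lam (p1 x / sqrt 2) = k.
Proof.
  intros He. assert (Hl : 0 < lam) by lra. destruct (unf_fold lam (p1 x / sqrt 2) Hl) as [E H].
  set (k := fold_k lam (p1 x / sqrt 2)) in *. set (a := fold lam (p1 x / sqrt 2) / lam) in *.
  destruct He as [-> | ->].
  - exists k, k, a. rewrite !Rmult_1_l. repeat split; assumption.
  - exists k, (- k)%Z, a. repeat split; try assumption.
    + cbn [snd]. replace (-1 * a) with (- a) by ring. now rewrite Rabs_Ropp.
    + rewrite E. unfold unf. rewrite sgnZ_opp, opp_IZR. ring.
Qed.

(** By the symmetry of [hf] on the diagonals the plane is mapped into itself, so [planar] is the
    restriction of the Zorich map in the new coordinates. *)
Lemma emb_planar eps x : eps = 1 \/ eps = -1 -> emb eps (planar eps x) = zor (emb eps x).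
Proof.
  intros He. destruct (emb_coordinates eps x He) as (k & k' & a & Q & E1 & E2 & _).
  unfold emb at 1, planar. proj3. pose proof sqrt2_pos.
  replace (sqrt 2 * p1 (zor (emb eps x)) / sqrt 2) with (p1 (zor (emb eps x))) by (field; lra).
  rewrite (R3_eta (zor (emb eps x))) at 4. f_equal. f_equal.
  unfold emb. rewrite E1 at 1 3. rewrite E2 at 1 2. rewrite zorich_unf by assumption.
  proj3. rewrite (hf_diag eps a) by (assumption || (destruct Q as [Q _]; now apply Rabs_le_between)). ring.
Qed.

Lemma emb_dist eps x y : eps = 1 \/ eps = -1 ->
  dist3 (emb eps x) (emb eps y) ^ 2 = (p1 x - p1 y) ^ 2 + (p3 x - p3 y) ^ 2.
Proof.
  intros He. rewrite dist3_sq. unfold emb. proj3. pose proof sqrt2_pos.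
  assert (E : (p1 x / sqrt 2 - p1 y / sqrt 2) ^ 2 = (p1 x - p1 y) ^ 2 / 2).
  { rewrite <- div_sqrt2_sq. field. lra. }
  replace (eps * (p1 x / sqrt 2) - eps * (p1 y / sqrt 2)) with (eps * (p1 x / sqrt 2 - p1 y / sqrt 2)) by ring.
  rewrite Rpow_mult_distr, E. replace (eps ^ 2) with 1 by (destruct He as [-> | ->]; ring). field.
Qed.

Lemma emb_dist_le eps x y : eps = 1 \/ eps = -1 -> dist3 (emb eps x) (emb eps y) <= dist3 x y.
Proof.
  intros He. apply pow2_le_inv; [apply dist3_pos|]. rewrite emb_dist, dist3_sq by assumption.
  pose proof (pow2_ge_0 (p2 x - p2 y)). lra.
Qed.

(** Along a diagonal plane both beam parities change together, so the image stays in the closed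
    upper half-space and two neighbouring intervals can have the same image. Their contributions are
    added, which is the folding factor 2. *)
Lemma pullback_planar (W : R3 -> Prop) (b t0 eps : R) (k0 : Z) :
  1 < t0 -> eps = 1 \/ eps = -1 -> (forall x, W x -> - b <= p3 x) ->
  (forall x, W x -> exists a, inQ (a, eps * a) /\
     (p1 x / sqrt 2 = unf lam k0 a \/ p1 x / sqrt 2 = unf lam (k0 + 1) a)) ->
  pullback (planar eps) W (fun x => rad x ^ 2) (t0 * (2 * (L * lam))).
Proof.
  intros Ht0 He Hb Hk. destruct (slack_exists t0 Ht0) as (t & Ht & _ & Hs).
  set (rho := nu * exp (- b) * lam).
  assert (Hrho : 0 < rho).
  { unfold rho. pose proof (exp_pos (- b)). apply Rmult_lt_0_compat; [|lra]. nra. }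
  assert (HLl : 1 <= L * lam) by nra. pose proof sqrt2_pos as Hq2.
  set (d := t * rho / 4). assert (Hd : 0 < d) by (unfold d; nra).
  exists d. split; [assumption|]. intros B VB SB _. pose proof (vol_pos B VB) as Hvol.
  destruct (classic (exists x0, W x0 /\ inb B (planar eps x0))) as [(x0 & W0 & I0)|Hno].
  2:{ exists 1. split; [lra|]. split.
      - apply covb_empty; [lra|]. intros x Hx. apply Hno. now exists x.
      - intros x Wx Ix. exfalso. apply Hno. now exists x. }
  set (N := fun y => norm3 (emb eps y)).
  assert (HN : forall x, N (planar eps x) = rad x).
  { intros x. unfold N. rewrite emb_planar by assumption. 
    rewrite zorich_norm by assumption. reflexivity. }
  set (n0 := N (planar eps x0)).
  assert (Hn0 : rho <= n0) by (unfold n0; rewrite HN; apply rad_low; auto).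
  assert (Hd4 : 4 * d <= t * n0) by (unfold d; nra).
  set (r := (1 - t) * n0). assert (Hr : 0 < r) by (unfold r; nra).
  assert (Hl : 0 < / r) by now apply Rinv_0_lt_compat.
  assert (HNtri : forall y y', N y <= N y' + dist3 y y').
  { intros y y'. unfold N. pose proof (norm3_tri (emb eps y) (emb eps y')).
    pose proof (emb_dist_le eps y y' He). lra. }
  assert (HB3 : forall y, inb B y -> n0 - 3 * d <= N y <= n0 + 3 * d).
  { intros y Hy. pose proof (small_dist d B y _ SB Hy I0) as D.
    pose proof (HNtri y (planar eps x0)). pose proof (HNtri (planar eps x0) y).
    rewrite (dist3_sym (planar eps x0) y) in *. unfold n0. lra. }
  (* The angular part is projected to the unit vector along the diagonal. The dummy coordinate is
     scaled by [/ r] to keep [Psi] Lipschitz with constant [/ r]; the linear map below restores it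
     with a factor [r], leaving the planar power [(/ r) ^ 2]. *)
  set (Psi := fun y => ((fst (theta (emb eps y)) + eps * snd (theta (emb eps y))) / (sqrt 2 * L),
    / r * p2 y, ln (N y)) : R3).
  assert (Hlip : covb (fun y => exists x, inb B x /\ y = Psi x) ((/ r) ^ 3 * vol B + t * ((/ r) ^ 3 * vol B))).
  { apply lipschitz_box with (d := d); try assumption.
    - intros y c Hy Hc. destruct (HB3 y Hy) as [Hy1 Hy2].
      pose proof (HNtri y c) as Htri.
      apply dist3_le; [apply Rmult_le_pos; [lra|apply dist3_pos]|].
      assert (Hpol : (fst (theta (emb eps y)) / L - fst (theta (emb eps c)) / L) ^ 2 +
        (snd (theta (emb eps y)) / L - snd (theta (emb eps c)) / L) ^ 2 + (ln (N y) - ln (N c)) ^ 2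
        <= (dist3 (emb eps y) (emb eps c) / r) ^ 2).
      { eapply log_polar_lipschitz; try eassumption; fold (N y) (N c); unfold r; lra. }
      unfold Psi. proj3.
      replace ((dist3 (emb eps y) (emb eps c) / r) ^ 2) with (dist3 (emb eps y) (emb eps c) ^ 2 * (/ r) ^ 2) in Hpol
        by (field; lra).
      rewrite emb_dist in Hpol by assumption. rewrite Rpow_mult_distr, dist3_sq.
      set (A := fst (theta (emb eps y)) / L - fst (theta (emb eps c)) / L) in *.
      set (C := snd (theta (emb eps y)) / L - snd (theta (emb eps c)) / L) in *.
      replace ((fst (theta (emb eps y)) + eps * snd (theta (emb eps y))) / (sqrt 2 * L) -
        (fst (theta (emb eps c)) + eps * snd (theta (emb eps c))) / (sqrt 2 * L))
        with ((A + eps * C) / sqrt 2) by (unfold A, C; field; lra).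
      assert (HAC : ((A + eps * C) / sqrt 2) ^ 2 <= A ^ 2 + C ^ 2).
      { rewrite div_sqrt2_sq.
        pose proof (pow2_ge_0 (A - eps * C)).
        replace (A ^ 2 + C ^ 2) with (A ^ 2 + eps ^ 2 * C ^ 2) by (destruct He as [-> | ->]; ring). lra. }
      replace (/ r * p2 y - / r * p2 c) with (/ r * (p2 y - p2 c)) by ring.
      rewrite Rpow_mult_distr. lra.
    - apply Rmult_lt_0_compat; [lra|]. apply Rmult_lt_0_compat; [now apply pow_lt|assumption]. }
  exists (2 * (L * lam) * ((1 + t) * (/ r) ^ 2)).
  assert (Hr2 : 0 < (/ r) ^ 2) by now apply pow_lt.
  split; [|split].
  - apply Rmult_lt_0_compat; [lra|]. apply Rmult_lt_0_compat; lra.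
  - assert (Half : forall k, covb (fun x => (W x /\ inb B (planar eps x)) /\
        exists a, inQ (a, eps * a) /\ p1 x / sqrt 2 = unf lam k a)
        ((L * lam) * ((1 + t) * (/ r) ^ 2) * vol B)).
    { intros k. set (s1 := sgnZ k * (L * lam)).
      assert (A1 : Rabs s1 = L * lam) by (unfold s1; rewrite Rabs_sgnZ, Rabs_pos_eq; lra).
      replace ((L * lam) * ((1 + t) * (/ r) ^ 2) * vol B)
        with (Rabs s1 * Rabs r * Rabs 1 * ((/ r) ^ 3 * vol B + t * ((/ r) ^ 3 * vol B)))
        by (rewrite A1, Rabs_R1, (Rabs_pos_eq r) by lra; field; lra).
      apply covb_aff with (c := (sqrt 2 * (2 * IZR k * lam), 0, - ln (nu * lam)))
        (A := fun y => exists x, inb B x /\ y = Psi x); [|lra|lra| |exact Hlip].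
      - intros E. rewrite E, Rabs_R0 in A1. lra.
      - intros x [[Wx Ix] (a & Q & E1)]. exists (Psi (planar eps x)).
        split; [now exists (planar eps x)|].
        assert (E2 : exists k', eps * (p1 x / sqrt 2) = unf lam k' (eps * a)).
        { rewrite E1. destruct He as [-> | ->].
          - exists k. now rewrite !Rmult_1_l.
          - exists (- k)%Z. unfold unf. rewrite sgnZ_opp, opp_IZR. ring. }
        destruct E2 as (k' & E2).
        assert (Et : theta (zor (emb eps x)) = (a, eps * a)).
        { unfold emb. rewrite E2, E1. eapply theta_zorich; eassumption. }
        unfold aff, Psi. proj3. rewrite emb_planar, Et by assumption. cbn [fst snd].
        assert (Eln : 1 * ln (N (planar eps x)) + - ln (nu * lam) = p3 x).
        { unfold N. rewrite emb_planar by assumption. pose proof (ln_rad (emb eps x)) as H.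
          unfold emb at 1 in H. proj3 in H. rewrite H. ring. }
        rewrite Eln. unfold planar at 1. proj3. rewrite (R3_eta x) at 1. f_equal. f_equal; [|field; lra].
        replace (p1 x) with (sqrt 2 * (p1 x / sqrt 2)) by (field; lra). rewrite E1. unfold unf, s1.
        replace (a + eps * (eps * a)) with (2 * a) by (destruct He as [-> | ->]; ring).
        replace (2 * a / (sqrt 2 * L)) with (sqrt 2 * a / L)
          by (transitivity (sqrt 2 * sqrt 2 * a / (sqrt 2 * L)); [field; lra|now rewrite sqrt2_sq]).
        field. lra. }
    apply covb_union with (l := k0 :: (k0 + 1)%Z :: nil)
      (F := fun k x => (W x /\ inb B (planar eps x)) /\ exists a, inQ (a, eps * a) /\ p1 x / sqrt 2 = unf lam k a)
      (m := fun _ => (L * lam) * ((1 + t) * (/ r) ^ 2) * vol B).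
    + intros k _. apply Half.
    + intros x [Wx Ix]. destruct (Hk x Wx) as (a & Q & [E|E]).
      * exists k0. split; [now left|]. split; [auto|]. now exists a.
      * exists (k0 + 1)%Z. split; [now right; left|]. split; [auto|]. now exists a.
    + unfold lsum. cbn [fold_right]. right. ring.
  - intros x Wx Ix. destruct (HB3 _ Ix) as [_ H]. rewrite HN in H.
    assert (Hx2 : rad x ^ 2 <= ((1 + t) * n0) ^ 2).
    { apply pow_incr. split; [left; now apply rad_pos|lra]. }
    replace (2 * (L * lam) * ((1 + t) * (/ r) ^ 2) * rad x ^ 2)
      with (2 * (L * lam) * ((1 + t) * ((/ r) ^ 2 * rad x ^ 2))) by ring.
    rewrite (Rmult_comm t0). apply Rmult_le_compat_l; [lra|].
    assert (H1 : (/ r) ^ 2 * rad x ^ 2 <= (1 + t) ^ 2 / (1 - t) ^ 2).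
    { apply Rle_trans with ((/ r) ^ 2 * ((1 + t) * n0) ^ 2); [apply Rmult_le_compat_l; lra|].
      right. unfold r. field. lra. }
    apply Rle_trans with ((1 + t) * ((1 + t) ^ 2 / (1 - t) ^ 2)); [apply Rmult_le_compat_l; lra|].
    replace ((1 + t) * ((1 + t) ^ 2 / (1 - t) ^ 2)) with ((1 + t) ^ 3 / (1 - t) ^ 2)
      by (field; lra).
    apply (proj2 (Rle_div_l _ t0 ((1 - t) ^ 2) (pow_lt (1 - t) 2 ltac:(lra)))). lra.
Qed.




(* Above height [0] the pull-back estimate on the slices [j <= x3 <= j + 1]
   gives a geometric series. *)
Lemma finite_content (f : R3 -> R3) (phi : R3 -> R) (m : nat) (K w delta T : R) :
  (2 <= m)%nat -> 0 < K -> 0 < w -> 0 < delta -> 0 < T -> exists M, forall W : R3 -> Prop,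
    pullback f W (fun x => rad x ^ m) K ->
    (exists a1 a2, forall x, W x -> a1 <= p1 x <= a1 + w /\ a2 <= p2 x <= a2 + w) ->
    (exists a1 a2, forall x, W x -> a1 <= p1 (f x) <= a1 + w /\ a2 <= p2 (f x) <= a2 + w) ->
    (forall x, W x -> Rabs (p3 (f x)) <= rad x) -> (exists h, forall x, W x -> p3 x <= h) ->
    wcov phi (fun x => W x /\ delta < phi x /\ - T < p3 x) M.
Proof.
  intros Hm HK Hw Hdelta HT.
  exists (/ delta * (w * w * T) + / delta * (4 * exp 1 * w * w * K)).
  intros W HP (a1 & a2 & Ha) (c1 & c2 & Hc) H3 (h & Hh).
  assert (Hid : 0 < / delta) by now apply Rinv_0_lt_compat.
  assert (Hphi : forall x, delta < phi x -> 1 <= / delta * phi x).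
  { intros x Hx. apply Rmult_le_reg_l with delta; [assumption|].
    rewrite <- Rmult_assoc, Rinv_r by lra. lra. }
  destruct (INR_large h) as (J & HJ & HJh).
  set (S := fun j x => (W x /\ delta < phi x) /\ INR j <= p3 x <= INR j + 1).
  assert (HS : forall j, wcov phi (S j) (/ delta * (2 * exp 1 * w * w * K * (/ 2) ^ j))).
  { intros j. apply covb_wcov; [lra|intros x Hx; apply Hphi; apply Hx|].
    set (r := nu * exp (INR j) * lam).
    assert (Hr : 2 ^ j <= r).
    { unfold r. assert (2 ^ j <= exp (INR j)).
      { clear. induction j as [|j IH]; [simpl; rewrite exp_0; lra|].
        rewrite S_INR, exp_plus. simpl. pose proof (exp_ineq1_le 1). pose proof (exp_pos (INR j)). nra. }
      pose proof (exp_pos (INR j)). nra. }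
    assert (Hr1 : 1 <= r) by (apply Rle_trans with (2 := Hr); apply pow_R1_Rle; lra).
    assert (Hrm : 0 < r ^ m) by (apply pow_lt; lra).
    (* An unweighted pull-back, contracting by [K / r ^ m] on the slice. The image lies in a box of
       height [2 * exp 1 * r]; since [m >= 2], the result decays at least like [/ r], hence like
       [(/ 2) ^ j]. *)
    assert (Hcov : wcov (fun _ => 1) (S j) (K / r ^ m * (1 * (w * w * (2 * (exp 1 * r)))))).
    { apply pullback_wcov with (f := f) (g := fun x => rad x ^ m) (K := K).
      - apply pullback_mono with (2 := HP). intros x Hx. apply Hx.
      - apply Rlt_le. now apply Rdiv_lt_0_compat.
      - intros x [_ [Hx _]]. split; [apply pow_lt; now apply rad_pos|].
        assert (Hrx : r <= rad x).
        { replace (INR j) with (- - INR j) in Hx by ring. apply rad_low in Hx.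
          rewrite Ropp_involutive in Hx. exact Hx. }
        assert (r ^ m <= rad x ^ m) by (apply pow_incr; lra).
        rewrite !Rmult_1_r. replace K with (K / r ^ m * r ^ m) at 1 by (field; lra).
        apply Rmult_le_compat_l; [|assumption]. left; now apply Rdiv_lt_0_compat.
      - apply covb_wcov; [lra|intros; lra|].
        set (B := mkbox (c1, c2, - (exp 1 * r)) w w (2 * (exp 1 * r))).
        pose proof (exp_pos 1) as He.
        assert (VB : valid B) by (apply mkbox_valid; nra).
        apply covb_mono with (3 := covb_box B VB).
        + intros y (x & Hx & ->). destruct Hx as [[Wx _] [_ Hx]].
          destruct (Hc x Wx) as [X1 X2]. pose proof (H3 x Wx) as X3.
          assert (Hrx : rad x <= exp 1 * r).
          { unfold rad, r. replace (exp 1 * (nu * exp (INR j) * lam)) with (nu * (exp (INR j) * exp 1) * lam) by ring.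
            rewrite <- exp_plus. apply Rmult_le_compat_r; [lra|]. apply Rmult_le_compat_l; [lra|].
            destruct Hx as [Hx| ->]; [left; now apply exp_increasing|lra]. }
          apply Rabs_le_between in X3. unfold B. rewrite mkbox_inb. proj3. lra.
        + unfold B. rewrite mkbox_vol. lra. }
    apply wcov_covb with (b := 1) in Hcov; [|lra|intros; lra].
    revert Hcov. apply covb_mono; [tauto|].
    rewrite !Rmult_1_l. pose proof (exp_pos 1) as He.
    replace (K / r ^ m * (w * w * (2 * (exp 1 * r)))) with (2 * exp 1 * w * w * K * (r / r ^ m)) by (field; lra).
    apply Rmult_le_compat_l.
    { repeat apply Rmult_le_pos; lra. }
    assert (Hr2 : r ^ 2 <= r ^ m) by (apply Rle_pow; [lra|lia]).
    apply Rle_trans with (/ r).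
    - apply (proj2 (Rle_div_l r (/ r) (r ^ m) Hrm)).
      apply Rmult_le_reg_l with r; [lra|]. replace (r * (/ r * r ^ m)) with (r ^ m) by (field; lra).
      simpl in Hr2; lra.
    - rewrite pow_inv. apply Rinv_le_contravar; [apply pow_lt; lra|assumption]. }
  apply wcov_union with (l := 0%nat :: 1%nat :: nil)
    (F := fun i x => match i with O => (W x /\ delta < phi x) /\ - T <= p3 x <= 0
                             | _ => (W x /\ delta < phi x) /\ 0 <= p3 x end)
    (m := fun i => match i with O => / delta * (w * w * T) | _ => / delta * (4 * exp 1 * w * w * K) end).
  - intros i [<-|[<-|[]]].
    + apply covb_wcov; [lra|intros x Hx; apply Hphi; apply Hx|].
      set (B := mkbox (a1, a2, - T) w w T).
      assert (VB : valid B) by (apply mkbox_valid; lra).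
      apply covb_mono with (3 := covb_box B VB).
      * intros x [[Wx _] Hx]. destruct (Ha x Wx). unfold B. rewrite mkbox_inb. proj3. lra.
      * unfold B. rewrite mkbox_vol. lra.
    + apply wcov_union with (l := seq 0 J) (F := S) (m := fun j => / delta * (2 * exp 1 * w * w * K * (/ 2) ^ j)).
      * intros j _. apply HS.
      * intros x [Hx Hx0]. specialize (Hh x (proj1 Hx)).
        destruct (grid1 0 1 J (p3 x) Rlt_0_1 HJ ltac:(lra)) as (j & Hj & Hjx).
        exists j. split; [apply in_seq; lia|]. split; [assumption|]. lra.
      * rewrite lsum_scal. apply Rmult_le_compat_l; [lra|]. rewrite lsum_scal.
        pose proof (exp_pos 1).
        replace (4 * exp 1 * w * w * K) with (2 * exp 1 * w * w * K * 2) by ring.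
        apply Rmult_le_compat_l; [repeat apply Rmult_le_pos; lra|].
        assert (G : forall n k, lsum (fun j => (/ 2) ^ j) (seq k n) <= 2 * (/ 2) ^ k).
        { induction n as [|n IHn]; intros k.
          - unfold lsum; simpl. pose proof (pow_lt (/ 2) k ltac:(lra)). lra.
          - change ((/ 2) ^ k + lsum (fun j => (/ 2) ^ j) (seq (Datatypes.S k) n) <= 2 * (/ 2) ^ k).
            specialize (IHn (Datatypes.S k)). rewrite <- tech_pow_Rmult in IHn.
            set (q := (/ 2) ^ k) in *. lra. }
        specialize (G J 0%nat). rewrite pow_O, Rmult_1_r in G. exact G.
  - intros x (Wx & Hx & HT'). destruct (Rle_lt_dec (p3 x) 0).
    + exists 0%nat. split; [now left|]. split; [now split|lra].
    + exists 1%nat. split; [now right; left|]. split; [now split|lra].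
  - unfold lsum. cbn [fold_right]. lra.
Qed.

(** * Continuity and openness of the Zorich map *)

Lemma hf_boundary_dist a b c : inQ (a, b) -> inQ c -> onbdQ c ->
  p3 (hf (a, b)) <= L * dist2 (a, b) c.
Proof.
  intros Hab Hc Hcb. destruct (Hbilip _ _ Hab Hc) as [_ H].
  apply Rle_trans with (2 := H).
  assert (E : p3 (hf c) = 0) by (apply hf_bd; assumption).
  pose proof (dist3_p3 (hf (a, b)) (hf c)) as D. rewrite E, Rminus_0_r in D.
  pose proof (Rle_abs (p3 (hf (a, b)))). lra.
Qed.

(** The height vanishes on the boundary and [hf] is Lipschitz. This smallness compensates for the
    change of sign at a face. *)
Lemma hf_p3_near_face a b : inQ (a, b) ->
  p3 (hf (a, b)) <= L * (1 - Rabs a) /\ p3 (hf (a, b)) <= L * (1 - Rabs b).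
Proof.
  intros Hab. destruct (Hab) as [Ha Hb]; cbn [fst snd] in *.
  assert (S : forall t, Rabs t <= 1 -> exists s, Rabs s = 1 /\ Rabs (t - s) = 1 - Rabs t).
  { intros t Ht. destruct (Rle_lt_dec 0 t).
    - exists 1. rewrite Rabs_R1, (Rabs_left1 (t - 1)), (Rabs_pos_eq t); [lra|lra|].
      rewrite Rabs_pos_eq in Ht; lra.
    - exists (-1). rewrite Rabs_left in Ht by lra. rewrite (Rabs_left t), (Rabs_left (-1)), Rabs_pos_eq; lra. }
  destruct (S a Ha) as (s & S1 & S2). destruct (S b Hb) as (s' & S1' & S2').
  split.
  - rewrite <- S2. replace (Rabs (a - s)) with (dist2 (a, b) (s, b)).
    + apply hf_boundary_dist; [assumption| |]; repeat split; cbn [fst snd]; lra.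
    + unfold dist2, norm2; cbn [fst snd]. rewrite <- sqrt_Rsqr_abs. f_equal. unfold Rsqr. ring.
  - rewrite <- S2'. replace (Rabs (b - s')) with (dist2 (a, b) (a, s')).
    + apply hf_boundary_dist; [assumption| |]; repeat split; cbn [fst snd]; lra.
    + unfold dist2, norm2; cbn [fst snd]. rewrite <- sqrt_Rsqr_abs. f_equal. unfold Rsqr. ring.
Qed.

Lemma zorich_dist x y :
  dist3 (zor x) (zor y) <= 3 * (Rabs (rad x - rad y) + rad x * (2 * L * dist3 x y)).
Proof.
  assert (Hl : 0 < lam) by lra.
  set (sx := sgnZ (fold_k lam (p1 x)) * sgnZ (fold_k lam (p2 x))).
  set (sy := sgnZ (fold_k lam (p1 y)) * sgnZ (fold_k lam (p2 y))).
  set (qx := (fold lam (p1 x) / lam, fold lam (p2 x) / lam) : R2).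
  set (qy := (fold lam (p1 y) / lam, fold lam (p2 y) / lam) : R2).
  assert (EZ : forall z, zor z = (rad z * p1 (hf (fold lam (p1 z) / lam, fold lam (p2 z) / lam)),
    rad z * p2 (hf (fold lam (p1 z) / lam, fold lam (p2 z) / lam)),
    rad z * (sgnZ (fold_k lam (p1 z)) * sgnZ (fold_k lam (p2 z)) * p3 (hf (fold lam (p1 z) / lam, fold lam (p2 z) / lam)))))
    by reflexivity.
  rewrite (EZ x), (EZ y). fold qx qy sx sy.
  assert (Qx : inQ qx) by (split; apply unf_fold; assumption).
  assert (Qy : inQ qy) by (split; apply unf_fold; assumption).
  set (D := dist3 x y). assert (HD : 0 <= D) by apply dist3_pos.
  pose proof (dist3_p1 x y) as D1. pose proof (dist3_p2 x y) as D2. fold D in D1, D2.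
  pose proof (fold_lipschitz lam (p1 x) (p1 y) Hl) as F1. pose proof (fold_lipschitz lam (p2 x) (p2 y) Hl) as F2.
  assert (Hq : dist2 qx qy <= 2 * D).
  { apply pow2_le_inv; [lra|]. rewrite dist2_sq. unfold qx, qy; cbn [fst snd].
    assert (Dv : forall u v, Rabs (u - v) <= D -> (u / lam - v / lam) ^ 2 <= D ^ 2).
    { intros u v H. rewrite <- pow2_abs. apply pow_incr. split; [apply Rabs_pos|].
      replace (u / lam - v / lam) with ((u - v) / lam) by (field; lra).
      unfold Rdiv. rewrite Rabs_mult, (Rabs_pos_eq (/ lam)) by (left; now apply Rinv_0_lt_compat).
      apply (proj2 (Rle_div_l (Rabs (u - v)) D lam Hl)). nra. }
    pose proof (Dv _ _ (Rle_trans _ _ _ F1 D1)). pose proof (Dv _ _ (Rle_trans _ _ _ F2 D2)).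
    pose proof (pow2_ge_0 D). replace ((2 * D) ^ 2) with (4 * D ^ 2) by ring. lra. }
  destruct (Hbilip qx qy Qx Qy) as [_ Hh].
  assert (Hh' : dist3 (hf qx) (hf qy) <= 2 * L * D).
  { apply Rle_trans with (1 := Hh). replace (2 * L * D) with (L * (2 * D)) by ring.
    apply Rmult_le_compat_l; lra. }
  destruct (hf_sphere _ Qx) as [Sx Sx3]. destruct (hf_sphere _ Qy) as [Sy Sy3].
  pose proof (rad_pos x) as Rx. fold (rad x) in Rx.
  assert (One : forall a b c, a ^ 2 + b ^ 2 + c ^ 2 = 1 -> Rabs a <= 1 /\ Rabs b <= 1 /\ Rabs c <= 1).
  { intros a b c H. pose proof (pow2_ge_0 a). pose proof (pow2_ge_0 b). pose proof (pow2_ge_0 c).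
    repeat split; apply Rabs_le_of_sq; simpl in *; lra. }
  destruct (One _ _ _ Sy) as (O1 & O2 & O3).
  assert (Hs : Rabs (sx * p3 (hf qx) - sy * p3 (hf qy)) <= 2 * L * D).
  { destruct (Req_dec sx sy) as [E|Hne].
    - rewrite E, <- Rmult_minus_distr_l. unfold sy. rewrite Rmult_assoc, !Rabs_sgnZ.
      apply Rle_trans with (2 := Hh'). apply dist3_p3.
    (* Different signs mean different beams; both points are then within [D] of a face and both
       heights are small, so their sum is bounded instead of their difference. *)
    - assert (P : p3 (hf qx) <= L * D /\ p3 (hf qy) <= L * D).
      { assert (Face : forall a b, fold_k lam a <> fold_k lam b -> Rabs (a - b) <= D ->
          1 - Rabs (fold lam a / lam) <= D).
        { intros a b H Hd. pose proof (fold_k_differ lam a b Hl H).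
          unfold Rdiv. rewrite Rabs_mult, (Rabs_pos_eq (/ lam)) by (left; now apply Rinv_0_lt_compat).
          replace (1 - Rabs (fold lam a) * / lam) with ((lam - Rabs (fold lam a)) / lam) by (field; lra).
          apply (proj2 (Rle_div_l _ D lam Hl)). nra. }
        destruct (hf_p3_near_face _ _ Qx) as [X1 X2]. destruct (hf_p3_near_face _ _ Qy) as [Y1 Y2].
        fold qx in X1, X2. fold qy in Y1, Y2.
        destruct (Z.eq_dec (fold_k lam (p1 x)) (fold_k lam (p1 y))) as [E1|N1].
        - destruct (Z.eq_dec (fold_k lam (p2 x)) (fold_k lam (p2 y))) as [E2|N2].
          + exfalso. apply Hne. unfold sx, sy. now rewrite E1, E2.
          + pose proof (Face _ _ N2 D2). pose proof (Face _ _ (not_eq_sym N2) ltac:(now rewrite Rabs_minus_sym)).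
            split; [apply Rle_trans with (1 := X2)|apply Rle_trans with (1 := Y2)]; apply Rmult_le_compat_l; lra.
        - pose proof (Face _ _ N1 D1). pose proof (Face _ _ (not_eq_sym N1) ltac:(now rewrite Rabs_minus_sym)).
          split; [apply Rle_trans with (1 := X1)|apply Rle_trans with (1 := Y1)]; apply Rmult_le_compat_l; lra. }
      unfold Rminus. apply Rle_trans with (1 := Rabs_triang _ _). rewrite Rabs_Ropp.
      unfold sx, sy. rewrite !Rmult_assoc, !Rabs_sgnZ, !Rabs_pos_eq by assumption. lra. }
  assert (Step : forall u v, Rabs v <= 1 -> Rabs (u - v) <= 2 * L * D ->
    Rabs (rad x * u - rad y * v) <= Rabs (rad x - rad y) + rad x * (2 * L * D)).
  { intros u v Hv Huv. replace (rad x * u - rad y * v) with ((rad x - rad y) * v + rad x * (u - v)) by ring.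
    apply Rle_trans with (1 := Rabs_triang _ _). rewrite !Rabs_mult, (Rabs_pos_eq (rad x)) by lra.
    pose proof (Rabs_pos (rad x - rad y)). apply Rplus_le_compat; [nra|]. apply Rmult_le_compat_l; lra. }
  eapply Rle_trans; [apply dist3_le_sum|]. proj3.
  pose proof (Step _ _ O1 (Rle_trans _ _ _ (dist3_p1 (hf qx) (hf qy)) Hh')).
  pose proof (Step _ _ O2 (Rle_trans _ _ _ (dist3_p2 (hf qx) (hf qy)) Hh')).
  assert (O3' : Rabs (sy * p3 (hf qy)) <= 1) by (unfold sy; rewrite Rmult_assoc, !Rabs_sgnZ; assumption).
  pose proof (Step _ _ O3' Hs). lra.
Qed.

Lemma zorich_continuous : contmap zor.
Proof.
  intros x e He. pose proof (rad_pos x) as Rx.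
  assert (C : continuity_pt (fun t => nu * exp t * lam) (p3 x)).
  { apply derivable_continuous_pt. auto_derive. exact I. }
  destruct (C (e / 6) ltac:(lra)) as (d & Hd & H).
  set (d' := e / (18 * (rad x * L))).
  assert (RL : 0 < rad x * L) by nra.
  assert (Hd' : 0 < d') by (apply Rdiv_lt_0_compat; lra).
  exists (Rmin d d'). split; [now apply Rmin_glb_lt|]. intros y Hy.
  assert (Hy1 : dist3 x y < d) by (apply Rlt_le_trans with (1 := Hy); apply Rmin_l).
  assert (Hy2 : dist3 x y < d') by (apply Rlt_le_trans with (1 := Hy); apply Rmin_r).
  assert (Hr : Rabs (rad x - rad y) < e / 6).
  { destruct (Req_dec (p3 y) (p3 x)) as [E|Hne].
    - unfold rad. rewrite E, Rminus_diag, Rabs_R0. lra.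
    - rewrite Rabs_minus_sym. apply (H (p3 y)). split; [split; [exact I|auto]|].
      simpl. unfold Rdist. apply Rle_lt_trans with (2 := Hy1). rewrite dist3_sym. apply dist3_p3. }
  apply Rle_lt_trans with (1 := zorich_dist x y).
  assert (E : rad x * L * d' = e / 18) by (unfold d'; field; lra).
  pose proof (dist3_pos x y). nra.
Qed.


(** Openness comes from an explicit inverse branch: a beam containing [x] is chosen with the parity
    that the sign of [p3 y] requires, and the branch is Lipschitz by [log_polar_lipschitz]. *)
Lemma zorich_open x e : 0 < e -> exists d, 0 < d /\
  forall y, dist3 (zor x) y < d -> exists x', dist3 x x' < e /\ zor x' = y.
Proof.
  intros He. assert (Hl : 0 < lam) by lra.
  destruct (coordinates x) as (k1 & k2 & a & b & Q & E1 & E2 & Ex & _).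
  pose proof (rad_pos x) as Rx. set (r := rad x) in *.
  assert (Er : norm3 (zor x) = r) by apply zorich_norm.
  destruct (hf_sphere _ Q) as [_ S3].
  assert (EZ3 : p3 (zor x) = r * (sgnZ k1 * sgnZ k2 * p3 (hf (a, b)))).
  { rewrite Ex at 1. rewrite zorich_unf by assumption. reflexivity. }
  (* Off the faces [y] must stay on the same side of the reflecting plane as the image of [x]. On a
     face no such bound is needed, since neighbouring beams of both parities contain [x]. *)
  set (d0 := if Rle_dec (p3 (hf (a, b))) 0 then r / 2 else Rmin (r / 2) (r * p3 (hf (a, b)))).
  (* With [w <= 2 * d1 / r] each of the three coordinates of the preimage moves by less than
     [e / 4]. *)
  set (d1 := e * r / (8 * L * lam)).
  assert (HLl : 1 <= L * lam) by nra.
  assert (Hd1 : 0 < d1) by (unfold d1; apply Rdiv_lt_0_compat; nra).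
  assert (Hd0 : 0 < d0).
  { unfold d0. destruct (Rle_dec _ _); [lra|]. apply Rmin_glb_lt; [lra|]. apply Rmult_lt_0_compat; lra. }
  assert (Hd0' : d0 <= r / 2).
  { unfold d0. destruct (Rle_dec _ _); [lra|]. apply Rmin_l. }
  exists (Rmin d0 d1). split; [now apply Rmin_glb_lt|]. intros y Hy.
  assert (Hy0 : dist3 (zor x) y < d0) by (apply Rlt_le_trans with (1 := Hy); apply Rmin_l).
  assert (Hy1 : dist3 (zor x) y < d1) by (apply Rlt_le_trans with (1 := Hy); apply Rmin_r).
  assert (Hny : r / 2 <= norm3 y).
  { pose proof (norm3_tri (zor x) y). lra. }
  assert (Hk : exists j1 j2, unf lam j1 a = unf lam k1 a /\ unf lam j2 b = unf lam k2 b /\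
    sgnZ j1 * sgnZ j2 * Rabs (p3 y) = p3 y).
  { assert (Sg : forall s, s = 1 \/ s = -1 -> s * Rabs (p3 y) = p3 y \/ - s * Rabs (p3 y) = p3 y).
    { intros s [-> | ->]; unfold Rabs; destruct (Rcase_abs _); lra. }
    assert (Hsg : sgnZ k1 * sgnZ k2 = 1 \/ sgnZ k1 * sgnZ k2 = -1).
    { destruct (sgnZ_cases k1) as [-> | ->], (sgnZ_cases k2) as [-> | ->]; lra. }
    destruct (Sg _ Hsg) as [H|H]; [now exists k1, k2|].
    destruct (Rle_lt_dec (p3 (hf (a, b))) 0) as [Z0|Zp].
    - assert (B : onbdQ (a, b)) by (apply hf_bd; try assumption; lra).
      destruct B as [_ [B|B]]; cbn [fst snd] in B.
      + destruct (unf_alternative lam k1 a B) as (j & J1 & J2). exists j, k2.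
        repeat split; [assumption|]. rewrite J2. lra.
      + destruct (unf_alternative lam k2 b B) as (j & J1 & J2). exists k1, j.
        repeat split; [assumption|]. rewrite J2. lra.
    - exists k1, k2. repeat split.
      assert (Hy0' : dist3 (zor x) y < r * p3 (hf (a, b))).
      { apply Rlt_le_trans with (1 := Hy0). unfold d0. destruct (Rle_dec _ _); [lra|]. apply Rmin_r. }
      pose proof (dist3_p3 (zor x) y) as D. rewrite EZ3 in D.
      set (w := r * p3 (hf (a, b))) in *. assert (0 < w) by (unfold w; nra).
      assert (D' : Rabs (sgnZ k1 * sgnZ k2 * w - p3 y) < w).
      { replace (sgnZ k1 * sgnZ k2 * w) with (r * (sgnZ k1 * sgnZ k2 * p3 (hf (a, b)))) by (unfold w; ring). lra. }
      apply Rabs_lt_between in D'.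
      destruct Hsg as [E|E]; rewrite E in *; unfold Rabs; destruct (Rcase_abs _); lra. }
  destruct Hk as (j1 & j2 & J1 & J2 & J3).
  set (t := theta y).
  exists (unf lam j1 (fst t), unf lam j2 (snd t), ln (norm3 y / (nu * lam))). split.
  2:{ eapply zorich_preimage; try eassumption. lra. }
  pose proof (log_polar_lipschitz (r / 2) (zor x) y ltac:(lra) ltac:(lra) Hny) as HP.
  assert (Et : theta (zor x) = (a, b)).
  { rewrite Ex. eapply theta_zorich; eassumption. }
  rewrite Et in HP. fold t in HP. cbn [fst snd] in HP.
  set (w := dist3 (zor x) y / (r / 2)) in *.
  assert (Hw : 0 <= w) by (apply Rle_mult_inv_pos; [apply dist3_pos|lra]).
  assert (Hw' : L * lam * w < e / 4).
  { assert (E4 : L * lam * (d1 / (r / 2)) = e / 4) by (unfold d1; field; lra).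
    rewrite <- E4. apply Rmult_lt_compat_l; [lra|]. unfold w. apply Rmult_lt_compat_r; [|assumption].
    apply Rinv_0_lt_compat. lra. }
  assert (Hsep : forall A B C, A ^ 2 + B ^ 2 + C ^ 2 <= w ^ 2 -> Rabs A <= w /\ Rabs B <= w /\ Rabs C <= w).
  { intros A B C H. pose proof (pow2_ge_0 A). pose proof (pow2_ge_0 B). pose proof (pow2_ge_0 C).
    repeat split; apply Rabs_le_of_sq; lra. }
  apply Hsep in HP. destruct HP as (P1 & P2 & P3).
  assert (Hcoord : forall j a t, Rabs (a / L - t / L) <= w -> Rabs (unf lam j a - unf lam j t) <= L * lam * w).
  { intros j a' t' H. unfold unf.
    replace (2 * IZR j * lam + sgnZ j * (lam * a') - (2 * IZR j * lam + sgnZ j * (lam * t')))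
      with (sgnZ j * (L * lam * (a' / L - t' / L))) by (field; lra).
    rewrite Rabs_sgnZ, Rabs_mult, (Rabs_pos_eq (L * lam)) by lra. apply Rmult_le_compat_l; lra. }
  eapply Rle_lt_trans; [apply dist3_le_sum|]. proj3.
  rewrite E1, E2, <- J1, <- J2.
  pose proof (Hcoord j1 _ _ P1). pose proof (Hcoord j2 _ _ P2).
  assert (H3 : Rabs (p3 x - ln (norm3 y / (nu * lam))) <= L * lam * w).
  { rewrite ln_rad by assumption.  rewrite ln_div by nra.
    replace (ln (norm3 (zor x)) - ln (nu * lam) - (ln (norm3 y) - ln (nu * lam)))
      with (ln (norm3 (zor x)) - ln (norm3 y)) by ring. nra. }
  lra.
Qed.

Lemma zorich_image_open (U : R3 -> Prop) : open3 U -> open3 (fun y => exists x, U x /\ zor x = y).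
Proof.
  intros HU y (x & Ux & <-). destruct (HU x Ux) as (e & He & H).
  destruct (zorich_open x e He) as (d & Hd & H'). exists d. split; [assumption|].
  intros y Hy. destruct (H' y Hy) as (x' & Hx' & E). exists x'. auto.
Qed.

Lemma zorich_iter_open (U : R3 -> Prop) n : open3 U ->
  open3 (fun y => exists x, U x /\ Nat.iter n zor x = y).
Proof.
  intros HU. induction n as [|n IH].
  - intros y (x & Ux & <-). destruct (HU x Ux) as (r & Hr & H). exists r.
    split; [assumption|]. intros z Hz. exists z. auto.
  - intros y (x & Ux & <-).
    destruct (zorich_image_open _ IH (Nat.iter (S n) zor x)) as (r & Hr & H).
    { exists (Nat.iter n zor x). split; [now exists x|reflexivity]. }
    exists r. split; [assumption|]. intros z Hz. destruct (H z Hz) as (w & (v & Uv & <-) & <-).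
    now exists v.
Qed.

(** * Iterates of open sets meet the axis *)

Definition orbit_set (f : R3 -> R3) (B : box) (n : nat) (x : R3) : Prop :=
  exists v, inb B v /\ x = Nat.iter n f v.

(** The bound may depend on [n]. It provides the height bounds demanded by the pull-back lemmas and
    by [finite_content], whose constants do not depend on them. *)
Lemma orbit_set_bounded f B n : (forall x, Rabs (p3 (f x)) <= rad x) ->
  exists h, forall x, orbit_set f B n x -> Rabs (p3 x) <= h.
Proof.
  intros Hf. induction n as [|n (h & IH)].
  - exists (Rabs (p3 (fst B)) + Rabs (p3 (snd B))). intros x (v & (_ & _ & I) & ->). cbn.
    pose proof (Rle_abs (p3 (snd B))). pose proof (Rle_abs (- p3 (fst B))). rewrite Rabs_Ropp in *.
    pose proof (Rabs_pos (p3 (snd B))). pose proof (Rabs_pos (p3 (fst B))). apply Rabs_le. lra.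
  - exists (nu * exp h * lam). intros x (v & I & ->).
    change (Nat.iter (S n) f v) with (f (Nat.iter n f v)). apply Rle_trans with (1 := Hf _).
    assert (H : p3 (Nat.iter n f v) <= h).
    { apply Rle_trans with (1 := Rle_abs _). apply IH. now exists v. }
    unfold rad. apply Rmult_le_compat_r; [lra|]. apply Rmult_le_compat_l; [lra|].
    destruct H as [H| ->]; [left; now apply exp_increasing|lra].
Qed.

(** Shared by the argument in space, with [m = 3] and the cube of the horizontal norm, and the one
    in a plane, with [m = 2] and the square of [p1]. [finite_content] bounds the region uniformly in
    [n], and the inequality between [K] and [kappa] is the contraction of the weighted content. *)
Lemma orbits_stay_out (f : R3 -> R3) (phi : R3 -> R) (m : nat) (B : box) (K kappa b w delta T : R) :
  valid B -> (2 <= m)%nat -> 0 < K -> 0 <= kappa < 1 -> 0 < b -> 0 < w -> 0 < delta -> 0 < T ->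
  (forall x, inb B x -> phi x <= b) -> contmap f ->
  (forall x, delta < phi x -> exists d, 0 < d /\ forall y, dist3 x y < d -> delta < phi y) ->
  (forall x, Rabs (p3 (f x)) <= rad x) ->
  (forall x, K * phi (f x) <= kappa * phi x * rad x ^ m) ->
  (forall n, pullback f (orbit_set f B n) (fun x => rad x ^ m) K) ->
  (forall n, exists a1 a2, forall x, orbit_set f B n x -> a1 <= p1 x <= a1 + w /\ a2 <= p2 x <= a2 + w) ->
  exists x N, inb B x /\ forall n, (N <= n)%nat ->
    ~ (delta < phi (Nat.iter n f x) /\ - T < p3 (Nat.iter n f x)).
Proof.
  intros VB Hm HK Hk Hb Hw Hdelta HT Hphib Hcont Hphi Hp3 Hcontr Hpull Hstrip.
  destruct (finite_content f phi m K w delta T Hm HK Hw Hdelta HT) as (M & HM).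
  apply (eventually_outside f phi (fun y => delta < phi y /\ - T < p3 y) B kappa b M); try assumption.
  - intros n x Ix [H1 H2]. destruct (Hphi _ H1) as (d1 & D1 & H1').
    set (z := Nat.iter n f x) in *.
    destruct (contmap_iter f n Hcont x (Rmin d1 (p3 z + T))) as (d & Hd & H).
    { apply Rmin_glb_lt; lra. }
    exists d. split; [assumption|]. intros y Hy. specialize (H y Hy). fold z in H. split.
    + apply H1'. apply Rlt_le_trans with (1 := H). apply Rmin_l.
    + assert (H' : dist3 z (Nat.iter n f y) < p3 z + T) by (apply Rlt_le_trans with (1 := H); apply Rmin_r).
      pose proof (dist3_p3 z (Nat.iter n f y)). pose proof (Rle_abs (p3 z - p3 (Nat.iter n f y))). lra.
  - intros n A M' HA HM'.
    apply pullback_wcov with (f := f) (g := fun x => rad x ^ m) (K := K); try assumption; [|lra|].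
    + apply pullback_mono with (2 := Hpull n). intros x Ax. exact (HA x Ax).
    + intros x _. split; [apply pow_lt; now apply rad_pos|apply Hcontr].
  - intros n.
    assert (HS : forall x, orbit_set f B n x -> orbit_set f B (S n) (f x)).
    { intros x (v & I & ->). exists v. now split. }
    apply wcov_mono with (3 := HM (orbit_set f B n) (Hpull n) (Hstrip n)
      ltac:(destruct (Hstrip (S n)) as (a1 & a2 & H); exists a1, a2; intros x Hx; apply H; auto)
      (fun x _ => Hp3 x)
      ltac:(destruct (orbit_set_bounded f B n Hp3) as (h & H); exists h; intros x Hx;
            apply Rle_trans with (1 := Rle_abs _); auto)); [|lra].
    intros y ([G1 G2] & v & I & ->). split; [now exists v|now split].
Qed.

(** * Diamonds cut out by the preimages of the two planes *)

Lemma net_to_plane x k s : s = 1 \/ s = -1 -> p1 x = s * p2 x + 2 * IZR k * lam ->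
  exists eps, (eps = 1 \/ eps = -1) /\ p2 (zor x) = eps * p1 (zor x).
Proof.
  intros Hs E. assert (Hl : 0 < lam) by lra.
  (* Up to sign the fold commutes with negation and with translation by [2 * lam], so the line is
     folded onto a diagonal of the square. *)
  assert (F : exists t, (t = 1 \/ t = -1) /\ fold lam (p2 x) = t * fold lam (p1 x)).
  { rewrite E, fold_shift by assumption.
    assert (Fs : fold lam (s * p2 x) = s * fold lam (p2 x)).
    { destruct Hs as [-> | ->]; [now rewrite !Rmult_1_l|].
      replace (-1 * p2 x) with (- p2 x) by ring. rewrite fold_opp by assumption. ring. }
    rewrite Fs. exists (sgnZ k * s). split.
    - destruct (sgnZ_cases k) as [-> | ->], Hs as [-> | ->]; lra.
    - replace (sgnZ k * s * (sgnZ k * (s * fold lam (p2 x)))) with (sgnZ k * sgnZ k * (s * s) * fold lam (p2 x)) by ring.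
      rewrite sgnZ_sq. destruct Hs as [-> | ->]; ring. }
  destruct F as (t & Ht & F). exists t. split; [assumption|].
  unfold zor, zorich. proj3. rewrite F. replace (t * fold lam (p1 x) / lam) with (t * (fold lam (p1 x) / lam)) by (field; lra).
  rewrite (hf_diag t); [ring|assumption|]. apply Rabs_le_between. now apply unf_fold.
Qed.

Lemma in_half_beam x k j a b : inQ (a, b) -> p1 x = unf lam k a -> p2 x = unf lam j b ->
  sgnZ k * sgnZ j * p3 (zor x) <= 0 -> Rabs a = 1 \/ Rabs b = 1.
Proof.
  intros Q E1 E2 H. rewrite (R3_eta x), E1, E2 in H. 
  rewrite zorich_unf in H by assumption. proj3 in H.
  pose proof (rad_pos x) as Rx. unfold rad in Rx.
  replace (sgnZ k * sgnZ j * (nu * exp (p3 x) * lam * (sgnZ k * sgnZ j * p3 (hf (a, b)))))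
    with ((sgnZ k * sgnZ k) * (sgnZ j * sgnZ j) * ((nu * exp (p3 x) * lam) * p3 (hf (a, b)))) in H by ring.
  rewrite !sgnZ_sq in H. destruct (hf_sphere _ Q) as [_ S3].
  assert (H0 : p3 (hf (a, b)) = 0) by nra.
  apply hf_bd in H0; try assumption. destruct H0 as [_ H0]. exact H0.
Qed.

(** The sign of the image decides on which side of the wall the point lies, and on the wall both
    charts apply. The predicate [beam] is abstract so that walls in both horizontal directions are
    covered. *)
Lemma two_beams (beam : Z -> Z -> Prop) (t1 t2 z : R) m j :
  (forall k i a b, Rabs a <= 1 -> Rabs b <= 1 -> t1 = unf lam k a -> t2 = unf lam i b ->
     beam k i /\ (sgnZ k * sgnZ i * z <= 0 -> Rabs a = 1 \/ Rabs b = 1)) ->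
  Rabs (t1 - 2 * IZR m * lam) < lam -> Rabs (t2 - (2 * IZR j + 1) * lam) < lam ->
  (0 <= sgnZ m * sgnZ j * z -> beam m j) /\ (sgnZ m * sgnZ j * z <= 0 -> beam m (j + 1)%Z).
Proof.
  intros HB H1 H2. assert (Hl : 0 < lam) by lra.
  destruct (unf_exists lam m t1 Hl) as (a & E1 & A). assert (Ha : Rabs a < 1) by nra.
  destruct (interval_rep lam _ _ Hl H2) as [(b & Hb & E2 & Hb')|(b & Hb & E2)].
  - destruct (HB m j a b) as [B0 B1]; try assumption; [lra|]. split; intros H; [assumption|].
    destruct (B1 H) as [C|C]; [lra|]. destruct (Hb' C) as (b' & Hb1 & E3).
    apply (HB m (j + 1)%Z a b'); try assumption; lra.
  - destruct (HB m (j + 1)%Z a b) as [B0 B1]; try assumption; [lra|lra|]. split; intros H; [|assumption].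
    exfalso. rewrite sgnZ_succ in B1. destruct B1; lra.
Qed.

Lemma diamond_beams x m j : Rabs (p1 x - 2 * IZR m * lam) < lam -> Rabs (p2 x - (2 * IZR j + 1) * lam) < lam ->
  (0 <= sgnZ m * sgnZ j * p3 (zor x) -> inbeam m j x) /\
  (sgnZ m * sgnZ j * p3 (zor x) <= 0 -> inbeam m (j + 1) x).
Proof.
  apply (two_beams (fun k i => inbeam k i x)). intros k i a b Ha Hb E1 E2.
  assert (Q : inQ (a, b)) by now split.
  split; [now exists a, b|]. now apply in_half_beam.
Qed.

Lemma diamond_beams' x m j : Rabs (p2 x - 2 * IZR m * lam) < lam -> Rabs (p1 x - (2 * IZR j + 1) * lam) < lam ->
  (0 <= sgnZ m * sgnZ j * p3 (zor x) -> inbeam j m x) /\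
  (sgnZ m * sgnZ j * p3 (zor x) <= 0 -> inbeam (j + 1) m x).
Proof.
  apply (two_beams (fun k i => inbeam i k x)). intros k i a b Ha Hb E1 E2.
  assert (Q : inQ (b, a)) by now split.
  split; [now exists b, a|]. rewrite (Rmult_comm (sgnZ k)). intros H.
  destruct (in_half_beam x i k b a Q E2 E1 H); auto.
Qed.

(** The diamond has its centre at [((k + l + 1) * lam, (l - k) * lam)]. One of the two multiples is
    even and the other odd, so the centre is the middle of a wall; the parity of [k + l + 1] tells
    which wall. *)
Lemma diamond_two_beams (W : R3 -> Prop) (k l : Z) :
  (forall x, W x -> IZR k * (2 * lam) < p1 x - p2 x < IZR (k + 1) * (2 * lam) /\
                    IZR l * (2 * lam) < p1 x + p2 x < IZR (l + 1) * (2 * lam)) ->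
  (exists k1 k2, forall x, W x -> 0 <= p3 (zor x) -> inbeam k1 k2 x) /\
  (exists k1 k2, forall x, W x -> p3 (zor x) <= 0 -> inbeam k1 k2 x).
Proof.
  intros HW.
  assert (Main : exists s m j m' j', (s = 1 \/ s = -1) /\ forall x, W x ->
     (0 <= s * p3 (zor x) -> inbeam m j x) /\ (s * p3 (zor x) <= 0 -> inbeam m' j' x)).
  { assert (Hs : forall a b, sgnZ a * sgnZ b = 1 \/ sgnZ a * sgnZ b = -1).
    { intros a b. destruct (sgnZ_cases a) as [-> | ->], (sgnZ_cases b) as [-> | ->]; lra. }
    destruct (Z.Even_or_Odd (k + l + 1)) as [[m Em]|[m Em]].
    - exists (sgnZ m * sgnZ (l - m)), m, (l - m)%Z, m, (l - m + 1)%Z. split; [apply Hs|].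
      intros x Wx. destruct (HW x Wx) as [H1 H2]. rewrite !plus_IZR in *.
      assert (Ek : IZR k = 2 * IZR m - IZR l - 1).
      { apply (f_equal IZR) in Em. rewrite !plus_IZR, mult_IZR in Em. lra. }
      rewrite Ek in H1. apply diamond_beams; rewrite ?minus_IZR; apply Rabs_lt_between; lra.
    - exists (sgnZ (l - m) * sgnZ m), m, (l - m)%Z, (m + 1)%Z, (l - m)%Z. split; [apply Hs|].
      intros x Wx. destruct (HW x Wx) as [H1 H2]. rewrite !plus_IZR in *.
      assert (Ek : IZR k = 2 * IZR m - IZR l).
      { apply (f_equal IZR) in Em. rewrite !plus_IZR, mult_IZR in Em. lra. }
      rewrite Ek in H1. apply diamond_beams'; rewrite ?minus_IZR; apply Rabs_lt_between; lra. }
  destruct Main as (s & m & j & m' & j' & [-> | ->] & H).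
  - split; [exists m, j|exists m', j']; intros x Wx H3; apply (H x Wx); lra.
  - split; [exists m', j'|exists m, j]; intros x Wx H3; apply (H x Wx); lra.
Qed.

Lemma hnorm_lip x y : hnorm x <= hnorm y + dist3 x y.
Proof.
  pose proof (norm3_tri (p1 x, p2 x, 0) (p1 y, p2 y, 0)) as H.
  assert (E : forall z, norm3 (p1 z, p2 z, 0) = hnorm z).
  { intros z. unfold norm3, hnorm. proj3. f_equal. ring. }
  rewrite !E in H. apply Rle_trans with (1 := H). apply Rplus_le_compat_l.
  apply dist3_le; [apply dist3_pos|]. rewrite dist3_sq. proj3. pose proof (pow2_ge_0 (p3 x - p3 y)). simpl in *; lra.
Qed.

Lemma open_box (V : R3 -> Prop) v : open3 V -> V v ->
  exists B, valid B /\ inb B v /\ forall x, inb B x -> V x.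
Proof.
  intros HV Vv. destruct (HV v Vv) as (r & Hr & H).
  exists (mkbox v (r / 4) (r / 4) (r / 4)). split; [apply mkbox_valid; lra|].
  assert (I : inb (mkbox v (r / 4) (r / 4) (r / 4)) v) by (rewrite mkbox_inb; lra).
  split; [assumption|]. intros x Hx. apply H.
  pose proof (inball_sides _ _ _ _ _ _ I Hx). lra.
Qed.


Lemma ratio_slack q : 0 < q < 1 -> exists t, 1 < t /\ 0 <= t * q < 1.
Proof.
  intros Hq. exists ((1 + q) / (2 * q)). split.
  - apply (proj1 (Rlt_div_r 1 (1 + q) (2 * q) ltac:(lra))). lra.
  - replace ((1 + q) / (2 * q) * q) with ((1 + q) / 2) by (field; lra). lra.
Qed.

(* Otherwise the iterates of a small box stay in the diamonds cut out by the
   preimages of the two planes, and on such a diamond the map is injective. *)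
Lemma hits_planes (V : R3 -> Prop) : open3 V -> (exists v, V v) ->
  exists n x eps, V x /\ (eps = 1 \/ eps = -1) /\ p2 (Nat.iter n zor x) = eps * p1 (Nat.iter n zor x).
Proof.
  intros HV (v & Vv). destruct (open_box V v HV Vv) as (B & VB & _ & HB).
  apply NNPP. intros Hno.
  assert (Hpl : forall n x eps, inb B x -> eps = 1 \/ eps = -1 -> p2 (Nat.iter n zor x) <> eps * p1 (Nat.iter n zor x)).
  { intros n x eps Ix He E. apply Hno. exists n, x, eps. auto. }
  pose proof zorich_continuous as Hcont.
  assert (Hl : 0 < lam) by lra.
  assert (Hdia : forall n, exists k l, forall x, orbit_set zor B n x ->
     IZR k * (2 * lam) < p1 x - p2 x < IZR (k + 1) * (2 * lam) /\
     IZR l * (2 * lam) < p1 x + p2 x < IZR (l + 1) * (2 * lam)).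
  { intros n.
    assert (Hc : forall s, s = 1 \/ s = -1 -> forall x e, 0 < e -> exists d, 0 < d /\ forall y, dist3 x y < d ->
      Rabs ((p1 (Nat.iter n zor x) - s * p2 (Nat.iter n zor x)) - (p1 (Nat.iter n zor y) - s * p2 (Nat.iter n zor y))) < e).
    { intros s Hs x e He. destruct (contmap_iter zor n Hcont x (e / 2) ltac:(lra)) as (d & Hd & H).
      exists d. split; [assumption|]. intros y Hy. specialize (H y Hy).
      set (a := Nat.iter n zor x) in *. set (b := Nat.iter n zor y) in *.
      pose proof (dist3_p1 a b). pose proof (dist3_p2 a b).
      replace (p1 a - s * p2 a - (p1 b - s * p2 b)) with ((p1 a - p1 b) + (- s) * (p2 a - p2 b)) by ring.
      apply Rle_lt_trans with (1 := Rabs_triang _ _). rewrite Rabs_mult, Rabs_Ropp.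
      replace (Rabs s) with 1; [lra|]. destruct Hs as [-> | ->]; [now rewrite Rabs_R1|rewrite Rabs_left; lra]. }
    assert (Hl2 : forall s, s = 1 \/ s = -1 -> forall x k, inb B x ->
      p1 (Nat.iter n zor x) - s * p2 (Nat.iter n zor x) <> IZR k * (2 * lam)).
    { intros s Hs x k Ix E. destruct (net_to_plane (Nat.iter n zor x) k s Hs ltac:(lra)) as (eps & He & E').
      exact (Hpl (S n) x eps Ix He E'). }
    destruct (box_avoids_lattice B _ (2 * lam) VB ltac:(lra) (Hc 1 (or_introl eq_refl)) (Hl2 1 (or_introl eq_refl))) as (k & Hk).
    destruct (box_avoids_lattice B _ (2 * lam) VB ltac:(lra) (Hc (-1) (or_intror eq_refl)) (Hl2 (-1) (or_intror eq_refl))) as (l & Hl').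
    exists k, l. intros x (u & Iu & ->). specialize (Hk u Iu). specialize (Hl' u Iu). lra. }
  assert (HL5 : 0 < L ^ 5) by (apply pow_lt; lra).
  destruct (ratio_slack (L ^ 5 / lam)) as (t & Ht & Htk).
  { split; [apply Rdiv_lt_0_compat; lra|]. apply (proj2 (Rlt_div_l (L ^ 5) 1 lam Hl)). lra. }
  destruct leaves_axis as (T & HT & Hleave).
  set (d0 := lam / (2 * L)) in *. assert (Hd0 : 0 < d0) by (apply Rdiv_lt_0_compat; lra).
  set (bb := (hnorm (fst B) + dist3 (fst B) (snd B) + 1) ^ 3).
  pose proof (hnorm_pos (fst B)). pose proof (dist3_pos (fst B) (snd B)).
  (* [K] is [(L * lam) ^ 2] up to the slack [t], and the weight contributes [(L / lam) ^ 3]; the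
     product is [kappa = t * (L ^ 5 / lam) < 1]. A diamond has extent [2 * lam] in both horizontal
     coordinates. *)
  destruct (orbits_stay_out zor (fun x => hnorm x ^ 3) 3 B (t * (L * lam) ^ 2) (t * (L ^ 5 / lam)) bb (2 * lam) (d0 ^ 3) T)
    as (x & N & Ix & HN); try assumption.
  - lia.
  - apply Rmult_lt_0_compat; [lra|]. apply pow_lt. nra.
  - unfold bb. apply pow_lt. lra.
  - lra.
  - now apply pow_lt.
  - intros x Ix. unfold bb. apply pow_incr. split; [apply hnorm_pos|].
    pose proof (hnorm_lip x (fst B)) as H1.
    assert (dist3 x (fst B) <= dist3 (fst B) (snd B)); [|lra].
    rewrite (dist3_sym (fst B)). apply dist3_le; [apply dist3_pos|]. rewrite dist3_sq.
    destruct Ix as (I1 & I2 & I3). apply Rplus_le_compat; [apply Rplus_le_compat|]; apply pow_incr; lra.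
  - intros x Hx. assert (Hx' : d0 < hnorm x).
    { apply Rnot_le_lt. intros Hle. apply (Rlt_irrefl (d0 ^ 3)). apply Rlt_le_trans with (1 := Hx).
      apply pow_incr. split; [apply hnorm_pos|assumption]. }
    exists (hnorm x - d0). split; [lra|]. intros y Hy. pose proof (hnorm_lip x y).
    assert (Hd : d0 < hnorm y) by lra.
    apply Rlt_le_trans with (d0 ^ 2 * hnorm y).
    + replace (d0 ^ 3) with (d0 ^ 2 * d0) by ring. apply Rmult_lt_compat_l; [now apply pow_lt|assumption].
    + replace (hnorm y ^ 3) with (hnorm y ^ 2 * hnorm y) by ring. apply Rmult_le_compat_r; [lra|].
      apply pow_incr; lra.
  - intros x. apply zorich_p3_le; assumption.
  - intros x. pose proof (zorich_hnorm_le x) as H1.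
    assert (H2 : (lam * hnorm (zor x)) ^ 3 <= (L * rad x * hnorm x) ^ 3).
    { apply pow_incr. split; [|assumption]. apply Rmult_le_pos; [lra|apply hnorm_pos]. }
    replace (t * (L * lam) ^ 2 * hnorm (zor x) ^ 3) with (t * L ^ 2 / lam * (lam * hnorm (zor x)) ^ 3) by (field; lra).
    replace (t * (L ^ 5 / lam) * hnorm x ^ 3 * rad x ^ 3) with (t * L ^ 2 / lam * (L * rad x * hnorm x) ^ 3) by (field; lra).
    apply Rmult_le_compat_l; [|assumption]. apply Rle_mult_inv_pos; [|lra]. apply Rmult_le_pos; [lra|apply pow2_ge_0].
  - intros n. destruct (Hdia n) as (k & l & Hkl).
    destruct (diamond_two_beams _ k l Hkl) as [U D].
    destruct (orbit_set_bounded zor B n) as (h & Hh).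
    { intros x. apply zorich_p3_le; assumption. }
    eapply pullback_zorich with (b := h); try eassumption.
    intros x Hx. specialize (Hh x Hx). apply Rabs_le_between in Hh. lra.
  - intros n. destruct (Hdia n) as (k & l & Hkl).
    exists ((IZR k + IZR l) * lam), ((IZR l - IZR k - 1) * lam).
    intros x Hx. destruct (Hkl x Hx). rewrite !plus_IZR in *. lra.
  (* The axis lies in both planes, so the orbit avoids it and must return to the region it was shown
     to have left. *)
  - destruct (Hleave x) with (N := N) as (n & Hn & Hn1 & Hn2).
    { intros n. pose proof (hnorm_pos (Nat.iter n zor x)) as P. destruct P as [P|P]; [assumption|exfalso].
      pose proof (hnorm_sq (Nat.iter n zor x)) as Q. rewrite <- P in Q.
      apply (Hpl n x 1 Ix (or_introl eq_refl)).
      assert (p1 (Nat.iter n zor x) = 0) by nra. assert (p2 (Nat.iter n zor x) = 0) by nra. lra. }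
    apply (HN n Hn). split; [|assumption].
    set (y := Nat.iter n zor x) in *.
    apply Rlt_le_trans with (d0 ^ 2 * hnorm y).
    + replace (d0 ^ 3) with (d0 ^ 2 * d0) by ring. apply Rmult_lt_compat_l; [now apply pow_lt|assumption].
    + replace (hnorm y ^ 3) with (hnorm y ^ 2 * hnorm y) by ring. apply Rmult_le_compat_r; [lra|].
      apply pow_incr; lra.
Qed.

(* The images of the corners of the square are at distance [sqrt 2]. *)
Lemma L_sq_ge_2 : 2 <= L ^ 2.
Proof.
  destruct (Hdiag 1 ltac:(lra)) as [D1 D2].
  assert (Q1 : onbdQ (1, 1)) by (repeat split; cbn [fst snd]; rewrite Rabs_R1; auto; lra).
  assert (R1m : Rabs (- (1)) = 1) by (rewrite Rabs_Ropp; apply Rabs_R1).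
  assert (Q2 : onbdQ (1, - (1))).
  { repeat split; cbn [fst snd]; rewrite ?R1m, ?Rabs_R1; auto; lra. }
  assert (Z1 : p3 (hf (1, 1)) = 0) by (apply hf_bd; try assumption; apply Q1).
  assert (Z2 : p3 (hf (1, - (1))) = 0) by (apply hf_bd; try assumption; apply Q2).
  destruct (hf_sphere _ (proj1 Q1)) as [S1 _]. destruct (hf_sphere _ (proj1 Q2)) as [S2 _].
  destruct (Hbilip _ _ (proj1 Q1) (proj1 Q2)) as [H _].
  assert (H2 : dist2 (1, 1) (1, - (1)) ^ 2 <= (L * dist3 (hf (1, 1)) (hf (1, - (1)))) ^ 2).
  { apply pow_incr. split; [apply dist2_pos|]. rewrite Rmult_comm.
    apply (proj1 (Rle_div_l _ _ L ltac:(lra)) H). }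
  rewrite Rpow_mult_distr, dist2_sq, dist3_sq, Z1, Z2 in H2. cbn [fst snd] in H2.
  rewrite Z1 in S1. rewrite Z2 in S2.
  set (a := p1 (hf (1, 1))) in *. set (a' := p2 (hf (1, 1))) in *.
  set (b := p1 (hf (1, - (1)))) in *. set (b' := p2 (hf (1, - (1)))) in *.
  assert (E : (a - b) ^ 2 + (a' - b') ^ 2 + (0 - 0) ^ 2 = 2).
  { rewrite <- D1. replace b' with (- b) by lra.
    replace ((a - b) ^ 2 + (a - - b) ^ 2 + (0 - 0) ^ 2) with (a ^ 2 + a ^ 2 + (b ^ 2 + b ^ 2)) by ring.
    rewrite <- D1 in S1. replace b' with (- b) in S2 by lra.
    replace ((- b) ^ 2) with (b ^ 2) in S2 by ring. lra. }
  rewrite E in H2. lra.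
Qed.

Lemma planar_ratio : 0 < 2 * L ^ 3 / lam < 1.
Proof.
  pose proof L_sq_ge_2. assert (L3 : 0 < L ^ 3) by (apply pow_lt; lra).
  split; [apply Rdiv_lt_0_compat; lra|]. apply (proj2 (Rlt_div_l (2 * L ^ 3) 1 lam ltac:(lra))).
  replace (L ^ 5) with (L ^ 2 * L ^ 3) in Hlam by ring. nra.
Qed.

Lemma planar_continuous eps : eps = 1 \/ eps = -1 -> contmap (planar eps).
Proof.
  intros He x e Hpos.
  destruct (zorich_continuous (emb eps x) (e / 4) ltac:(lra)) as (d & Hd & H).
  exists (Rmin d (e / 4)). split; [apply Rmin_glb_lt; lra|]. intros y Hy.
  assert (Hy1 : dist3 x y < d) by (apply Rlt_le_trans with (1 := Hy); apply Rmin_l).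
  assert (Hy2 : dist3 x y < e / 4) by (apply Rlt_le_trans with (1 := Hy); apply Rmin_r).
  specialize (H (emb eps y) ltac:(apply Rle_lt_trans with (2 := Hy1); now apply emb_dist_le)).
  eapply Rle_lt_trans; [apply dist3_le_sum|]. unfold planar. proj3.
  rewrite <- Rmult_minus_distr_l, Rabs_mult, (Rabs_pos_eq (sqrt 2)) by (left; apply sqrt2_pos).
  set (u := zor (emb eps x)) in *. set (v := zor (emb eps y)) in *.
  pose proof (dist3_p1 u v). pose proof (dist3_p3 u v). pose proof (dist3_p2 x y).
  assert (S2 : sqrt 2 <= 3 / 2) by (apply sqrt_le_iff; lra).
  pose proof sqrt2_pos. pose proof (Rabs_pos (p1 u - p1 v)). nra.
Qed.

Lemma emb_hnorm eps x : eps = 1 \/ eps = -1 -> hnorm (emb eps x) ^ 2 = p1 x ^ 2.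
Proof.
  intros He. rewrite hnorm_sq. unfold emb. proj3. rewrite Rpow_mult_distr, div_sqrt2_sq.
  replace (eps ^ 2) with 1 by (destruct He as [-> | ->]; ring). field.
Qed.

Lemma emb_planar_iter eps n x : eps = 1 \/ eps = -1 ->
  emb eps (Nat.iter n (planar eps) x) = Nat.iter n zor (emb eps x).
Proof.
  intros He. induction n as [|n IH]; [reflexivity|].
  change (emb eps (planar eps (Nat.iter n (planar eps) x)) = zor (Nat.iter n zor (emb eps x))).
  rewrite <- IH. apply emb_planar; assumption.
Qed.

(** The lines at even multiples of [lam] are mapped to the axis. If the axis is never hit, each
    iterate of the planar box stays between two such lines, that is, in two neighbouring intervals,
    and [pullback_planar] applies. *)
Lemma hits_axis_from_plane (V : R3 -> Prop) p eps : open3 V -> V p -> eps = 1 \/ eps = -1 ->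
  p2 p = eps * p1 p -> exists n x, V x /\ hnorm (Nat.iter n zor x) = 0.
Proof.
  intros HV Vp He Ep. destruct (HV p Vp) as (r & Hr & Hball). assert (Hl : 0 < lam) by lra.
  pose proof sqrt2_pos as Q2.
  set (c := (sqrt 2 * p1 p - r / 4, 0, p3 p - r / 4) : R3).
  (* In the coordinates of [planar]: arclength, a dummy of side 1, and height. *)
  set (B := mkbox c (r / 2) 1 (r / 2)).
  assert (VB : valid B) by (apply mkbox_valid; lra).
  assert (HB : forall x, inb B x -> V (emb eps x)).
  { intros x Ix. apply Hball. unfold B in Ix. rewrite mkbox_inb in Ix. unfold c in Ix. proj3 in Ix.
    assert (Epe : p = emb eps (sqrt 2 * p1 p, p2 x, p3 p)).
    { rewrite (R3_eta p) at 1. unfold emb. proj3.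
      replace (sqrt 2 * p1 p / sqrt 2) with (p1 p) by (field; lra). now rewrite Ep. }
    rewrite Epe. apply Rle_lt_trans with (1 := emb_dist_le eps _ _ He).
    eapply Rle_lt_trans; [apply dist3_le_sum|]. proj3. rewrite Rminus_diag, Rabs_R0.
    assert (Rabs (sqrt 2 * p1 p - p1 x) <= r / 4) by (apply Rabs_le; lra).
    assert (Rabs (p3 p - p3 x) <= r / 4) by (apply Rabs_le; lra). lra. }
  apply NNPP. intros Hno. set (f := planar eps).
  assert (Hax : forall n x, inb B x -> p1 (Nat.iter n f x) <> 0).
  { intros n x Ix E. apply Hno. exists n, (emb eps x). split; [auto|].
    rewrite <- emb_planar_iter by assumption. fold f.
    pose proof (emb_hnorm eps (Nat.iter n f x) He) as Q. rewrite E in Q.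
    pose proof (hnorm_pos (emb eps (Nat.iter n f x))). nra. }
  pose proof (planar_continuous eps He) as Hcont. fold f in Hcont.
  assert (Hstrip : forall n, exists k, forall x, orbit_set f B n x ->
     IZR k * (2 * lam) < p1 x / sqrt 2 < IZR (k + 1) * (2 * lam)).
  { intros n.
    destruct (box_avoids_lattice B (fun x => p1 (Nat.iter n f x) / sqrt 2) (2 * lam) VB ltac:(lra)) as (k & Hk).
    - intros x e Hpos. destruct (contmap_iter f n Hcont x (e * sqrt 2) ltac:(nra)) as (d & Hd & H).
      exists d. split; [assumption|]. intros y Hy. specialize (H y Hy).
      replace (p1 (Nat.iter n f x) / sqrt 2 - p1 (Nat.iter n f y) / sqrt 2)
        with ((p1 (Nat.iter n f x) - p1 (Nat.iter n f y)) / sqrt 2) by (field; lra).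
      unfold Rdiv. rewrite Rabs_mult, (Rabs_pos_eq (/ sqrt 2)) by (left; now apply Rinv_0_lt_compat).
      apply (proj2 (Rlt_div_l _ e (sqrt 2) Q2)). pose proof (dist3_p1 (Nat.iter n f x) (Nat.iter n f y)). lra.
    - intros x k Ix E. apply (Hax (S n) x Ix).
      change (p1 (planar eps (Nat.iter n f x)) = 0). unfold planar. proj3.
      set (y := Nat.iter n f x) in *.
      assert (E1 : p1 y / sqrt 2 = unf lam k 0) by (unfold unf; rewrite E; ring).
      assert (E2 : exists k', eps * (p1 y / sqrt 2) = unf lam k' 0).
      { destruct He as [-> | ->]; [exists k|exists (- k)%Z]; rewrite E; unfold unf; rewrite ?opp_IZR; ring. }
      destruct E2 as (k' & E2). unfold emb. rewrite E2, E1, zorich_unf by (assumption || apply inQ_0).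
      proj3. rewrite hf_0 by assumption. proj3. ring.
    - exists k. intros x (u & Iu & ->). apply Hk; assumption. }
  pose proof planar_ratio as Hq. destruct (ratio_slack _ Hq) as (t & Ht & Htk).
  destruct leaves_axis as (T & HT & Hleave).
  set (d0 := lam / (2 * L)) in *. assert (Hd0 : 0 < d0) by (apply Rdiv_lt_0_compat; lra).
  assert (Hrad : forall x, rad (emb eps x) = rad x) by reflexivity.
  assert (Hp3 : forall x, Rabs (p3 (f x)) <= rad x).
  { intros x. rewrite <- Hrad. unfold f, planar. proj3. apply zorich_p3_le; assumption. }
  (* Here [K] is [2 * L * lam] up to [t] and the weight contributes [(L / lam) ^ 2], which gives
     [2 * L ^ 3 / lam]. The width [4 * lam] bounds [sqrt 2 * (2 * lam)] and the dummy side. *)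
  destruct (orbits_stay_out f (fun x => p1 x ^ 2) 2 B (t * (2 * (L * lam))) (t * (2 * L ^ 3 / lam))
     ((Rabs (sqrt 2 * p1 p) + r) ^ 2) (4 * lam) (d0 ^ 2) T) as (x & N & Ix & HN); try assumption.
  - lia.
  - apply Rmult_lt_0_compat; nra.
  - apply pow_lt. pose proof (Rabs_pos (sqrt 2 * p1 p)). lra.
  - lra.
  - now apply pow_lt.
  - intros x Ix. rewrite <- pow2_abs. apply pow_incr. split; [apply Rabs_pos|].
    unfold B in Ix. rewrite mkbox_inb in Ix. unfold c in Ix. proj3 in Ix.
    pose proof (Rle_abs (sqrt 2 * p1 p)). pose proof (Rle_abs (- (sqrt 2 * p1 p))). rewrite Rabs_Ropp in *.
    apply Rabs_le. lra.
  - intros x Hx. assert (Hx' : d0 < Rabs (p1 x)).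
    { apply Rnot_le_lt. intros Hle. apply (Rlt_irrefl (d0 ^ 2)). apply Rlt_le_trans with (1 := Hx).
      rewrite <- (pow2_abs (p1 x)). apply pow_incr. split; [apply Rabs_pos|assumption]. }
    exists (Rabs (p1 x) - d0). split; [lra|]. intros y Hy. pose proof (dist3_p1 x y).
    pose proof (Rabs_triang_inv (p1 x) (p1 y)). rewrite <- (pow2_abs (p1 y)). nra.
  - intros x. unfold f at 1, planar. proj3.
    pose proof (zorich_hnorm_le (emb eps x)) as H1.
    rewrite Hrad in H1.
    assert (H2 : (lam * hnorm (zor (emb eps x))) ^ 2 <= (L * rad x * hnorm (emb eps x)) ^ 2).
    { apply pow_incr. split; [|assumption]. apply Rmult_le_pos; [lra|apply hnorm_pos]. }
    rewrite !Rpow_mult_distr, emb_hnorm in H2 by assumption.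
    rewrite <- emb_planar in H2 by assumption.
    rewrite emb_hnorm in H2 by assumption. unfold planar in H2. proj3 in H2.
    set (u := (sqrt 2 * p1 (zor (emb eps x))) ^ 2) in *.
    replace (t * (2 * (L * lam)) * u) with (t * (2 * L / lam) * (lam ^ 2 * u)) by (field; lra).
    replace (t * (2 * L ^ 3 / lam) * p1 x ^ 2 * rad x ^ 2)
      with (t * (2 * L / lam) * (L ^ 2 * rad x ^ 2 * p1 x ^ 2)) by (field; lra).
    apply Rmult_le_compat_l; [|assumption]. apply Rmult_le_pos; [lra|]. apply Rle_mult_inv_pos; lra.
  - intros n. destruct (Hstrip n) as (k & Hk). destruct (orbit_set_bounded f B n Hp3) as (h & Hh).
    eapply pullback_planar with (b := h) (k0 := k); try eassumption.
    + intros x Hx. specialize (Hh x Hx). apply Rabs_le_between in Hh. lra.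
    + intros x Hx. specialize (Hk x Hx). rewrite plus_IZR in Hk.
      assert (Qe : forall a, Rabs a <= 1 -> inQ (a, eps * a)).
      { intros a Ha. split; cbn [fst snd]; [assumption|]. destruct He as [-> | ->].
        - now rewrite Rmult_1_l.
        - replace (-1 * a) with (- a) by ring. now rewrite Rabs_Ropp. }
      destruct (interval_rep lam (p1 x / sqrt 2) k Hl) as [(a & Ha & E & _)|(a & Ha & E)].
      * apply Rabs_lt_between. lra.
      * exists a. auto.
      * exists a. split; [apply Qe; lra|auto].
  - intros n. destruct (Hstrip n) as (k & Hk). exists (sqrt 2 * (IZR k * (2 * lam))), 0.
    intros x Hx. pose proof (Hk x Hx) as Hkx. rewrite plus_IZR in Hkx. split.
    + assert (E : p1 x = sqrt 2 * (p1 x / sqrt 2)) by (field; lra).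
      assert (S2 : sqrt 2 <= 2) by (apply sqrt_le_iff; lra).
      set (q := p1 x / sqrt 2) in *. rewrite E. nra.
    + assert (E2 : forall n v, p2 (Nat.iter n f v) = p2 v).
      { clear. intros n v. induction n as [|n IH]; [reflexivity|]. rewrite <- IH. reflexivity. }
      destruct Hx as (v & Iv & ->). rewrite E2. unfold B in Iv. rewrite mkbox_inb in Iv. unfold c in Iv. proj3 in Iv. lra.
  - destruct (Hleave (emb eps x)) with (N := N) as (n & Hn & Hn1 & Hn2).
    { intros n. pose proof (hnorm_pos (Nat.iter n zor (emb eps x))) as P. destruct P as [P|P]; [assumption|exfalso].
      apply Hno. exists n, (emb eps x). auto. }
    rewrite <- emb_planar_iter in Hn1, Hn2 by assumption. fold f in Hn1, Hn2.
    apply (HN n Hn). split; [|exact Hn2].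
    rewrite <- (emb_hnorm eps) by assumption. nra.
Qed.

Lemma hits_axis (V : R3 -> Prop) : open3 V -> (exists v, V v) ->
  exists n x, V x /\ hnorm (Nat.iter n zor x) = 0.
Proof.
  intros HV Hne.
  destruct (hits_planes V HV Hne) as (n & x & eps & Vx & He & E).
  pose proof (zorich_iter_open V n HV) as HU.
  destruct (hits_axis_from_plane _ (Nat.iter n zor x) eps HU) as (m & y & (w & Vw & <-) & Hy); try assumption.
  - now exists x.
  - exists (m + n)%nat, w. split; [assumption|]. now rewrite Nat.iter_add.
Qed.

(** * From the axis to the whole space *)

Definition cyl (a r : R) (x : R3) : Prop := hnorm x <= r /\ Rabs (p3 x - a) <= r.

(** Around the axis the inverse branch into the central beam contracts roughly by [lam * L / a'],
    with [a'] the height of the image; the 8 leaves room for distortion over the cylinder. *)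
Lemma cylinder_image a r : 0 < r <= 1 -> forall y,
  cyl (nu * exp a * lam) (nu * exp a * lam * r / (8 * lam * L)) y ->
  exists x, cyl a r x /\ zor x = y.
Proof.
  intros Hr y [Y1 Y2]. assert (Hl : 0 < lam) by lra.
  pose proof (exp_pos a) as Ea. set (a' := nu * exp a * lam) in *.
  assert (Ha' : 0 < a') by (unfold a'; apply Rmult_lt_0_compat; nra).
  set (r' := a' * r / (8 * lam * L)) in *.
  assert (HlL : 1 <= lam * L) by nra.
  assert (Er' : r' * (8 * (lam * L)) = a' * r) by (unfold r'; field; lra).
  assert (Hr'0 : 0 < r') by (unfold r'; apply Rdiv_lt_0_compat; nra).
  assert (Hr' : 8 * r' <= a' * r) by nra.
  assert (Hr'' : 8 * r' <= a') by nra.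
  apply Rabs_le_between in Y2.
  assert (Hy3 : 7 / 8 * a' <= p3 y) by lra.
  set (n := norm3 y).
  assert (Hn1 : p3 y <= n) by (apply Rle_trans with (2 := norm3_p3 y); apply Rle_abs).
  assert (Hn2 : n <= a' + 2 * r').
  { unfold n. pose proof (norm3_hnorm y) as H. rewrite (Rabs_pos_eq (p3 y)) in H by lra. lra. }
  assert (Hn0 : 0 < n) by lra.
  set (t := theta y).
  exists (unf lam 0 (fst t), unf lam 0 (snd t), ln (n / (nu * lam))). split.
  - assert (U0 : forall s, unf lam 0 s = lam * s) by (intros; unfold unf, sgnZ; simpl; ring).
    split.
    + destruct (theta_spec y Hn0) as [Q E]. fold t in Q, E.
      destruct (Hbilip t (0, 0) Q inQ_0) as [H _]. rewrite E, hf_0 in H by assumption.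
      pose proof (dist2_pos t (0, 0)) as P.
      assert (H2 : dist2 t (0, 0) ^ 2 <= (L * dist3 (dirup y) (0, 0, 1)) ^ 2).
      { apply pow_incr. split; [assumption|]. rewrite Rmult_comm. apply (proj1 (Rle_div_l _ _ L ltac:(lra)) H). }
      rewrite Rpow_mult_distr, dist2_sq, dist3_sq in H2. unfold dirup in H2. proj3 in H2. cbn [fst snd] in H2.
      rewrite (Rabs_pos_eq (p3 y)), !Rminus_0_r in H2 by lra. fold n in H2.
      pose proof (norm3_sq y) as En. fold n in En. pose proof (hnorm_sq y) as Eh.
      set (h := hnorm y) in *. assert (0 <= h) by apply hnorm_pos.
      assert (E2 : (p1 y / n) ^ 2 + (p2 y / n) ^ 2 = h ^ 2 / n ^ 2) by (rewrite Eh; field; lra).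
      assert (E3 : (p3 y / n) ^ 2 = 1 - h ^ 2 / n ^ 2).
      { replace (h ^ 2) with (n ^ 2 - p3 y ^ 2) by lra. field. lra. }
      set (w := p3 y / n) in *.
      assert (W : 0 <= w <= 1).
      { unfold w. split; [apply Rle_mult_inv_pos; lra|]. apply (proj2 (Rle_div_l (p3 y) 1 n Hn0)). lra. }
      assert (H3 : fst t ^ 2 + snd t ^ 2 <= L ^ 2 * (2 * (h ^ 2 / n ^ 2))).
      { apply Rle_trans with (1 := H2). apply Rmult_le_compat_l; [apply pow2_ge_0|]. rewrite E2. nra. }
      apply pow2_le_inv; [lra|]. rewrite hnorm_sq. proj3. rewrite !U0, !Rpow_mult_distr, <- Rmult_plus_distr_l.
      apply Rle_trans with (lam ^ 2 * (L ^ 2 * (2 * (h ^ 2 / n ^ 2)))); [apply Rmult_le_compat_l; [apply pow2_ge_0|assumption]|].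
      replace (lam ^ 2 * (L ^ 2 * (2 * (h ^ 2 / n ^ 2)))) with (2 * (lam * L * h / n) ^ 2) by (field; lra).
      assert (Hq : 0 <= lam * L * h / n <= r / 7).
      { split; [apply Rle_mult_inv_pos; [|lra]; apply Rmult_le_pos; lra|].
        apply (proj2 (Rle_div_l (lam * L * h) (r / 7) n Hn0)).
        assert (lam * L * h <= lam * L * r') by (apply Rmult_le_compat_l; lra).
        assert (r / 7 * (7 / 8 * a') <= r / 7 * n) by (apply Rmult_le_compat_l; lra). lra. }
      set (q := lam * L * h / n) in *. assert (q ^ 2 <= (r / 7) ^ 2) by (apply pow_incr; lra).
      pose proof (pow2_ge_0 r). replace ((r / 7) ^ 2) with (r ^ 2 / 49) in * by field. lra.
    + proj3. assert (Eln : ln (n / (nu * lam)) - a = ln (n / a')).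
      { rewrite !ln_div by nra. unfold a'. replace (nu * exp a * lam) with (nu * lam * exp a) by ring.
        rewrite (ln_mult (nu * lam) (exp a)), ln_exp by nra. ring. }
      rewrite Eln. apply Rabs_le. split.
      * replace (n / a') with (/ (a' / n)) by (field; lra). rewrite ln_Rinv by (apply Rdiv_lt_0_compat; lra).
        pose proof (ln_le_sub1 (a' / n) ltac:(apply Rdiv_lt_0_compat; lra)) as H.
        assert (a' / n - 1 <= r); [|lra].
        replace (a' / n - 1) with ((a' - n) / n) by (field; lra).
        apply (proj2 (Rle_div_l (a' - n) r n Hn0)). nra.
      * apply Rle_trans with (1 := ln_le_sub1 (n / a') ltac:(apply Rdiv_lt_0_compat; lra)).
        replace (n / a' - 1) with ((n - a') / a') by (field; lra).
        apply (proj2 (Rle_div_l (n - a') r a' Ha')). nra.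
  - apply zorich_preimage; [exact Hn0|].
    rewrite Rabs_pos_eq by lra. unfold sgnZ; simpl. lra.
Qed.

Lemma axis_step z : hnorm z = 0 -> hnorm (zor z) = 0 /\ p3 (zor z) = rad z.
Proof.
  intros Hz. pose proof (zorich_hnorm_le z) as H1.
  rewrite Hz, Rmult_0_r in H1. pose proof (hnorm_pos (zor z)) as H2.
  assert (H0 : hnorm (zor z) = 0) by nra. split; [assumption|].
  destruct (zorich_near_axis z) as [_ H3].
  { rewrite Hz. apply Rle_mult_inv_pos; lra. }
  pose proof (zorich_norm z) as E.
  pose proof (rad_pos z). pose proof (norm3_hnorm (zor z)) as H4. rewrite H0 in H4.
  pose proof (norm3_p3 (zor z)) as H5. unfold rad in *. rewrite E in *.
  rewrite (Rabs_pos_eq (p3 _)) in * by lra. lra.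
Qed.

(** The initial height is arbitrary, possibly very negative; from the first image on it is positive
    and grows by [rad_ge]. Hence the exception [n = 0] and the [- 1]. *)
Lemma axis_orbit z n : hnorm z = 0 -> hnorm (Nat.iter n zor z) = 0 /\ (INR n - 1 <= p3 (Nat.iter n zor z) \/ n = 0%nat).
Proof.
  intros Hz. induction n as [|n [IH1 IH2]]; [auto|].
  change (Nat.iter (S n) zor z) with (zor (Nat.iter n zor z)).
  destruct (axis_step _ IH1) as [A1 A2]. split; [assumption|left]. rewrite A2.
  pose proof (rad_ge (Nat.iter n zor z)) as H.
  pose proof (rad_pos (Nat.iter n zor z)). rewrite S_INR.
  destruct IH2 as [IH2| ->]; [|change (INR 0) with 0; lra]. pose proof (pos_INR n).
  destruct (Rle_lt_dec (INR n) 0); lra.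
Qed.

(** High up on the axis each step at least doubles the radius, as long as it is at most 1, the range
    of [cylinder_image]. Once radius 1 is reached, a single step from a sufficiently high point
    produces any radius. *)
Lemma large_cylinders (U : R3 -> Prop) z : open3 U -> U z -> hnorm z = 0 -> forall A R,
  exists n a, A <= a /\ forall y, cyl a R y -> exists x, U x /\ Nat.iter n zor x = y.
Proof.
  intros HU Uz Hz A R0.
  assert (HlL : 1 <= lam * L) by nra.
  (* Above height [12 * (lam * L)] the next height is at least [16 * (lam * L)] by [rad_ge], so the
     factor in [cylinder_image] is at least 2. *)
  destruct (INR_large (12 * (lam * L) + 1)) as (n1 & N1 & N1').
  destruct (axis_orbit z n1 Hz) as [O1 [O2|O2]]; [|lia].
  set (c := Nat.iter n1 zor z) in *.
  pose proof (zorich_iter_open U n1 HU) as HUo.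
  destruct (HUo c) as (r0 & Hr0 & Hball); [now exists z|].
  set (r := Rmin 1 (r0 / 4)).
  assert (Hr : 0 < r) by (unfold r; apply Rmin_glb_lt; lra).
  assert (Hstart : forall y, cyl (p3 c) r y -> exists x, U x /\ Nat.iter n1 zor x = y).
  { intros y [Y1 Y2]. apply Hball. assert (r <= r0 / 4) by apply Rmin_r.
    eapply Rle_lt_trans; [apply dist3_le_sum|].
    pose proof (hnorm_sq c) as Ec. rewrite O1 in Ec. pose proof (hnorm_sq y) as Ey.
    pose proof (pow2_ge_0 (p1 c)). pose proof (pow2_ge_0 (p2 c)).
    assert (C1 : p1 c = 0) by (apply Rsqr_0_uniq; unfold Rsqr; simpl in *; lra).
    assert (C2 : p2 c = 0) by (apply Rsqr_0_uniq; unfold Rsqr; simpl in *; lra).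
    rewrite C1, C2. pose proof (hnorm_pos y).
    assert (Rabs (0 - p1 y) <= hnorm y) by (apply Rabs_le_of_sq; [assumption|]; rewrite Ey; nra).
    assert (Rabs (0 - p2 y) <= hnorm y) by (apply Rabs_le_of_sq; [assumption|]; rewrite Ey; nra).
    rewrite Rabs_minus_sym in Y2. lra. }
  assert (Hgrow : forall n a r, 0 < r <= 1 -> (forall y, cyl a r y -> exists x, U x /\ Nat.iter n zor x = y) ->
    forall y, cyl (nu * exp a * lam) (nu * exp a * lam * r / (8 * lam * L)) y -> exists x, U x /\ Nat.iter (S n) zor x = y).
  { intros n a s Hs H y Hy. destruct (cylinder_image a s Hs y Hy) as (w & Hw & <-).
    destruct (H w Hw) as (x & Ux & <-). now exists x. }
  assert (Hexp : forall a, 4 / 3 * (1 + a) <= nu * exp a * lam).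
  { intros a. exact (rad_ge (0, 0, a)). }
  assert (Hj : forall j, exists a, 12 * (lam * L) + INR j <= a /\
    forall y, cyl a (Rmin 1 (2 ^ j * r)) y -> exists x, U x /\ Nat.iter (j + n1) zor x = y).
  { induction j as [|j (a & Ha & IH)].
    - exists (p3 c). split; [simpl; lra|]. intros y Hy. apply Hstart. destruct Hy as [Y1 Y2].
      assert (Rmin 1 (2 ^ 0 * r) <= r) by (eapply Rle_trans; [apply Rmin_r|simpl; lra]). split; lra.
    - assert (P2 : 0 < 2 ^ j) by (apply pow_lt; lra). pose proof (pos_INR j) as Pj.
      exists (nu * exp a * lam). specialize (Hexp a). split; [rewrite S_INR; lra|].
      set (s := Rmin 1 (2 ^ j * r)) in *.
      assert (Hs : 0 < s <= 1) by (unfold s; split; [apply Rmin_glb_lt; nra|apply Rmin_l]).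
      assert (Hs2 : Rmin 1 (2 ^ S j * r) <= 2 * s).
      { unfold s. simpl pow. unfold Rmin. repeat destruct (Rle_dec _ _); nra. }
      intros y [Y1 Y2]. apply (Hgrow (j + n1)%nat a s Hs IH y).
      assert (2 * s <= nu * exp a * lam * s / (8 * lam * L)).
      { apply (proj1 (Rle_div_r (2 * s) (nu * exp a * lam * s) (8 * lam * L) ltac:(nra))). nra. }
      split; lra. }
  (* [J1] steps bring the radius to 1; [J2] further ones raise the height until the last image has
     height at least [A] and radius at least [R0]. *)
  destruct (INR_large (1 / r)) as (J1 & _ & HJ1).
  destruct (INR_large (Rmax A (8 * lam * L * R0))) as (J2 & _ & HJ2).
  destruct (Hj (J1 + J2)%nat) as (a & Ha & Hc). rewrite plus_INR in Ha.
  pose proof (pos_INR J1) as PJ1. pose proof (pos_INR J2) as PJ2.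
  assert (Hone : Rmin 1 (2 ^ (J1 + J2) * r) = 1).
  { apply Rmin_left. apply Rle_trans with (INR J1 * r).
    - assert (1 < INR J1 * r) by (apply (Rlt_div_l 1 (INR J1) r Hr); lra). lra.
    - apply Rmult_le_compat_r; [lra|]. apply Rle_trans with (2 ^ J1).
      + clear. induction J1 as [|j IH]; [simpl; lra|]. rewrite S_INR. simpl.
        assert (1 <= 2 ^ j) by (apply pow_R1_Rle; lra). lra.
      + apply Rle_pow; [lra|lia]. }
  rewrite Hone in Hc. specialize (Hexp a).
  exists (S (J1 + J2 + n1)), (nu * exp a * lam).
  pose proof (Rmax_l A (8 * lam * L * R0)). pose proof (Rmax_r A (8 * lam * L * R0)).
  split; [lra|]. intros y [Y1 Y2]. apply (Hgrow _ a 1 ltac:(lra) Hc y).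
  assert (R0 <= nu * exp a * lam * 1 / (8 * lam * L)).
  { apply (proj1 (Rle_div_r R0 (nu * exp a * lam * 1) (8 * lam * L) ltac:(nra))). lra. }
  split; lra.
Qed.

(** The point [y] has preimages [x] at one fixed height in beams arbitrarily far out. One is chosen
    whose norm is close to [nu * exp a * lam]; then a preimage [w] of [x] has height close to [a]
    and lies near the axis, inside the cylinder. *)
Lemma axis_covers (U : R3 -> Prop) z : open3 U -> U z -> hnorm z = 0 -> forall y, y <> origin3 ->
  exists n x, U x /\ Nat.iter n zor x = y.
Proof.
  intros HU Uz Hz y Hy. apply norm3_origin in Hy. assert (Hl : 0 < lam) by lra.
  (* [C] bounds the deviation of [norm3 x] from [rho]: [5 * lam] and [lam] from the horizontal
     coordinates, [Rabs eta] from the height. *)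
  set (eta := ln (norm3 y / (nu * lam))). set (C := 6 * lam + Rabs eta).
  pose proof (Rabs_pos eta) as Peta.
  destruct (large_cylinders U z HU Uz Hz (2 * C) (4 * lam)) as (n & a & Ha & Hcyl).
  set (rho := nu * exp a * lam).
  assert (Hrho : 2 * C <= rho).
  { pose proof (rad_ge (0, 0, a)) as H. unfold rad in H. proj3 in H.
    fold rho in H. unfold C in *. lra. }
  (* The beam index is [2 * k + e]: [4 * k * lam] approximates [rho], and [e] adjusts the parity to
     the sign of [p3 y]. *)
  destruct (sign_index (p3 y)) as (e & He & Se).
  destruct (base_Int_part (rho / (4 * lam))) as [K1 K2]. set (k := Int_part (rho / (4 * lam))) in *.
  assert (Ek : rho / (4 * lam) * (4 * lam) = rho) by (field; lra).
  assert (Kb : rho - 4 * lam <= 4 * IZR k * lam <= rho).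
  { set (q := rho / (4 * lam)) in *. nra. }
  set (t := theta y). destruct (theta_spec y Hy) as [[Qt1 Qt2] _]. fold t in Qt1, Qt2.
  set (x := (unf lam (2 * k + e) (fst t), unf lam 0 (snd t), eta) : R3).
  assert (Zx : zor x = y).
  { apply zorich_preimage; [assumption|].
    rewrite sgnZ_add, sgnZ_double. replace (sgnZ 0) with 1 by reflexivity. rewrite Rmult_1_l, Rmult_1_r. exact Se. }
  assert (Hx1 : Rabs (p1 x - rho) <= 5 * lam).
  { pose proof (unf_bound lam (2 * k + e) _ Hl Qt1) as H. unfold x. proj3.
    rewrite plus_IZR, mult_IZR in H. apply Rabs_le_between in H. apply Rabs_le.
    destruct He as [-> | ->]; lra. }
  assert (Hx2 : Rabs (p2 x) <= lam).
  { pose proof (unf_bound lam 0 _ Hl Qt2) as H. unfold x. proj3.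
    now replace (unf lam 0 (snd t) - 2 * 0 * lam) with (unf lam 0 (snd t)) in H by ring. }
  assert (Hnx : rho - C <= norm3 x <= rho + C).
  { pose proof (norm3_p1 x). pose proof (norm3_le_sum x). pose proof (Rle_abs (p1 x)).
    apply Rabs_le_between in Hx1. rewrite (Rabs_pos_eq (p1 x)) in * by (unfold C in *; lra).
    assert (p3 x = eta) as E by reflexivity. rewrite E in *. unfold C in *. lra. }
  assert (Hx0 : 0 < norm3 x) by (unfold C in *; lra).
  destruct (sign_index (p3 x)) as (e' & He' & Se').
  set (t' := theta x). destruct (theta_spec x Hx0) as [[Qx1 Qx2] _]. fold t' in Qx1, Qx2.
  set (w := (unf lam e' (fst t'), unf lam 0 (snd t'), ln (norm3 x / (nu * lam))) : R3).
  assert (Zw : zor w = x).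
  { apply zorich_preimage; [assumption|].
    replace (sgnZ 0) with 1 by reflexivity. rewrite Rmult_1_r. exact Se'. }
  destruct (Hcyl w) as (v & Uv & Ev).
  - split.
    + apply Rle_trans with (1 := hnorm_le_sum w). unfold w. proj3.
      pose proof (unf_bound lam e' _ Hl Qx1) as H1. pose proof (unf_bound lam 0 _ Hl Qx2) as H2.
      replace (unf lam 0 (snd t') - 2 * 0 * lam) with (unf lam 0 (snd t')) in H2 by ring.
      assert (Rabs (unf lam e' (fst t')) <= 3 * lam); [|lra].
      apply Rabs_le_between in H1. apply Rabs_le. destruct He' as [-> | ->]; lra.
    + assert (Rabs (p3 w - a) <= 1); [|lra]. unfold w. proj3.
      assert (Hrho0 : 0 < rho) by (unfold C in *; lra).
      assert (Eln : ln (norm3 x / (nu * lam)) - a = ln (norm3 x / rho)).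
      { rewrite !ln_div by nra. unfold rho. replace (nu * exp a * lam) with (nu * lam * exp a) by ring.
        pose proof (exp_pos a). rewrite (ln_mult (nu * lam) (exp a)), ln_exp by nra. ring. }
      rewrite Eln. apply Rabs_le. split.
      * replace (norm3 x / rho) with (/ (rho / norm3 x)) by (field; lra).
        rewrite ln_Rinv by (apply Rdiv_lt_0_compat; lra).
        pose proof (ln_le_sub1 (rho / norm3 x) ltac:(apply Rdiv_lt_0_compat; lra)).
        assert (rho / norm3 x <= 2); [|lra]. apply (proj2 (Rle_div_l rho 2 (norm3 x) Hx0)). lra.
      * apply Rle_trans with (1 := ln_le_sub1 (norm3 x / rho) ltac:(apply Rdiv_lt_0_compat; lra)).
        assert (norm3 x / rho <= 2); [|lra]. apply (proj2 (Rle_div_l (norm3 x) 2 rho Hrho0)). lra.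
  - exists (S (S n)), v. split; [assumption|].
    change (zor (zor (Nat.iter n zor v)) = y). now rewrite Ev, Zw.
Qed.


Lemma blow_up (V : R3 -> Prop) : open3 V -> (exists v, V v) -> forall y, y <> origin3 ->
  exists n x, V x /\ Nat.iter n zor x = y.
Proof.
  intros HV Hne y Hy.
  destruct (hits_axis V HV Hne) as (n & x & Vx & Hx).
  pose proof (zorich_iter_open V n HV) as HU.
  destruct (axis_covers _ (Nat.iter n zor x) HU) with (y := y) as (m & w & (v & Vv & <-) & E); try assumption.
  - now exists x.
  - exists (m + n)%nat, v. split; [assumption|]. rewrite Nat.iter_add. exact E.
Qed.

(** The Julia set counts iterates from the first one on; covering is therefore applied to the open
    set of images of [U]. *)
Lemma iterates_cover (U : R3 -> Prop) x : open3 U -> U x -> forall y, y <> origin3 ->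
  exists (k : nat) z, (1 <= k)%nat /\ U z /\ Nat.iter k zor z = y.
Proof.
  intros HU Ux y Hy.
  pose proof (zorich_image_open U HU) as HU'.
  destruct (blow_up _ HU') with (y := y) as (n & w & (v & Uv & <-) & E); [exists (zor x), x; now split|assumption|].
  exists (n + 1)%nat, v. split; [lia|]. split; [assumption|]. rewrite Nat.iter_add. exact E.
Qed.

End Zorich.

(** * Points have zero capacity *)

(** The classical function [exp (- / x)], flat at 0, with powers of [/ x] included so that
    derivatives are linear combinations within the family. *)
Definition flat (k : nat) (x : R) : R :=
  if Rlt_dec 0 x then (/ x) ^ k * exp (- / x) else 0.

Lemma exp_ge_pow (z : R) (n : nat) : 0 <= z -> z ^ n / INR (fact n) <= exp z.
Proof.
  intros Hz. apply Rle_trans with (2 := exp_ge_taylor z n Hz).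
  destruct n as [|n]; [simpl; lra|]. rewrite tech5.
  assert (0 <= sum_f_R0 (fun k => z ^ k / INR (fact k)) n); [|lra].
  apply cond_pos_sum. intros k. apply Rle_mult_inv_pos; [now apply pow_le|apply INR_fact_lt_0].
Qed.

Lemma flat_pos k x : 0 < x -> flat k x = (/ x) ^ k * exp (- / x).
Proof. intros H. unfold flat. now destruct (Rlt_dec 0 x). Qed.

Lemma flat_neg k x : x <= 0 -> flat k x = 0.
Proof. intros H. unfold flat. destruct (Rlt_dec 0 x); [lra|reflexivity]. Qed.

Lemma flat_nonneg k x : 0 <= flat k x.
Proof.
  unfold flat. destruct (Rlt_dec 0 x); [|lra].
  apply Rmult_le_pos; [apply pow_le; left; now apply Rinv_0_lt_compat|left; apply exp_pos].
Qed.

Lemma flat_bound k x : flat k x <= INR (fact k).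
Proof.
  pose proof (INR_fact_lt_0 k) as F. unfold flat. destruct (Rlt_dec 0 x) as [H|H]; [|lra].
  assert (Hz : 0 < / x) by now apply Rinv_0_lt_compat. set (z := / x) in *.
  pose proof (exp_ge_pow z k ltac:(lra)) as E. rewrite exp_Ropp. pose proof (exp_pos z).
  apply (proj2 (Rle_div_l (z ^ k) (INR (fact k)) (exp z) H0)).
  apply (proj1 (Rle_div_l (z ^ k) (exp z) (INR (fact k)) F)) in E. lra.
Qed.

(** At 0 the difference quotient for [h > 0] equals [h * flat (S (S k)) h], and [flat (S (S k))] is
    bounded. *)
Lemma flat_derive k x : is_derive (flat k) x (- INR k * flat (S k) x + flat (S (S k)) x).
Proof.
  destruct (Rtotal_order x 0) as [H|[->|H]].
  - apply is_derive_ext_loc with (fun _ => 0).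
    + exists (mkposreal (- x) ltac:(lra)). intros y Hy. symmetry. apply flat_neg.
      apply Rabs_lt_between in Hy. simpl in Hy. unfold minus, plus, opp in Hy; simpl in Hy. lra.
    + rewrite !flat_neg by lra. replace (- INR k * 0 + 0) with 0 by ring. apply is_derive_Reals, derivable_pt_lim_const.
  - rewrite !(flat_neg _ 0) by lra. replace (- INR k * 0 + 0) with 0 by ring.
    apply is_derive_Reals. intros e He. pose proof (INR_fact_lt_0 (S (S k))) as F.
    set (c := INR (fact (S (S k)))) in *.
    assert (Hd : 0 < e / c) by now apply Rdiv_lt_0_compat.
    exists (mkposreal _ Hd). intros h Hh Hhd. simpl in Hhd. rewrite Rplus_0_l, (flat_neg _ 0), !Rminus_0_r by lra.
    destruct (Rle_lt_dec h 0) as [H|H].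
    + rewrite flat_neg by assumption. unfold Rdiv. rewrite Rmult_0_l, Rabs_R0. assumption.
    + rewrite Rabs_pos_eq in Hhd by lra.
      assert (E : flat k h / h = h * flat (S (S k)) h).
      { rewrite !flat_pos by assumption. simpl. field. lra. }
      rewrite E, Rabs_pos_eq by (apply Rmult_le_pos; [lra|apply flat_nonneg]).
      apply Rle_lt_trans with (h * c).
      * apply Rmult_le_compat_l; [lra|apply flat_bound].
      * replace e with (e / c * c) by (field; lra). apply Rmult_lt_compat_r; lra.
  - apply is_derive_ext_loc with (fun y => (/ y) ^ k * exp (- / y)).
    + exists (mkposreal x H). intros y Hy. symmetry. apply flat_pos.
      apply Rabs_lt_between in Hy. simpl in Hy. unfold minus, plus, opp in Hy; simpl in Hy. lra.
    + rewrite !flat_pos by assumption. auto_derive; [lra|]. destruct k as [|k].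
      * simpl. field. lra.
      * simpl pred. rewrite S_INR. simpl. field. lra.
Qed.

(** * Smooth functions of three variables *)

Definition co (i : coord) (x : R3) : R := match i with Defs.C1 => p1 x | Defs.C2 => p2 x | Defs.C3 => p3 x end.
Definition upd (i : coord) (x : R3) (t : R) : R3 :=
  match i with Defs.C1 => (t, p2 x, p3 x) | Defs.C2 => (p1 x, t, p3 x) | Defs.C3 => (p1 x, p2 x, t) end.

Lemma upd_co i x : upd i x (co i x) = x.
Proof. destruct x as [[a b] c]. now destruct i. Qed.

Definition isd (i : coord) (u : R3 -> R) (x : R3) (d : R) : Prop :=
  is_derive (fun t => u (upd i x t)) (co i x) d.

Lemma isd_pd i u x d : isd i u x d -> ex_pd i u x /\ pd i u x = d.
Proof.
  intros H. unfold isd in H. split.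
  - destruct i; exists d; exact H.
  - destruct i; apply is_derive_unique; exact H.
Qed.

Lemma isd_const i c x : isd i (fun _ => c) x 0.
Proof. apply is_derive_Reals, derivable_pt_lim_const. Qed.

Lemma isd_plus i u v x a b : isd i u x a -> isd i v x b -> isd i (fun y => u y + v y) x (a + b).
Proof. unfold isd. rewrite !is_derive_Reals. apply derivable_pt_lim_plus. Qed.

Lemma isd_mult i u v x a b : isd i u x a -> isd i v x b ->
  isd i (fun y => u y * v y) x (a * v x + u x * b).
Proof.
  unfold isd. rewrite !is_derive_Reals. intros Hu Hv.
  pose proof (derivable_pt_lim_mult _ _ _ _ _ Hu Hv) as H. cbv beta in H. rewrite upd_co in H. exact H.
Qed.

Lemma isd_comp i (g : R -> R) u x a b : isd i u x a -> is_derive g (u x) b ->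
  isd i (fun y => g (u y)) x (b * a).
Proof.
  unfold isd. rewrite !is_derive_Reals. intros Hu Hg.
  apply (derivable_pt_lim_comp (fun t => u (upd i x t)) g); [assumption|]. cbv beta. now rewrite upd_co.
Qed.

Lemma isd_coord i j x : isd i (co j) x (match i, j with Defs.C1, Defs.C1 | Defs.C2, Defs.C2 | Defs.C3, Defs.C3 => 1 | _, _ => 0 end).
Proof.
  unfold isd. rewrite is_derive_Reals.
  destruct i, j; first [apply derivable_pt_lim_id | apply derivable_pt_lim_const].
Qed.

Lemma cont3_const c x : cont3 (fun _ => c) x.
Proof. intros e He. exists 1. split; [lra|]. intros. now rewrite Rminus_diag, Rabs_R0. Qed.

Lemma cont3_coord i x : cont3 (co i) x.
Proof.
  intros e He. exists e. split; [assumption|]. intros y Hy. rewrite dist3_sym in Hy.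
  apply Rle_lt_trans with (2 := Hy). destruct i; [apply dist3_p1|apply dist3_p2|apply dist3_p3].
Qed.

Lemma cont3_plus u v x : cont3 u x -> cont3 v x -> cont3 (fun y => u y + v y) x.
Proof.
  intros Hu Hv e He. destruct (Hu (e / 2) ltac:(lra)) as (d1 & D1 & H1).
  destruct (Hv (e / 2) ltac:(lra)) as (d2 & D2 & H2).
  exists (Rmin d1 d2). split; [now apply Rmin_glb_lt|]. intros y Hy.
  specialize (H1 y (Rlt_le_trans _ _ _ Hy (Rmin_l _ _))).
  specialize (H2 y (Rlt_le_trans _ _ _ Hy (Rmin_r _ _))).
  replace (u y + v y - (u x + v x)) with ((u y - u x) + (v y - v x)) by ring.
  apply Rle_lt_trans with (1 := Rabs_triang _ _). lra.
Qed.

Lemma cont3_comp (g : R -> R) u x : continuity_pt g (u x) -> cont3 u x -> cont3 (fun y => g (u y)) x.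
Proof.
  intros Hg Hu e He. destruct (Hg e He) as (d & Hd & H). destruct (Hu d Hd) as (d' & Hd' & H').
  exists d'. split; [assumption|]. intros y Hy. destruct (Req_dec (u y) (u x)) as [E|Hne].
  - now rewrite E, Rminus_diag, Rabs_R0.
  - apply (H (u y)). split; [split; [exact I|auto]|]. simpl. unfold Rdist. auto.
Qed.

Lemma cont3_mult u v x : cont3 u x -> cont3 v x -> cont3 (fun y => u y * v y) x.
Proof.
  intros Hu Hv.
  assert (Sq : forall w, cont3 w x -> forall c, cont3 (fun y => c * (w y * w y)) x).
  { intros w Hw c. apply (cont3_comp (fun t => c * (t * t))); [|assumption].
    apply derivable_continuous_pt. auto_derive. exact I. }
  (* Polarisation reduces products to squares, which are compositions with a continuous function of
     one variable. *)
  replace (fun y => u y * v y) with (fun y => / 4 * ((u y + v y) * (u y + v y)) + - / 4 * ((u y + - (1) * v y) * (u y + - (1) * v y))).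
  - apply cont3_plus; apply Sq; apply cont3_plus; try assumption.
    apply (cont3_comp (fun t => - (1) * t)); [|assumption].
    apply derivable_continuous_pt. auto_derive. exact I.
  - apply functional_extensionality. intros y. field.
Qed.

(** Finite orders of smoothness, with the derivatives given existentially: sums, products and
    compositions with [flat] are handled by induction on the order, without formulas for iterated
    partial derivatives. *)
Fixpoint smoothn (n : nat) (u : R3 -> R) : Prop :=
  (forall x, cont3 u x) /\
  match n with
  | O => True
  | S m => forall i, exists v, (forall x, isd i u x (v x)) /\ smoothn m v
  end.

Lemma smoothn_cont n u : smoothn n u -> forall x, cont3 u x.
Proof. destruct n; intros H; apply H. Qed.

Lemma smoothn_pred n u : smoothn (S n) u -> smoothn n u.
Proof.
  revert u. induction n as [|n IH]; intros u [Hc H]; [split; auto|].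
  split; [assumption|]. intros i. destruct (H i) as (v & Hv & Sv). exists v. split; [assumption|]. now apply IH.
Qed.

Lemma smoothn_pd n u i : smoothn (S n) u -> (forall x, ex_pd i u x) /\ smoothn n (pd i u).
Proof.
  intros [_ H]. destruct (H i) as (v & Hv & Sv). split; [intros x; eapply isd_pd; apply Hv|].
  replace (pd i u) with v; [assumption|]. apply functional_extensionality. intros x.
  symmetry. now apply isd_pd.
Qed.

Lemma smoothn_smooth3 u : (forall n, smoothn n u) -> smooth3 u.
Proof.
  intros Hu l.
  assert (H : forall l n, smoothn (length l + n) u -> smoothn n (iterpd l u)).
  { clear l. induction l as [|i l IH]; intros n H; [exact H|].
    simpl. apply smoothn_pd. apply IH. now rewrite <- plus_n_Sm. }
  split.
  - apply (smoothn_cont 0). now apply H.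
  - intros i. apply (smoothn_pd 0). now apply H.
Qed.

Lemma smoothn_const n c : smoothn n (fun _ => c).
Proof.
  revert c. induction n as [|n IH]; intros c; (split; [intros; apply cont3_const|]); [exact I|].
  intros i. exists (fun _ => 0). split; [intros; apply isd_const|apply IH].
Qed.

Lemma smoothn_coord n j : smoothn n (co j).
Proof.
  destruct n; (split; [intros; apply cont3_coord|]); [exact I|].
  intros i. eexists. split; [intros; apply isd_coord|apply smoothn_const].
Qed.

Lemma smoothn_plus n u v : smoothn n u -> smoothn n v -> smoothn n (fun x => u x + v x).
Proof.
  revert u v. induction n as [|n IH]; intros u v [Cu Hu] [Cv Hv];
    (split; [intros; apply cont3_plus; auto|]); [exact I|].
  intros i. destruct (Hu i) as (u' & U & Su). destruct (Hv i) as (v' & V & Sv).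
  exists (fun x => u' x + v' x). split; [intros; apply isd_plus; auto|auto].
Qed.

Lemma smoothn_mult n u v : smoothn n u -> smoothn n v -> smoothn n (fun x => u x * v x).
Proof.
  revert u v. induction n as [|n IH]; intros u v Su Sv;
    (split; [intros; apply cont3_mult; eapply smoothn_cont; eassumption|]); [exact I|].
  intros i. pose proof (proj2 Su) as Hu'. pose proof (proj2 Sv) as Hv'.
  destruct (Hu' i) as (u' & U & Su'). destruct (Hv' i) as (v' & V & Sv').
  exists (fun x => u' x * v x + u x * v' x). split; [intros; now apply isd_mult|].
  apply smoothn_plus; apply IH; try assumption; now apply smoothn_pred.
Qed.

Lemma is_derive_continuity g x l : is_derive g x l -> continuity_pt g x.
Proof.
  intros H. apply derivable_continuous_pt. exists l. now apply is_derive_Reals.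
Qed.

Lemma smoothn_flat n u : smoothn n u -> forall k, smoothn n (fun x => flat k (u x)).
Proof.
  revert u. induction n as [|n IH]; intros u Su k;
    (split; [intros x; apply (cont3_comp (flat k)); [eapply is_derive_continuity; apply flat_derive|eapply smoothn_cont; eassumption]|]);
    [exact I|].
  intros i. pose proof (smoothn_pred _ _ Su) as Su'. destruct Su as [Cu Hu]. destruct (Hu i) as (u' & U & Sv).
  exists (fun x => (- INR k * flat (S k) (u x) + flat (S (S k)) (u x)) * u' x). split.
  - intros x. apply isd_comp; [apply U|apply flat_derive].
  - apply smoothn_mult; [|assumption]. apply smoothn_plus; [|now apply IH].
    apply smoothn_mult; [apply smoothn_const|now apply IH].
Qed.

Definition nsq (x : R3) : R := p1 x * p1 x + p2 x * p2 x + p3 x * p3 x.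

Lemma nsq_nonneg x : 0 <= nsq x.
Proof. unfold nsq. nra. Qed.

Lemma smoothn_nsq n : smoothn n nsq.
Proof.
  apply smoothn_plus; [apply smoothn_plus|]; apply smoothn_mult;
    solve [apply (smoothn_coord n Defs.C1)|apply (smoothn_coord n Defs.C2)|apply (smoothn_coord n Defs.C3)].
Qed.

Lemma isd_nsq i x : isd i nsq x (2 * co i x).
Proof.
  assert (Q : forall j, isd i (fun y => co j y * co j y) x
    (match i, j with Defs.C1, Defs.C1 | Defs.C2, Defs.C2 | Defs.C3, Defs.C3 => 1 | _, _ => 0 end * co j x +
     co j x * match i, j with Defs.C1, Defs.C1 | Defs.C2, Defs.C2 | Defs.C3, Defs.C3 => 1 | _, _ => 0 end)).
  { intros j. apply isd_mult; apply isd_coord. }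
  pose proof (isd_plus _ _ _ _ _ _ (isd_plus _ _ _ _ _ _ (Q Defs.C1) (Q Defs.C2)) (Q Defs.C3)) as H.
  match type of H with isd _ _ _ ?d => replace (2 * co i x) with d; [exact H|] end.
  destruct i; simpl; ring.
Qed.

(** * The logarithmic cutoff and its gradient *)

Section Cutoff.
Variables (e2 : R).
Hypothesis He2 : 0 < e2.

Lemma inv_nsq_derive i x : isd i (fun y => / (nsq y + e2)) x (- 2 * co i x * (/ (nsq x + e2) * / (nsq x + e2))).
Proof.
  pose proof (nsq_nonneg x).
  replace (- 2 * co i x * (/ (nsq x + e2) * / (nsq x + e2)))
    with ((- / (nsq x + e2) ^ 2) * (2 * co i x)) by (field; lra).
  apply (isd_comp i (fun t => / (t + e2))); [apply isd_nsq|]. auto_derive; [lra|]. field. lra.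
Qed.

Lemma smoothn_inv_nsq n : smoothn n (fun x => / (nsq x + e2)).
Proof.
  induction n as [|n IH].
  - split; [|exact I]. intros x. pose proof (nsq_nonneg x). apply (cont3_comp (fun t => / (t + e2))).
    + apply derivable_continuous_pt. auto_derive. lra.
    + apply (smoothn_cont 0), smoothn_nsq.
  - split; [apply (smoothn_cont n), IH|]. intros i. eexists. split; [intros; apply inv_nsq_derive|].
    apply smoothn_mult; [|now apply smoothn_mult].
    apply smoothn_mult; [apply smoothn_const|apply smoothn_coord].
Qed.

Lemma ln_nsq_derive i x : isd i (fun y => ln (nsq y + e2)) x (2 * co i x * / (nsq x + e2)).
Proof.
  pose proof (nsq_nonneg x).
  replace (2 * co i x * / (nsq x + e2)) with (/ (nsq x + e2) * (2 * co i x)) by ring.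
  apply (isd_comp i (fun t => ln (t + e2))); [apply isd_nsq|]. auto_derive; [lra|]. field. lra.
Qed.

Lemma smoothn_ln_nsq n : smoothn n (fun x => ln (nsq x + e2)).
Proof.
  assert (C : forall x, cont3 (fun x => ln (nsq x + e2)) x).
  { intros x. pose proof (nsq_nonneg x). apply (cont3_comp (fun t => ln (t + e2))).
    + apply derivable_continuous_pt. auto_derive. lra.
    + apply (smoothn_cont 0), smoothn_nsq. }
  destruct n; (split; [exact C|]); [exact I|].
  intros i. eexists. split; [intros; apply ln_nsq_derive|].
  apply smoothn_mult; [|apply smoothn_inv_nsq].
  apply smoothn_mult; [apply smoothn_const|apply smoothn_coord].
Qed.

Variable K : R.
Hypothesis HK : 0 < K.

(* Logarithmic cutoff at scales between [sqrt e2] and [1], with [K = - ln e2]. *)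
Definition cutoff (x : R3) : R := exp 1 * flat 0 (- / K * ln (nsq x + e2)).

Lemma cutoff_smooth : smooth3 cutoff.
Proof.
  apply smoothn_smooth3. intros n. apply smoothn_mult; [apply smoothn_const|].
  apply (smoothn_flat n (fun x => - / K * ln (nsq x + e2))).
  apply smoothn_mult; [apply smoothn_const|apply smoothn_ln_nsq].
Qed.

Lemma cutoff_pd i x : pd i cutoff x =
  co i x * (exp 1 * flat 2 (- / K * ln (nsq x + e2)) * (- / K) * 2 * / (nsq x + e2)).
Proof.
  apply isd_pd.
  replace (co i x * (exp 1 * flat 2 (- / K * ln (nsq x + e2)) * (- / K) * 2 * / (nsq x + e2)))
    with (0 * flat 0 (- / K * ln (nsq x + e2)) + exp 1 *
      ((- INR 0 * flat 1 (- / K * ln (nsq x + e2)) + flat 2 (- / K * ln (nsq x + e2))) *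
       (0 * ln (nsq x + e2) + - / K * (2 * co i x * / (nsq x + e2))))) by (simpl INR; ring).
  apply (isd_mult i (fun _ => exp 1) (fun y => flat 0 (- / K * ln (nsq y + e2)))); [apply isd_const|].
  apply (isd_comp i (flat 0) (fun y => - / K * ln (nsq y + e2))); [|apply flat_derive].
  apply (isd_mult i (fun _ => - / K) (fun y => ln (nsq y + e2))); [apply isd_const|apply ln_nsq_derive].
Qed.

(** The cubed gradient as a function of the squared norm. The absolute value extends it continuously
    to negative arguments, so that the integrability lemmas need no restriction of the domain. *)
Definition profile (s : R) : R :=
  (sqrt (Rabs s) * (exp 1 * flat 2 (- / K * ln (Rabs s + e2)) * / K * 2 * / (Rabs s + e2))) ^ 3.

Lemma cutoff_grad x : grad_norm cutoff x ^ 3 = profile (nsq x).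
Proof.
  unfold grad_norm, profile. f_equal. rewrite !cutoff_pd. pose proof (nsq_nonneg x) as Hq.
  rewrite (Rabs_pos_eq (nsq x)) by assumption.
  set (w := exp 1 * flat 2 (- / K * ln (nsq x + e2)) * / K * 2 * / (nsq x + e2)).
  replace (exp 1 * flat 2 (- / K * ln (nsq x + e2)) * - / K * 2 * / (nsq x + e2)) with (- w) by (unfold w; ring).
  assert (Hw : 0 <= w).
  { unfold w. pose proof (exp_pos 1). pose proof (flat_nonneg 2 (- / K * ln (nsq x + e2))).
    pose proof (Rinv_0_lt_compat K HK). assert (0 < / (nsq x + e2)) by (apply Rinv_0_lt_compat; lra).
    repeat apply Rmult_le_pos; lra. }
  replace ((co Defs.C1 x * - w) ^ 2 + (co Defs.C2 x * - w) ^ 2 + (co Defs.C3 x * - w) ^ 2) with (nsq x * (w * w))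
    by (unfold nsq; simpl; ring).
  rewrite sqrt_mult_alt by assumption. now rewrite sqrt_square.
Qed.

Lemma profile_continuous s : continuity_pt profile s.
Proof.
  assert (P : 0 < Rabs s + e2) by (pose proof (Rabs_pos s); lra).
  set (g := fun t => (sqrt t * (exp 1 * flat 2 (- / K * ln (t + e2)) * / K * 2 * / (t + e2))) ^ 3).
  assert (Cg : continuity_pt g (Rabs s)).
  { unfold g. assert (C1' : continuity_pt (fun t => flat 2 (- / K * ln (t + e2))) (Rabs s)).
    { apply (continuity_pt_comp (fun t => - / K * ln (t + e2)) (flat 2)).
      - apply derivable_continuous_pt. auto_derive. lra.
      - eapply is_derive_continuity. apply flat_derive. }
    assert (C2' : continuity_pt (fun t => / (t + e2)) (Rabs s)).
    { apply derivable_continuous_pt. auto_derive. lra. }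
    assert (C3' : continuity_pt sqrt (Rabs s)) by (apply continuity_pt_sqrt, Rabs_pos).
    apply (continuity_pt_comp (fun t => sqrt t * (exp 1 * flat 2 (- / K * ln (t + e2)) * / K * 2 * / (t + e2))) (fun z => z ^ 3)).
    - apply continuity_pt_mult; [assumption|].
      apply continuity_pt_mult; [|assumption].
      apply continuity_pt_mult; [|apply continuity_pt_const; now intros ? ?].
      apply continuity_pt_mult; [|apply continuity_pt_const; now intros ? ?].
      apply continuity_pt_mult; [apply continuity_pt_const; now intros ? ?|assumption].
    - apply derivable_continuous_pt. auto_derive. exact I. }
  exact (continuity_pt_comp Rabs g s (Rcontinuity_abs s) Cg).
Qed.

(** The gradient is at most a multiple of the inverse of [K * sqrt (s + e2)]; the 4 is the bound 2
    for [flat 2] times the 2 from differentiating the squared norm. Its cube is a regularised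
    inverse cube of the norm, borderline for integrability in space. *)
Lemma profile_bound s : 0 <= s -> profile s <= (4 * exp 1 / K) ^ 3 * / ((s + e2) * sqrt (s + e2)).
Proof.
  intros Hs. unfold profile. rewrite (Rabs_pos_eq s) by assumption.
  set (g := s + e2). assert (Hg : 0 < g) by (unfold g; lra).
  pose proof (sqrt_lt_R0 g Hg) as Sg. pose proof (sqrt_sqrt g ltac:(lra)) as Eg.
  assert (Sle : sqrt s <= sqrt g) by (apply sqrt_le_1_alt; unfold g; lra). pose proof (sqrt_pos s).
  pose proof (flat_bound 2 (- / K * ln g)) as F. simpl in F. pose proof (flat_nonneg 2 (- / K * ln g)) as F0.
  pose proof (exp_pos 1) as E1. pose proof (Rinv_0_lt_compat K HK) as K1. pose proof (Rinv_0_lt_compat g Hg) as G1.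
  set (fl := flat 2 (- / K * ln g)) in *.
  assert (Hb : sqrt s * (exp 1 * fl * / K * 2 * / g) <= sqrt g * (exp 1 * 2 * / K * 2 * / g)).
  { apply Rmult_le_compat; [assumption|repeat apply Rmult_le_pos; lra|assumption|].
    apply Rmult_le_compat_r; [lra|]. apply Rmult_le_compat_r; [lra|]. apply Rmult_le_compat_r; [lra|].
    apply Rmult_le_compat_l; lra. }
  apply Rle_trans with ((sqrt g * (exp 1 * 2 * / K * 2 * / g)) ^ 3).
  - apply pow_incr. split; [|assumption]. apply Rmult_le_pos; [assumption|]. repeat apply Rmult_le_pos; lra.
  - right. set (r := sqrt g) in *. replace g with (r * r). field. lra.
Qed.

End Cutoff.

(** * Iterated integrals of radial functions over the cube *)

Definition fiber (G : R -> R) (s : R) : R := RInt (fun c => G (s + c ^ 2)) (-1) 1.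

Lemma fiber_integrable (G : R -> R) s : (forall t, continuity_pt G t) -> ex_RInt (fun c => G (s + c ^ 2)) (-1) 1.
Proof.
  intros HG. apply (ex_RInt_continuous (V := R_CompleteNormedModule)). intros c _. apply continuity_pt_filterlim.
  apply (continuity_pt_comp (fun c => s + c ^ 2) G); [|apply HG].
  apply derivable_continuous_pt. auto_derive. exact I.
Qed.

Lemma fiber_continuous (G : R -> R) : (forall t, continuity_pt G t) -> forall s, continuity_pt (fiber G) s.
Proof.
  intros HG s e He.
  destruct (Heine_cor2 (f := G) (a := s - 1) (b := s + 2) (fun x _ => HG x) (mkposreal (e / 3) ltac:(lra))) as (d & Hd).
  exists (Rmin 1 d). split; [apply Rmin_glb_lt; [lra|apply cond_pos]|].
  intros t [_ Ht]. change (Rabs (t - s) < Rmin 1 d) in Ht. change (Rabs (fiber G t - fiber G s) < e).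
  assert (Ht1 : Rabs (t - s) < 1) by (apply Rlt_le_trans with (1 := Ht); apply Rmin_l).
  assert (Ht2 : Rabs (t - s) < d) by (apply Rlt_le_trans with (1 := Ht); apply Rmin_r).
  apply Rabs_lt_between in Ht1. unfold fiber.
  pose proof (RInt_minus (V := R_CompleteNormedModule) _ _ (-1) 1 (fiber_integrable G t HG) (fiber_integrable G s HG)) as E.
  change (RInt (fun c => G (t + c ^ 2) - G (s + c ^ 2)) (-1) 1 =
    RInt (fun c => G (t + c ^ 2)) (-1) 1 - RInt (fun c => G (s + c ^ 2)) (-1) 1) in E.
  rewrite <- E.
  apply Rle_lt_trans with ((1 - -1) * (e / 3)); [|lra].
  apply abs_RInt_le_const; [lra| |].
  - apply (ex_RInt_minus (V := R_NormedModule)); now apply fiber_integrable.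
  - intros c Hc. left. apply Hd.
    + assert (0 <= c ^ 2 <= 1) by nra. lra.
    + assert (0 <= c ^ 2 <= 1) by nra. lra.
    + replace (t + c ^ 2 - (s + c ^ 2)) with (t - s) by ring. assumption.
Qed.

Lemma fiber_le (G g : R -> R) (I0 : R) s : (forall t, continuity_pt G t) ->
  is_RInt g (-1) 1 I0 -> (forall c, -1 < c < 1 -> G (s + c ^ 2) <= g c) -> fiber G s <= I0.
Proof.
  intros HG Hg Hle. unfold fiber. rewrite <- (is_RInt_unique _ _ _ _ Hg).
  apply RInt_le; [lra|now apply fiber_integrable|now exists I0|assumption].
Qed.

Lemma is_RInt_antiderivative (F f : R -> R) :
  (forall x, -1 <= x <= 1 -> is_derive F x (f x)) -> (forall x, -1 <= x <= 1 -> continuity_pt f x) ->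
  is_RInt f (-1) 1 (F 1 - F (-1)).
Proof.
  intros HF Hf. apply (is_RInt_derive (V := R_CompleteNormedModule) F f (-1) 1).
  - intros x. rewrite Rmin_left, Rmax_right by lra. apply HF.
  - intros x. rewrite Rmin_left, Rmax_right by lra. intros Hx. apply continuity_pt_filterlim. auto.
Qed.

Lemma fiber_inv_three_halves (G : R -> R) (C e2 : R) : 0 < e2 -> 0 <= C -> (forall t, continuity_pt G t) ->
  (forall s, 0 <= s -> G s <= C * / ((s + e2) * sqrt (s + e2))) ->
  forall s, 0 <= s -> fiber G s <= 2 * C * / (s + e2).
Proof.
  intros He HC HG Hb s Hs. set (g := s + e2). assert (Hg : 0 < g) by (unfold g; lra).
  assert (Hpos : forall c, 0 < g + c ^ 2) by (intros c; pose proof (pow2_ge_0 c); lra).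
  apply Rle_trans with (C * (1 / (g * sqrt (g + 1 ^ 2))) - C * (-1 / (g * sqrt (g + (-1) ^ 2)))).
  - apply (fiber_le G (fun c => C * / ((g + c ^ 2) * sqrt (g + c ^ 2)))); [assumption| |].
    + apply (is_RInt_antiderivative (fun c => C * (c / (g * sqrt (g + c ^ 2))))).
      * intros c _. pose proof (Hpos c) as P. pose proof (sqrt_lt_R0 _ P) as S.
        pose proof (sqrt_sqrt _ (Rlt_le _ _ P)) as E.
        auto_derive.
        { repeat split; try lra; simpl in *; try lra. apply Rmult_integral_contrapositive_currified; lra. }
        simpl in *. set (w := sqrt (g + c * (c * 1))) in *.
        assert (Eg : g = w * w - c * (c * 1)) by lra.
        rewrite <- E. assert (Hg' : w * w - c * (c * 1) <> 0) by lra. rewrite Eg. field. repeat split; lra.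
      * intros c _. pose proof (Hpos c) as P. pose proof (sqrt_lt_R0 _ P) as S.
        apply derivable_continuous_pt. auto_derive. repeat split; simpl in *; try lra.
        apply Rmult_integral_contrapositive_currified; lra.
    + intros c _. apply Rle_trans with (1 := Hb (s + c ^ 2) ltac:(pose proof (pow2_ge_0 c); lra)).
      unfold g. right. replace (s + c ^ 2 + e2) with (s + e2 + c ^ 2) by ring. reflexivity.
  - replace ((-1) ^ 2) with 1 by ring. replace (1 ^ 2) with 1 by ring.
    set (w := sqrt (g + 1)). assert (Hw : 1 <= w) by (apply Rle_trans with (sqrt 1); [rewrite sqrt_1; lra|apply sqrt_le_1_alt; lra]).
    replace (C * (1 / (g * w)) - C * (-1 / (g * w))) with (2 * C * / g * / w) by (field; lra).
    rewrite <- (Rmult_1_r (2 * C * / g)) at 2. apply Rmult_le_compat_l.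
    + apply Rmult_le_pos; [lra|]. left. now apply Rinv_0_lt_compat.
    + rewrite <- Rinv_1. apply Rinv_le_contravar; lra.
Qed.

Lemma fiber_inv (G : R -> R) (C e2 : R) : 0 < e2 -> 0 <= C -> (forall t, continuity_pt G t) ->
  (forall s, 0 <= s -> G s <= C * / (s + e2)) ->
  forall s, 0 <= s -> fiber G s <= 4 * C * / sqrt (s + e2).
Proof.
  intros He HC HG Hb s Hs. set (g := s + e2). assert (Hg : 0 < g) by (unfold g; lra).
  set (w := sqrt g). assert (Hw : 0 < w) by now apply sqrt_lt_R0.
  assert (Ew : w * w = g) by (apply sqrt_sqrt; lra).
  apply Rle_trans with (C * (atan (1 / w) / w) - C * (atan (-1 / w) / w)).
  - apply (fiber_le G (fun c => C * / (g + c ^ 2))); [assumption| |].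
    + apply (is_RInt_antiderivative (fun c => C * (atan (c / w) / w))).
      * intros c _. assert (P : 0 < g + c ^ 2) by (pose proof (pow2_ge_0 c); lra).
        auto_derive; [exact I|]. simpl in *. rewrite <- Ew in *. field.
        repeat split; nra.
      * intros c _. assert (P : 0 < g + c ^ 2) by (pose proof (pow2_ge_0 c); lra).
        apply derivable_continuous_pt. auto_derive. simpl in *. lra.
    + intros c _. apply Rle_trans with (1 := Hb (s + c ^ 2) ltac:(pose proof (pow2_ge_0 c); lra)).
      unfold g. right. replace (s + c ^ 2 + e2) with (s + e2 + c ^ 2) by ring. reflexivity.
  - pose proof (atan_bound (1 / w)). pose proof (atan_bound (-1 / w)). pose proof PI_4.
    assert (0 < / w) by now apply Rinv_0_lt_compat.
    replace (C * (atan (1 / w) / w) - C * (atan (-1 / w) / w))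
      with (C * / w * (atan (1 / w) - atan (-1 / w))) by (field; lra).
    replace (4 * C * / w) with (C * / w * 4) by ring.
    apply Rmult_le_compat_l; [apply Rmult_le_pos; lra|lra].
Qed.

Lemma fiber_inv_sqrt (G : R -> R) (C e2 : R) : 0 < e2 <= 1 -> 0 <= C -> (forall t, continuity_pt G t) ->
  (forall s, 0 <= s -> G s <= C * / sqrt (s + e2)) ->
  fiber G 0 <= C * (4 - ln e2).
Proof.
  intros He HC HG Hb.
  assert (Hpos : forall c, 0 < e2 + c ^ 2) by (intros c; pose proof (pow2_ge_0 c); lra).
  assert (Hlin : forall c, 0 < c + sqrt (e2 + c ^ 2)).
  { intros c. assert (Rabs c < sqrt (e2 + c ^ 2)).
    { rewrite <- sqrt_Rsqr_abs. apply sqrt_lt_1_alt. unfold Rsqr. split; [apply Rle_0_sqr|simpl; lra]. }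
    pose proof (Rle_abs (- c)). rewrite Rabs_Ropp in *. lra. }
  apply Rle_trans with (C * ln (1 + sqrt (e2 + 1 ^ 2)) - C * ln (-1 + sqrt (e2 + (-1) ^ 2))).
  - apply (fiber_le G (fun c => C * / sqrt (e2 + c ^ 2))); [assumption| |].
    + apply (is_RInt_antiderivative (fun c => C * ln (c + sqrt (e2 + c ^ 2)))).
      * intros c _. pose proof (Hpos c) as P. pose proof (sqrt_lt_R0 _ P) as S. pose proof (Hlin c) as Q.
        auto_derive; [simpl in *; repeat split; lra|]. simpl in *. field. split; lra.
      * intros c _. pose proof (Hpos c) as P. pose proof (sqrt_lt_R0 _ P) as S.
        apply derivable_continuous_pt. auto_derive. simpl in *. repeat split; lra.
    + intros c _. apply Rle_trans with (1 := Hb (0 + c ^ 2) ltac:(pose proof (pow2_ge_0 c); lra)).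
      right. replace (0 + c ^ 2 + e2) with (e2 + c ^ 2) by ring. reflexivity.
  - pose proof (Hlin (-1)) as Q. replace ((-1) ^ 2) with 1 in * by ring. replace (1 ^ 2) with 1 by ring.
    set (w := sqrt (e2 + 1)) in *. assert (Ew : w * w = e2 + 1) by (apply sqrt_sqrt; lra).
    assert (Hw2 : w <= 2) by nra.
    rewrite <- Rmult_minus_distr_l. apply Rmult_le_compat_l; [assumption|].
    (* Since [(w + 1) * (w - 1) = e2], the difference of the boundary values is
       [2 * ln (1 + w) - ln e2]. *)
    assert (E : ln e2 = ln (1 + w) + ln (-1 + w)).
    { rewrite <- ln_mult by lra. f_equal. lra. }
    assert (ln (1 + w) <= 2).
    { pose proof (exp_ineq1_le (ln (1 + w))) as H. rewrite exp_ln in H by lra. lra. }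
    lra.
Qed.

(** Each integration lowers the singularity by half a power of [s]: from exponent [- 3 / 2] to
    [- 1], then to [- 1 / 2], then to a logarithm, which equals [K] for this [e2]. Against the
    factor [/ K ^ 3] of the gradient this leaves a bound of order [/ K ^ 2]. *)
Lemma cutoff_energy (K : R) : 0 < K ->
  cube_integral 1 (fun x => grad_norm (cutoff (exp (- K)) K) x ^ 3) <= 8 * (12 / K) ^ 3 * (4 + K).
Proof.
  intros HK. set (e2 := exp (- K)). assert (He2 : 0 < e2) by apply exp_pos.
  assert (He1 : e2 <= 1).
  { unfold e2. rewrite <- exp_0. left. apply exp_increasing. lra. }
  set (G := profile e2 K).
  assert (HG : forall t, continuity_pt G t) by (intros; now apply profile_continuous).
  pose proof (fiber_continuous G HG) as HG1. pose proof (fiber_continuous _ HG1) as HG2.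
  assert (E : cube_integral 1 (fun x => grad_norm (cutoff e2 K) x ^ 3) = fiber (fiber (fiber G)) 0).
  { unfold cube_integral. unfold fiber at 1. apply RInt_ext. intros a _.
    unfold fiber at 1. apply RInt_ext. intros b _. unfold fiber. apply RInt_ext. intros c _.
    rewrite cutoff_grad by assumption. unfold G. f_equal. unfold nsq, p1, p2, p3; cbn [fst snd]. ring. }
  rewrite E. set (C := (12 / K) ^ 3).
  assert (HC : 0 <= C) by (apply pow_le; apply Rle_mult_inv_pos; lra).
  assert (B0 : forall s, 0 <= s -> G s <= C * / ((s + e2) * sqrt (s + e2))).
  { intros s Hs. apply Rle_trans with (1 := profile_bound e2 He2 K HK s Hs).
    apply Rmult_le_compat_r.
    - left. apply Rinv_0_lt_compat. apply Rmult_lt_0_compat; [lra|]. apply sqrt_lt_R0. lra.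
    - apply pow_incr. pose proof (exp_pos 1). pose proof exp_le_3. split.
      + apply Rle_mult_inv_pos; lra.
      + apply Rmult_le_compat_r; [left; now apply Rinv_0_lt_compat|lra]. }
  assert (B1 : forall s, 0 <= s -> fiber G s <= (2 * C) * / (s + e2)).
  { apply fiber_inv_three_halves; assumption. }
  assert (B2 : forall s, 0 <= s -> fiber (fiber G) s <= 4 * (2 * C) * / sqrt (s + e2)).
  { apply fiber_inv; try assumption; lra. }
  replace (8 * C * (4 + K)) with (4 * (2 * C) * (4 - ln e2)) by (unfold e2; rewrite ln_exp; ring).
  apply fiber_inv_sqrt; try assumption; lra.
Qed.

Lemma point_cap_zero (C : R3 -> Prop) : (forall x, C x -> x = origin3) -> compact_cap_zero C.
Proof.
  intros HC. exists (fun x => norm3 x < 2). split; [|split; [|split]].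
  - intros x Hx. exists (2 - norm3 x). split; [lra|]. intros y Hy.
    rewrite !norm3_dist in *. pose proof (dist3_tri y x origin3). rewrite (dist3_sym y x) in *. lra.
  - exists 2. intros x Hx. lra.
  - intros x Hx. rewrite (HC x Hx), norm3_dist, dist3_refl. lra.
  - intros eps Heps.
    (* For [K > 4] the energy is at most [16 * 12 ^ 3 / K ^ 2], which is below [eps] because
       [K * eps > 16 * 12 ^ 3]. *)
    set (K := 4 + 16 * 12 ^ 3 / eps).
    assert (Q : 0 < 16 * 12 ^ 3 / eps) by (apply Rdiv_lt_0_compat; lra).
    assert (HK : 4 < K) by (unfold K; lra).
    set (e2 := exp (- K)). assert (He2 : 0 < e2) by apply exp_pos.
    assert (Hout : forall x, 1 <= nsq x -> cutoff e2 K x = 0).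
    { intros x Hx. unfold cutoff. rewrite flat_neg; [ring|].
      assert (0 <= ln (nsq x + e2)) by (rewrite <- ln_1; apply Rcomplements.ln_le; lra).
      assert (0 < / K) by (apply Rinv_0_lt_compat; lra). nra. }
    assert (Ensq : forall x, nsq x = norm3 x ^ 2) by (intros x; rewrite norm3_sq; unfold nsq; ring).
    exists (cutoff e2 K), 1. split; [|split].
    + split; [now apply cutoff_smooth|]. split; [|split].
      * intros x. unfold cutoff. apply Rmult_le_pos; [left; apply exp_pos|apply flat_nonneg].
      * exists (fun x => norm3 x <= 1). split; [split|split].
        -- intros x Hx. exists (norm3 x - 1). split; [lra|]. intros y Hy Hy1.
           rewrite !norm3_dist in *. pose proof (dist3_tri x y origin3). lra.
        -- exists 1. auto.
        -- intros x Hx. lra.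
        -- intros x Hx. apply Hout. rewrite Ensq. nra.
      * intros x Hx. rewrite (HC x Hx). unfold cutoff.
        (* At the origin the argument of [flat 0] is 1, and the factor [exp 1] normalises the value
           to exactly 1. *)
        replace (nsq origin3) with 0 by (unfold nsq, origin3; rewrite ?p1E, ?p2E, ?p3E; ring).
        unfold e2. rewrite Rplus_0_l, ln_exp. replace (- / K * - K) with 1 by (field; lra).
        rewrite flat_pos by lra. rewrite Rinv_1. simpl. rewrite Rmult_1_l, <- exp_plus.
        replace (1 + - (1)) with 0 by ring. rewrite exp_0. lra.
    + intros x Hx. apply Hout. apply Rnot_lt_le. intros Hlt. apply Hx. unfold nsq in Hlt.
      assert (Hone : forall a, a * a < 1 -> Rabs a <= 1) by (intros a Ha; apply Rabs_le; nra).
      repeat split; apply Hone; nra.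
    + apply Rle_lt_trans with (1 := cutoff_energy K ltac:(lra)).
      assert (HKe : 16 * 12 ^ 3 < K * eps).
      { assert (16 * 12 ^ 3 / eps * eps = 16 * 12 ^ 3) by (field; lra). unfold K. nra. }
      replace (8 * (12 / K) ^ 3 * (4 + K)) with (8 * 12 ^ 3 * (4 + K) / K ^ 3) by (field; lra).
      assert (K3 : 0 < K ^ 3) by (apply pow_lt; lra).
      apply (proj2 (Rlt_div_l _ eps (K ^ 3) K3)).
      apply Rle_lt_trans with (16 * 12 ^ 3 * K); [lra|].
      replace (eps * K ^ 3) with ((K * eps) * K * K) by ring. nra.
Qed.

Theorem theorem1p1 (L lam nu : R) (hf : R2 -> R3)
  (HL : 1 <= L)
  (Hbilip : forall a b, inQ a -> inQ b ->
      dist2 a b / L <= dist3 (hf a) (hf b) /\ dist3 (hf a) (hf b) <= L * dist2 a b)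
  (Honto : forall y, (norm3 y = 1 /\ 0 <= p3 y) <-> exists a, inQ a /\ hf a = y)
  (Hbd : forall y, (norm3 y = 1 /\ p3 y = 0) <-> exists a, onbdQ a /\ hf a = y)
  (Hsense : sense_preserving hf)
  (Hdiag : forall t, -1 <= t <= 1 ->
      p1 (hf (t, t)) = p2 (hf (t, t)) /\ p1 (hf (t, - t)) = - p2 (hf (t, - t)))
  (Hlam1 : 1 <= lam) (Hnu0 : 0 < nu)
  (Hlam : L ^ 5 < lam) (Hnu : sqrt (2 * L / lam) < nu) :
  (forall x, in_julia (zorich hf lam nu) x) /\
  (forall V : R3 -> Prop, open3 V -> (exists v, V v) ->
     forall y, y <> origin3 ->
       exists (n : nat) x, V x /\ Nat.iter n (zorich hf lam nu) x = y).
Proof.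
  (* [(nu * lam) ^ 2 >= nu ^ 2 * lam >= 2 * L >= 2], and [(4 / 3) ^ 2 = 16 / 9 < 2]. *)
  assert (Hnulam : 4 / 3 <= nu * lam).
  { assert (H0 : 0 <= 2 * L / lam) by (apply Rle_mult_inv_pos; lra).
    assert (H1 : 2 * L / lam <= nu ^ 2) by (apply (sqrt_le_iff _ nu H0); lra).
    assert (H2 : 2 * L <= nu ^ 2 * lam) by (apply (proj1 (Rle_div_l (2 * L) (nu ^ 2) lam ltac:(lra)) H1)).
    apply pow2_le_inv; [nra|]. rewrite Rpow_mult_distr.
    apply Rle_trans with (nu ^ 2 * lam * 1); [lra|].
    replace (nu ^ 2 * lam ^ 2) with (nu ^ 2 * lam * lam) by ring.
    apply Rmult_le_compat_l; lra. }
  destruct (inverse_exists hf (fun y => proj1 (Honto y))) as (Phi & HPhi).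
  split.
  (* The iterates of [U] miss at most the origin, so every compact subset of the exceptional set is
     contained in a point. *)
  - intros x U HU Ux C _ HC. apply point_cap_zero. intros y Hy. apply NNPP. intros Hne.
    apply (HC y Hy). now apply (iterates_cover L lam nu hf) with (Phi := Phi) (x := x).
  - now apply (blow_up L lam nu hf) with (Phi := Phi).
Qed.
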